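(* Let $\mathcal D$ be a relativizable first order $k$-ary dependency, defined by the first-order sentence $\mathcal D(R)$ over the signature $\{R\}$ with $R$ a $k$-ary relation symbol. Then the following are equivalent: (i) $\mathcal D(R)$ is logically equivalent to a first-order sentence of the form \[ \bigvee_{k'=1}^{l}\Big(\psi_{k'}\wedge\bigwedge_{i=1}^{n_{k'}}\exists \bar y^{k'}_i\,\forall\bar x\,(R\bar x\rightarrow\theta^{k'}_i(\bar x,\bar y^{k'}_i))\wedge\bigwedge_{j=1}^{n'_{k'}}\neg\exists\bar z^{k'}_j\,\forall\bar x\,(R\bar x\rightarrow\xi^{k'}_j(\bar x,\bar z^{k'}_j))\Big), \] where all $\psi_{k'}$ are first-order sentences over the empty signature and all $\theta^{k'}_i,\xi^{k'}_j$ are first-order formulas over the empty signature; (ii) both $\mathcal D$ and $\sim\mathcal D$ are definable in $\mathrm{FO}(\mathcal D_0,\sqcup,\mathrm{const},\mathbf{All})$; (iii) $\mathcal D$ is doubly strongly first order; (iv) both $\mathcal D$ and $\sim\mathcal D$ are strongly first order.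
   Context: Team Semantics: all first-order models have domains with at least two elements; first-order formulas are in negation normal form. A team $X$ over a model $\mathfrak M$ with domain $M$ is a set of assignments $s:V\to M$ for a fixed finite set of variables $V$; for a tuple $\bar v$ of variables in $V$, $X(\bar v)=\{s(\bar v):s\in X\}$. Satisfaction $\mathfrak M\models_X\phi$: for a first-order literal $\alpha$, iff $\mathfrak M\models_s\alpha$ (Tarskian) for all $s\in X$; $\phi_1\vee\phi_2$ iff $X=Y\cup Z$ with $\mathfrak M\models_Y\phi_1$ and $\mathfrak M\models_Z\phi_2$; $\phi_1\wedge\phi_2$ iff both hold in $X$; $\exists v\psi$ iff there is $H:X\to\mathcal P(M)\setminus\{\emptyset\}$ with $\mathfrak M\models_{X[H/v]}\psi$, where $X[H/v]=\{s[m/v]:s\in X,m\in H(s)\}$; $\forall v\psi$ iff $\mathfrak M\models_{X[M/v]}\psi$ where $X[M/v]=\{s[m/v]:s\in X,m\in M\}$. A sentence is true in $\mathfrak M$ iff it is satisfied by the team $\{\emptyset\}$ containing only the empty assignment. A $k$-ary generalized dependency is a class $\mathcal D$ of structures $(M,R)$, $R\subseteq M^k$, closed under isomorphism; the atom $\mathcal D\bar x$ ($\bar x$ a $k$-tuple of variables) is satisfied by $X$ iff $(M,X(\bar x))\in\mathcal D$. $\mathcal D$ is first order if $\mathcal D=\{(M,R):(M,R)\models\mathcal D(R)\}$ for some first-order sentence $\mathcal D(R)$. For a family $\mathcal F$ of dependencies (and possibly extra connectives), $\mathrm{FO}(\mathcal F)$ is first-order logic with Team Semantics extended by them. A family $\mathcal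 F$ is strongly first order if every sentence of $\mathrm{FO}(\mathcal F)$ is equivalent (true in the same models) to a first-order sentence; a dependency $\mathcal D$ is strongly first order if $\{\mathcal D\}$ is. Relativization: for a unary predicate $P$, $\mathfrak M\models_X\mathcal D^{(P)}\bar x$ iff $(P^{\mathfrak M},X(\bar x))\in\mathcal D$. $\mathcal D$ is relativizable if every sentence of $\mathrm{FO}(\mathcal D^{(P)})$ is equivalent to some sentence of $\mathrm{FO}(\mathcal D)$. Complement: $\sim\mathcal D=\{(M,R):(M,R)\notin\mathcal D\}$. $\mathcal D$ is doubly strongly first order iff $\{\mathcal D,\sim\mathcal D\}$ is strongly first order. Extra atoms/connectives: constancy $\mathfrak M\models_X\mathrm{const}[\bar x]$ iff $s(\bar x)=s'(\bar x)$ for all $s,s'\in X$; totality $\mathfrak M\models_X\mathbf{All}(\bar x)$ iff $X(\bar x)=M^{|\bar x|}$; $\mathcal D_0$ is the family of all $0$-ary first order dependencies $[\psi]$, $\psi$ a first-order sentence over the empty signature, with $\mathfrak M\models_X[\psi]$ iff $M\models\psi$; global disjunction $\mathfrak M\models_X\phi\sqcup\psi$ iff $\mathfrak M\models_X\phi$ or $\mathfrak M\models_X\psi$. A dependency $\mathcal E$ is definable in a logic $L$ if for every tuple $\bar x$ of distinct variables there is a formula $\phi(\bar x)$ of $L$ such that for all models $\mathfrak M$ and teams $X$ whose domain contains $\bar x$, $\mathfrak M\models_X\mathcal E\bar x$ iff $\mathfrak M\models_X\phi(\bar x)$. *)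

(* Defs.v *)
From mathcomp Require Import all_boot boolp classical_sets.

Set Implicit Arguments.
Unset Strict Implicit.
Unset Printing Implicit Defensive.

Local Open Scope classical_set_scope.

Record domain := Domain {
  carrier :> Type;
  domain_two : exists a b : carrier, a <> b }.

Record signature := Signature {
  fsym : Type;
  far : fsym -> nat;
  rsym : Type;
  rar : rsym -> nat }.

Record model (S : signature) := Model {
  dom :> domain;
  fint : forall f : fsym S, ('I_(far f) -> dom) -> dom;
  rint : forall r : rsym S, set ('I_(rar r) -> dom) }.

Arguments fint {S} m f.
Arguments rint {S} m r.

Definition sig0 : signature :=
  @Signature Empty_set (fun=> 0) Empty_set (fun=> 0).

Definition bare (M : domain) : model sig0 :=
  @Model sig0 M (fun f => match f with end) (fun r => match r with end).

Definition sigR (k : nat) : signature :=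
  @Signature Empty_set (fun=> 0) unit (fun=> k).

Definition relmodel (k : nat) (M : domain) (R : set ('I_k -> M)) :
    model (sigR k) :=
  @Model (sigR k) M (fun f => match f with end) (fun=> R).

Inductive term (S : signature) : Type :=
| Var of nat
| App (f : fsym S) of 'I_(far f) -> term S.

Arguments Var {S} _.

(* The boolean is the polarity: [false] is the negated literal. *)
Inductive literal (S : signature) : Type :=
| LEq of bool & term S & term S
| LRel (b : bool) (r : rsym S) of 'I_(rar r) -> term S.

Inductive fo (S : signature) : Type :=
| FLit of literal S
| FAnd of fo S & fo S
| FOr of fo S & fo S
| FEx of nat & fo S
| FAll of nat & fo S.

Section FreeVariables.
Variable S : signature.

Fixpoint term_fv (t : term S) : set nat :=
  match t with
  | Var x => [set x]
  | App f a => [set v | exists i, term_fv (a i) v]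
  end.

Definition literal_fv (l : literal S) : set nat :=
  match l with
  | LEq _ t u => term_fv t `|` term_fv u
  | LRel _ r a => [set v | exists i, term_fv (a i) v]
  end.

Fixpoint fo_fv (p : fo S) : set nat :=
  match p with
  | FLit l => literal_fv l
  | FAnd p q | FOr p q => fo_fv p `|` fo_fv q
  | FEx v p | FAll v p => fo_fv p `\ v
  end.

Definition fo_sentence (p : fo S) : Prop := fo_fv p = set0.

End FreeVariables.

(* Assignments are partial functions on variables; the domain of [s] is the
   set of [v] such that [s v] is not [None]. *)
Definition assignment (M : Type) := nat -> option M.

Definition empty_assignment (M : Type) : assignment M := fun=> None.

Definition upd (M : Type) (s : assignment M) (v : nat) (m : M) : assignment M :=
  fun w => if w == v then Some m else s w.

Section Tarski.
Variables (S : signature) (M : model S).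

(* [term_val s t m]: the value of [t] under [s] is defined and equal to [m]. *)
Fixpoint term_val (s : assignment M) (t : term S) : set M :=
  match t with
  | Var x => [set m | s x = Some m]
  | App f a => [set m | exists b : 'I_(far f) -> M,
                   (forall i, term_val s (a i) (b i)) /\ m = fint M f b]
  end.

Definition literal_sat (s : assignment M) (l : literal S) : Prop :=
  match l with
  | LEq b t u => exists m n : M, [/\ term_val s t m, term_val s u n &
                   if b then m = n else m <> n]
  | LRel b r a => exists c : 'I_(rar r) -> M,
                   (forall i, term_val s (a i) (c i)) /\
                   if b then rint M r c else ~ rint M r c
  end.

Fixpoint fo_sat (s : assignment M) (p : fo S) : Prop :=
  match p with
  | FLit l => literal_sat s l
  | FAnd p q => fo_sat s p /\ fo_sat s q
  | FOr p q => fo_sat s p \/ fo_sat s q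
  | FEx v p => exists m : M, fo_sat (upd s v m) p
  | FAll v p => forall m : M, fo_sat (upd s v m) p
  end.

Definition fo_true (p : fo S) : Prop := fo_sat (@empty_assignment M) p.

End Tarski.

Record dependency := Dependency {
  dep_arity : nat;
  dep_mem : forall M : domain, set ('I_dep_arity -> M) -> Prop;
  dep_iso : forall (M N : domain) (f : M -> N) (R : set ('I_dep_arity -> M)),
    bijective f -> dep_mem R -> dep_mem [set f \o a | a in R] }.

Arguments dep_mem d {M} _.

Definition defines (D : dependency) (p : fo (sigR (dep_arity D))) : Prop :=
  forall (M : domain) (R : set ('I_(dep_arity D) -> M)),
    dep_mem D R <-> fo_true (relmodel R) p.

Arguments defines D p : clear implicits.

Lemma image_comp_can (I A B : Type) (f : A -> B) (g : B -> A)
    (R : set (I -> A)) :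
  cancel f g -> [set g \o b | b in [set f \o a | a in R]] = R.
Proof.
move=> fK; apply/seteqP; split=> [_ [_ [a Ra <-] <-]|a Ra].
  by suff -> : g \o (f \o a) = a by []; apply: funext => i /=; rewrite fK.
by exists (f \o a); [exists a | apply: funext => i /=; rewrite fK].
Qed.

Lemma dep_compl_iso (D : dependency) (M N : domain) (f : M -> N)
    (R : set ('I_(dep_arity D) -> M)) :
  bijective f -> ~ dep_mem D R -> ~ dep_mem D [set f \o a | a in R].
Proof.
move=> [g fK gK] nDR DR; apply: nDR.
rewrite -(image_comp_can R fK); apply: dep_iso DR.
by exists f.
Qed.

Definition dep_compl (D : dependency) : dependency :=
  @Dependency (dep_arity D) (fun M R => ~ dep_mem D R) (@dep_compl_iso D).

Lemma dep_const_iso (k : nat) (M N : domain) (f : M -> N)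
    (R : set ('I_k -> M)) :
  bijective f -> (forall a b, R a -> R b -> a = b) ->
  forall a b, [set f \o a | a in R] a -> [set f \o a | a in R] b -> a = b.
Proof. by move=> _ Rc _ _ [a Ra <-] [b Rb <-]; rewrite (Rc a b). Qed.

Definition dep_const (k : nat) : dependency :=
  @Dependency k (fun M R => forall a b, R a -> R b -> a = b) (@dep_const_iso k).

Lemma dep_all_iso (k : nat) (M N : domain) (f : M -> N) (R : set ('I_k -> M)) :
  bijective f -> R = setT -> [set f \o a | a in R] = setT.
Proof.
move=> [g fK gK] ->; apply/seteqP; split=> // b _.
by exists (g \o b) => //; apply: funext => i /=; rewrite gK.
Qed.

Definition dep_all (k : nat) : dependency :=
  @Dependency k (fun M R => R = setT) (@dep_all_iso k).

Lemma term_val_iso (M N : domain) (f : M -> N) (g : N -> M)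
    (s : assignment M) (t : term sig0) (n : N) :
  cancel f g -> cancel g f ->
  term_val (M := bare N) (fun v => omap f (s v)) t n <->
  term_val (M := bare M) s t (g n).
Proof.
move=> fK gK; case: t => [x|[]] /=; split.
  by case: (s x) => //= m [<-]; rewrite fK.
by move=> -> /=; rewrite gK.
Qed.

Lemma fo_sat_iso (M N : domain) (f : M -> N) (s : assignment M) (p : fo sig0) :
  bijective f ->
  fo_sat (M := bare M) s p <->
  fo_sat (M := bare N) (fun v => omap f (s v)) p.
Proof.
move=> [g fK gK]; elim: p s => [l|p IHp q IHq|p IHp q IHq|v p IHp|v p IHp] s /=.
- case: l => [b t u|b []] /=; split=> [[m [n [tm un mn]]]|[m [n [tm un mn]]]].
    exists (f m), (f n); split; try by apply/(term_val_iso _ _ _ fK gK); rewrite fK.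
    by case: b mn => [->|mn /(can_inj fK)].
  exists (g m), (g n); split; try exact/(term_val_iso _ _ _ fK gK).
  by case: b mn => [->|mn /(can_inj gK)].
- by rewrite IHp IHq.
- by rewrite IHp IHq.
all: have updE m : (fun w => omap f (upd s v m w)) =
                   upd (fun w => omap f (s w)) v (f m)
  by apply: funext => w; rewrite /upd; case: eqP.
- split=> [[m /IHp]|[n pn]]; first by rewrite updE => pm; exists (f m).
  by exists (g n); apply/IHp; rewrite updE gK.
- split=> pm m; last by apply/IHp; rewrite updE.
  by rewrite -[m]gK -updE; apply/IHp.
Qed.

Lemma dep0_iso (p : fo sig0) (M N : domain) (f : M -> N) (R : set ('I_0 -> M)) :
  bijective f -> fo_true (bare M) p -> fo_true (bare N) p.
Proof. by move=> fbij /(fo_sat_iso _ _ fbij). Qed.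

Definition dep0 (p : fo sig0) : dependency :=
  @Dependency 0 (fun M _ => fo_true (bare M) p) (@dep0_iso p).

(* [(P, R)] is an element of [D] only if it is a structure at all: [P] must have
   at least two elements and [R] must be a relation over [P]. *)
Definition relativized_mem (D : dependency) (M : domain) (P : set M)
    (R : set ('I_(dep_arity D) -> M)) : Prop :=
  exists h : exists a b : {m : M | P m}, a <> b,
    (forall a, R a -> forall i, P (a i)) /\
    @dep_mem D (Domain h) [set a | R (fun i => sval (a i))].

(* [Relativized D P] is D^(P); it is only used when [P] is unary. *)
Inductive atom (S : signature) : Type :=
| Plain of dependency
| Relativized of dependency & rsym S.

Arguments Plain {S} _.

Definition atom_dep (S : signature) (a : atom S) : dependency :=
  match a with Plain D | Relativized D _ => D end.

Definition atom_mem (S : signature) (M : model S) (a : atom S) :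
    set ('I_(dep_arity (atom_dep a)) -> M) -> Prop :=
  match a with
  | Plain D => fun R => dep_mem D R
  | Relativized D P => fun R => relativized_mem [set m | rint M P (fun=> m)] R
  end.

Inductive tform (S : signature) : Type :=
| TLit of literal S
| TAtom (a : atom S) of 'I_(dep_arity (atom_dep a)) -> nat
| TAnd of tform S & tform S
| TOr of tform S & tform S
| TGOr of tform S & tform S
| TEx of nat & tform S
| TAll of nat & tform S.

Fixpoint tform_fv (S : signature) (p : tform S) : set nat :=
  match p with
  | TLit l => literal_fv l
  | TAtom _ x => range x
  | TAnd p q | TOr p q | TGOr p q => tform_fv p `|` tform_fv q
  | TEx v p | TAll v p => tform_fv p `\ v
  end.

Definition tform_sentence (S : signature) (p : tform S) : Prop :=
  tform_fv p = set0.

Definition team_on (M : Type) (V : seq nat) (X : set (assignment M)) : Prop :=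
  forall s, X s -> forall v, isSome (s v) = (v \in V).

Definition team_rel (M : Type) (X : set (assignment M)) (k : nat)
    (x : 'I_k -> nat) : set ('I_k -> M) :=
  [set a | exists2 s, X s & forall i, s (x i) = Some (a i)].

Section TeamSemantics.
Variables (S : signature) (M : model S).

Fixpoint team_sat (X : set (assignment M)) (p : tform S) : Prop :=
  match p with
  | TLit l => forall s, X s -> literal_sat s l
  | TAtom a x => atom_mem (team_rel X x)
  | TAnd p q => team_sat X p /\ team_sat X q
  | TOr p q => exists Y Z, [/\ X = Y `|` Z, team_sat Y p & team_sat Z q]
  | TGOr p q => team_sat X p \/ team_sat X q
  | TEx v p => exists H : assignment M -> set M,
      (forall s, X s -> H s !=set0) /\
      team_sat [set t | exists s m, [/\ X s, H s m & t = upd s v m]] p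
  | TAll v p => team_sat [set t | exists s m, X s /\ t = upd s v m] p
  end.

Definition team_true (p : tform S) : Prop :=
  team_sat [set @empty_assignment M] p.

End TeamSemantics.

(* The formulas whose dependency atoms are all in [A]; the boolean tells whether
   global disjunction is allowed. *)
Fixpoint in_logic (S : signature) (A : set (atom S)) (g : bool)
    (p : tform S) : Prop :=
  match p with
  | TLit _ => True
  | TAtom a _ => A a
  | TAnd p q | TOr p q => in_logic A g p /\ in_logic A g q
  | TGOr p q => [/\ g, in_logic A g p & in_logic A g q]
  | TEx _ p | TAll _ p => in_logic A g p
  end.

Definition FO_of (F : set dependency) (S : signature) : set (tform S) :=
  [set p | in_logic (Plain @` F) false p].

Definition FO_relativized (D : dependency) (S : signature) (P : rsym S) :
    set (tform S) :=
  [set p | in_logic [set Relativized D P] false p].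

Definition D0 : set dependency := [set dep0 p | p in @fo_sentence sig0].

(* FO(D0, global disjunction, const, All) *)
Definition FO_D0_gor_const_all (S : signature) : set (tform S) :=
  [set p | in_logic (Plain @` (D0 `|` range dep_const `|` range dep_all)) true p].

Definition strongly_fo_family (F : set dependency) : Prop :=
  forall (S : signature) (p : tform S), FO_of F p -> tform_sentence p ->
    exists q : fo S, fo_sentence q /\
      forall M : model S, team_true M p <-> fo_true M q.

Definition strongly_fo (D : dependency) : Prop := strongly_fo_family [set D].

Definition doubly_strongly_fo (D : dependency) : Prop :=
  strongly_fo_family [set D; dep_compl D].

Definition relativizable (D : dependency) : Prop :=
  forall (S : signature) (P : rsym S), rar P = 1 ->
  forall p : tform S, FO_relativized D P p -> tform_sentence p ->
    exists q : tform S, [/\ FO_of [set D] q, tform_sentence q &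
      forall M : model S, team_true M p <-> team_true M q].

(* The defining formula has to make sense in all models, so it is over the empty
   signature and its truth depends only on the domain of the model. *)
Definition definable_in (L : set (tform sig0)) (E : dependency) : Prop :=
  forall x : 'I_(dep_arity E) -> nat, injective x ->
    exists p : tform sig0, [/\ L p, tform_fv p `<=` range x &
      forall (M : domain) (V : seq nat) (X : set (assignment M)),
        team_on V X -> (forall i, x i \in V) ->
        team_sat (M := bare M) X (@TAtom sig0 (Plain E) x) <->
        team_sat (M := bare M) X p].

Definition literal_neg (S : signature) (l : literal S) : literal S :=
  match l with
  | LEq b t u => LEq (~~ b) t u
  | LRel b r a => LRel (~~ b) a
  end.

(* Negation, in negation normal form. *)
Fixpoint fo_neg (S : signature) (p : fo S) : fo S :=
  match p with
  | FLit l => FLit (literal_neg l)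
  | FAnd p q => FOr (fo_neg p) (fo_neg q)
  | FOr p q => FAnd (fo_neg p) (fo_neg q)
  | FEx v p => FAll v (fo_neg p)
  | FAll v p => FEx v (fo_neg p)
  end.

Definition fo_top (S : signature) : fo S := FAll 0 (FLit (LEq true (Var 0) (Var 0))).
Definition fo_bot (S : signature) : fo S := fo_neg (fo_top S).

Definition term_lift (S : signature) (t : term sig0) : term S :=
  match t with Var x => Var x | App f _ => match f with end end.

Definition literal_lift (S : signature) (l : literal sig0) : literal S :=
  match l with
  | LEq b t u => LEq b (term_lift S t) (term_lift S u)
  | LRel _ r _ => match r with end
  end.

Fixpoint fo_lift (S : signature) (p : fo sig0) : fo S :=
  match p with
  | FLit l => FLit (literal_lift S l)
  | FAnd p q => FAnd (fo_lift S p) (fo_lift S q)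
  | FOr p q => FOr (fo_lift S p) (fo_lift S q)
  | FEx v p => FEx v (fo_lift S p)
  | FAll v p => FAll v (fo_lift S p)
  end.

Section NormalForm.
Variables (k : nat) (x : 'I_k -> nat).

(* A formula theta(x, y) over the empty signature, with its tuple y; the
   variables in x and y are pairwise distinct. *)
Record qmatrix := QMatrix {
  mx_vars : seq nat;
  mx_fo : fo sig0;
  mx_uniq : uniq (codom x ++ mx_vars);
  mx_fv : fo_fv mx_fo `<=` [set v | v \in codom x ++ mx_vars] }.

(* exists y, forall x, (R x -> theta(x, y)) *)
Definition qmatrix_fo (t : qmatrix) : fo (sigR k) :=
  foldr (@FEx _)
    (foldr (@FAll _)
       (FOr (FLit (@LRel (sigR k) false tt (fun i => Var (x i))))
            (fo_lift (sigR k) (mx_fo t)))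
       (codom x))
    (mx_vars t).

Record disjunct := Disjunct {
  dj_psi : fo sig0;
  dj_psiP : fo_sentence dj_psi;
  dj_n : nat;
  dj_theta : 'I_dj_n -> qmatrix;
  dj_n' : nat;
  dj_xi : 'I_dj_n' -> qmatrix }.

Definition disjunct_fo (d : disjunct) : fo (sigR k) :=
  FAnd (fo_lift (sigR k) (dj_psi d))
    (FAnd (\big[@FAnd _/fo_top _]_(i < dj_n d) qmatrix_fo (dj_theta i))
          (\big[@FAnd _/fo_top _]_(j < dj_n' d) fo_neg (qmatrix_fo (dj_xi j)))).

Definition normal_form (l : nat) (d : 'I_l -> disjunct) : fo (sigR k) :=
  \big[@FOr _/fo_bot _]_(i < l) disjunct_fo (d i).

End NormalForm.

Definition has_normal_form (k : nat) (p : fo (sigR k)) : Prop :=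
  exists (x : 'I_k -> nat) (l : nat) (d : 'I_l -> disjunct x),
    forall M : model (sigR k), fo_true M p <-> fo_true M (normal_form d).

(* Main.v *)
(* The normal form (i) is written directly as a team formula, which gives (ii).
   The team properties definable in FO(D0, global disjunction, const, All) are
   finite disjunctions of conditions "for some c: psi(c), all rows satisfy
   fl(., c), and for each i every m has a row satisfying rho_i(., c, m)". This
   class is closed under all the connectives and is first order on the team of
   the empty assignment, whence (iii), which contains (iv).

   For (iv) => (i), let E be strongly first order. Then "some nonempty member of
   E lies between T and Q" is an elementary property of (M, T, Q), because it is
   expressed by a sentence of FO(E); it can therefore be moved along
   ultraproducts, countable elementary submodels and isomorphisms. From this,
   (a) if E is D and also if E is its complement, no descending sequence of
   nonempty relations on a countable set lies alternately in D and outside D;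
   (b) if a member T of E is contained in a relation Q invariant under the
   permutations fixing n0 points, then for some n the closure of T under the
   permutations fixing n points is still contained in a member of E below Q.
   If D had no normal form, compactness would give R in D and R' not in D over a
   countable set that satisfy the same sentences "there are n distinct elements"
   and "exists y, forall x, R x -> theta(x, y)". Hence an invariant Q as in (b)
   contains a copy of R if and only if it contains a copy of R'. Applying (b)
   alternately to D with R and to the complement of D with R' produces a
   sequence contradicting (a). *)
Require Import Defs.
From mathcomp Require Import all_boot boolp classical_sets filter.

Set Implicit Arguments.
Unset Strict Implicit.
Unset Printing Implicit Defensive.

Local Open Scope classical_set_scope.

(** * First-order formulas *)

(** Membership in [E] becomes elementary through the lax existential quantifier: in [fam_tform] the
    relation tested by [E] is the set of values of x in an arbitrary team inside [Om], so one
    sentence quantifies over all members of [E] of a prescribed kind. Lying between T and Q is one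
    such kind; the additional variables u and i serve to index chains and to diagonalize over a list
    of sets.

    The obstacle in (b) is cardinality. T has continuum many images under the permutations of a
    countable set, and diagonalizing over unions of images requires a name in the model for each set
    of finite partial permutations. Hence [permutation_closure] works in a domain containing a copy
    of 2^nat, and there it frees only the tail of one sequence [A], every point outside [A] staying
    fixed. To reach all of nat it is applied twice: in an ultrapower of nat, to the sequence of
    standard points, which yields a relation that does not distinguish the points of an infinite
    set; and then in nat extended by 2^nat, to the sequence nat itself, the added points being
    copies of the points of that set. *)

Section Coincidence.
Variables (S : signature) (M : model S).
Implicit Types (s : assignment M).

Lemma term_val_eq s s' (t : term S) :
  (forall v, term_fv t v -> s v = s' v) -> term_val s t = term_val s' t.
Proof.
elim: t => [x|f a IH] /= ss'; first by rewrite ss'.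
have E i : term_val s (a i) = term_val s' (a i).
  by apply: IH => v va; apply: ss'; exists i.
apply: funext => m; apply: propext; split=> -[b [bv ->]]; exists b; split=> // i.
  by rewrite -E.
by rewrite E.
Qed.

Lemma literal_sat_eq s s' (l : literal S) :
  (forall v, literal_fv l v -> s v = s' v) -> literal_sat s l <-> literal_sat s' l.
Proof.
case: l => [b t u|b r a] /= ss'.
  by rewrite (@term_val_eq s s' t) ?(@term_val_eq s s' u)// => v vt; apply: ss'; [right|left].
have E i : term_val s (a i) = term_val s' (a i).
  by apply: term_val_eq => v va; apply: ss'; exists i.
by split=> -[c [cv cr]]; exists c; split=> // i; rewrite ?E// -E.
Qed.

Lemma upd_eq s s' v m w : (w <> v -> s w = s' w) -> upd s v m w = upd s' v m w.
Proof. by rewrite /upd => ss'; case: eqP. Qed.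

Lemma fo_sat_eq (p : fo S) s s' :
  (forall v, fo_fv p v -> s v = s' v) -> fo_sat s p <-> fo_sat s' p.
Proof.
elim: p s s' => [l|p IHp q IHq|p IHp q IHq|v p IHp|v p IHp] s s' /= ss'.
- exact: literal_sat_eq.
- rewrite (IHp s s') ?(IHq s s') // => v vt; apply: ss'; by [left|right].
- rewrite (IHp s s') ?(IHq s s') // => v vt; apply: ss'; by [left|right].
- have E m : fo_sat (upd s v m) p <-> fo_sat (upd s' v m) p.
    by apply: IHp => w wp; apply: upd_eq => wv; apply: ss'.
  by split=> -[m /E pm]; exists m.
- have E m : fo_sat (upd s v m) p <-> fo_sat (upd s' v m) p.
    by apply: IHp => w wp; apply: upd_eq => wv; apply: ss'.
  by split=> pm m; apply/E.
Qed.

Lemma fo_sentence_sat (p : fo S) s s' :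
  fo_sentence p -> fo_sat s p <-> fo_sat s' p.
Proof. by move=> p0; apply: fo_sat_eq => v; rewrite p0. Qed.

Lemma term_val_fun s (t : term S) m n :
  term_val s t m -> term_val s t n -> m = n.
Proof.
elim: t m n => [x|f a IH] m n /=; first by move=> -> [].
move=> [b [bv ->]] [c [cv ->]]; congr fint; apply: funext => i.
exact: IH (bv i) (cv i).
Qed.

Lemma term_val_def s (t : term S) :
  (forall v, term_fv t v -> exists m, s v = Some m) -> exists m, term_val s t m.
Proof.
elim: t => [x|f a IH] /= st; first exact: st.
have /choice[b bP] : forall i, exists m, term_val s (a i) m.
  by move=> i; apply: IH => v va; apply: st; exists i.
by exists (fint M f b), b.
Qed.

(** A literal with an undefined variable fails in both polarities, so negation is classical only
    where all the free variables have values. *)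
Lemma literal_neg_sat s (l : literal S) :
  (forall v, literal_fv l v -> exists m, s v = Some m) ->
  literal_sat s (literal_neg l) <-> ~ literal_sat s l.
Proof.
case: l => [b t u|b r a] /= sl.
  have [|m mt] := @term_val_def s t; first by move=> v vt; apply: sl; left.
  have [|n nu] := @term_val_def s u; first by move=> v vt; apply: sl; right.
  split.
    move=> [m1 [n1 [mt1 nu1 +]]] [m2 [n2 [mt2 nu2]]].
    rewrite (term_val_fun mt2 mt1) (term_val_fun nu2 nu1).
    by case: b {sl} => /=.
  move=> N; exists m, n; split=> //; case: b N {sl} => /= N.
    by move=> mn; apply: N; exists m, n.
  by apply: contrapT => mn; apply: N; exists m, n.
have /choice[c cv] : forall i, exists m, term_val s (a i) m.
  by move=> i; apply: term_val_def => v va; apply: sl; exists i.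
split.
  move=> [c1 [cv1 +]] [c2 [cv2]].
  have -> : c2 = c1 by apply: funext => i; exact: term_val_fun (cv2 i) (cv1 i).
  by case: b {sl} => /=.
move=> N; exists c; split=> //; case: b N {sl} => /= N.
  by move=> cr; apply: N; exists c.
by apply: contrapT => cr; apply: N; exists c.
Qed.

Lemma upd_def s v m (V : set nat) :
  (forall w, (V `\ v) w -> exists n, s w = Some n) ->
  forall w, V w -> exists n, upd s v m w = Some n.
Proof.
move=> sV w Vw; rewrite /upd; case: eqP => [_|wv]; first by exists m.
exact: sV.
Qed.

Lemma fo_neg_sat (p : fo S) s :
  (forall v, fo_fv p v -> exists m, s v = Some m) ->
  fo_sat s (fo_neg p) <-> ~ fo_sat s p.
Proof.
elim: p s => [l|p IHp q IHq|p IHp q IHq|v p IHp|v p IHp] s /= sp.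
- exact: literal_neg_sat.
- rewrite IHp ?IHq; first by rewrite -not_andP.
    by move=> v vq; apply: sp; right.
  by move=> v vq; apply: sp; left.
- rewrite IHp ?IHq; first by rewrite -not_orP.
    by move=> v vq; apply: sp; right.
  by move=> v vq; apply: sp; left.
- split=> [pm [m]|N m]; apply/IHp => //; try exact: upd_def.
  by move=> pm; apply: N; exists m.
- split=> [[m]|/existsNP[m pm]]; last by exists m; apply/IHp => //; apply: upd_def.
  by move=> /IHp H N; apply: H => //; apply: upd_def.
Qed.

End Coincidence.

Lemma literal_neg_fv (S : signature) (l : literal S) :
  literal_fv (literal_neg l) = literal_fv l.
Proof. by case: l. Qed.

Lemma fo_neg_fv (S : signature) (p : fo S) : fo_fv (fo_neg p) = fo_fv p.
Proof.
by elim: p => //= [l|p -> q ->|p -> q ->|v p ->|v p ->] //; exact: literal_neg_fv.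
Qed.

Lemma fo_neg_true (S : signature) (M : model S) (p : fo S) :
  fo_sentence p -> fo_true M (fo_neg p) <-> ~ fo_true M p.
Proof. by move=> p0; apply: fo_neg_sat => v; rewrite p0. Qed.

Lemma term_bound (S : signature) (t : term S) :
  exists B : nat, forall v, term_fv t v -> v < B.
Proof.
elim: t => [x|f a IH] /=; first by exists x.+1 => v ->.
have [b bP] := choice IH.
exists (\max_i b i) => v [i /bP vb]; exact: leq_trans vb (leq_bigmax i).
Qed.

Lemma literal_bound (S : signature) (l : literal S) :
  exists B : nat, forall v, literal_fv l v -> v < B.
Proof.
case: l => [b t u|b r a] /=.
  have [B BP] := term_bound t; have [C CP] := term_bound u.
  exists (maxn B C) => v [/BP|/CP] vb; rewrite leq_max vb ?orbT//.
have [b' bP] := choice (fun i => term_bound (a i)).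
exists (\max_i b' i) => v [i /bP vb]; exact: leq_trans vb (leq_bigmax i).
Qed.

Lemma fo_bound (S : signature) (p : fo S) :
  exists B : nat, forall v, fo_fv p v -> v < B.
Proof.
elim: p => [l|p [B BP] q [C CP]|p [B BP] q [C CP]|v p [B BP]|v p [B BP]] /=.
- exact: literal_bound.
- exists (maxn B C) => v [/BP|/CP] vb; rewrite leq_max vb ?orbT//.
- exists (maxn B C) => v [/BP|/CP] vb; rewrite leq_max vb ?orbT//.
- by exists B => w [/BP].
- by exists B => w [/BP].
Qed.

(** * Blocks of quantifiers, lifted formulas and finite connectives *)

Section Blocks.
Variable M : Type.

Fixpoint updl (s : assignment M) (vs : seq nat) (ms : seq M) : assignment M :=
  match vs, ms with
  | v :: vs', m :: ms' => updl (upd s v m) vs' ms'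
  | _, _ => s
  end.

Lemma updl_notin s vs ms w : w \notin vs -> updl s vs ms w = s w.
Proof.
elim: vs ms s => [|v vs IH] [|m ms] s //=.
rewrite inE negb_or => /andP[wv wvs]; rewrite IH // /upd.
by rewrite (negbTE wv).
Qed.

Lemma updl_in s s' vs ms w : size ms = size vs -> w \in vs ->
  updl s vs ms w = updl s' vs ms w.
Proof.
elim: vs ms s s' => [|v vs IH] [|m ms] s s' //= [sz].
rewrite inE; have [wvs _|wvs /orP[/eqP <-|//]] := boolP (w \in vs).
  exact: IH.
by rewrite !updl_notin // /upd eqxx.
Qed.

Lemma updl_nth m0 s vs ms i : uniq vs -> size ms = size vs -> i < size vs ->
  updl s vs ms (nth 0 vs i) = Some (nth m0 ms i).
Proof.
elim: vs ms s i => [|v vs IH] [|m ms] s [|i] //= /andP[vvs u] [sz] ivs.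
  by rewrite updl_notin // /upd eqxx.
exact: IH.
Qed.

End Blocks.

Lemma fo_sat_exs (S : signature) (M : model S) (p : fo S) vs (s : assignment M) :
  fo_sat s (foldr (@FEx S) p vs) <->
  exists2 ms, size ms = size vs & fo_sat (updl s vs ms) p.
Proof.
elim: vs s => [|v vs IH] s /=.
  by split=> [ps|[[|m ms] //]]; exists [::].
split=> [[m /IH[ms sz pm]]|[[//|m ms] /= [sz] pm]].
  by exists (m :: ms) => //=; rewrite sz.
by exists m; apply/IH; exists ms.
Qed.

Lemma fo_sat_alls (S : signature) (M : model S) (p : fo S) vs (s : assignment M) :
  fo_sat s (foldr (@FAll S) p vs) <->
  forall ms, size ms = size vs -> fo_sat (updl s vs ms) p.
Proof.
elim: vs s => [|v vs IH] s /=.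
  by split=> [ps [|//]|/(_ [::])]; last apply.
split=> [pm [//|m ms] /= [sz]|pm m]; first by have /IH/(_ ms sz) := pm m.
by apply/IH => ms sz; apply: (pm (m :: ms)); rewrite /= sz.
Qed.

Lemma fo_exs_fv (S : signature) (p : fo S) vs :
  fo_fv (foldr (@FEx S) p vs) = fo_fv p `\` [set v | v \in vs].
Proof.
elim: vs => [|v vs IH] /=; first by apply/seteqP; split=> [w|w []//]; split.
rewrite IH; apply/seteqP; split=> w /=.
  by move=> [[pw /negP wvs] /= wv]; split=> //=; rewrite inE => /orP[/eqP|/(negP wvs)].
move=> [pw /negP]; rewrite inE negb_or => /andP[/eqP wv /negP wvs].
by split=> //; split.
Qed.

Lemma fo_alls_fv (S : signature) (p : fo S) vs :
  fo_fv (foldr (@FAll S) p vs) = fo_fv p `\` [set v | v \in vs].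
Proof. by rewrite -fo_exs_fv; elim: vs => //= v vs ->. Qed.

Lemma term_lift_val (S : signature) (M : model S) (s : assignment M) t :
  term_val s (term_lift S t) = term_val (M := bare M) s t.
Proof. by case: t => [x|[]]. Qed.

Lemma fo_lift_sat (S : signature) (M : model S) (p : fo sig0) (s : assignment M) :
  fo_sat s (fo_lift S p) <-> fo_sat (M := bare M) s p.
Proof.
elim: p s => [l|p IHp q IHq|p IHp q IHq|v p IHp|v p IHp] s /=.
- by case: l => [b t u|b []] /=; rewrite !term_lift_val.
- by rewrite IHp IHq.
- by rewrite IHp IHq.
- by split=> -[m /IHp pm]; exists m.
- by split=> pm m; apply/IHp.
Qed.

Lemma fo_lift_fv (S : signature) (p : fo sig0) : fo_fv (fo_lift S p) = fo_fv p.
Proof.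
elim: p => [l|p /= -> q ->|p /= -> q ->|v p /= ->|v p /= ->] //=.
by case: l => [b [x|[]] [y|[]]|b []].
Qed.

Lemma fo_top_sat (S : signature) (M : model S) (s : assignment M) :
  fo_sat s (fo_top S).
Proof. by move=> m; exists m, m; split; rewrite //= /upd eqxx. Qed.

Lemma fo_bot_sat (S : signature) (M : model S) (s : assignment M) :
  ~ fo_sat s (fo_bot S).
Proof.
move=> /fo_neg_sat; apply; last exact: fo_top_sat.
by move=> v /= [[->|->]].
Qed.

Lemma fo_top_sentence (S : signature) : fo_sentence (fo_top S).
Proof. by apply/seteqP; split=> // v /= [[->|->]]. Qed.

Lemma fo_bigand_sat (S : signature) (M : model S) (s : assignment M)
    (I : Type) (r : seq I) (P : pred I) (F : I -> fo S) :
  fo_sat s (\big[@FAnd S/fo_top S]_(i <- r | P i) F i) <->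
  foldr (fun i A => (P i -> fo_sat s (F i)) /\ A) True r.
Proof.
elim: r => [|i r IH]; first by rewrite big_nil /=; split=> // _; apply: fo_top_sat.
rewrite big_cons; case: ifP => Pi /=; rewrite IH; first by split=> -[]; auto.
by rewrite Pi; split=> [|[]].
Qed.

Lemma fo_bigor_sat (S : signature) (M : model S) (s : assignment M)
    (I : Type) (r : seq I) (P : pred I) (F : I -> fo S) :
  fo_sat s (\big[@FOr S/fo_bot S]_(i <- r | P i) F i) <->
  foldr (fun i A => (P i /\ fo_sat s (F i)) \/ A) False r.
Proof.
elim: r => [|i r IH]; first by rewrite big_nil /=; split=> //; apply: fo_bot_sat.
rewrite big_cons; case: ifP => Pi /=; rewrite IH; first by rewrite Pi; split=> [[]|[[]|]]; auto.
by rewrite Pi; split=> [|[[]|]] //; right.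
Qed.

Lemma foldr_andP (I : eqType) (P : I -> Prop) (r : seq I) :
  foldr (fun i A => P i /\ A) True r <-> forall i, i \in r -> P i.
Proof.
elim: r => [|i r IH] //=; rewrite IH; split=> [[Pi Pr] j|Pr].
  by rewrite inE => /orP[/eqP ->|/Pr].
by split=> [|j jr]; apply: Pr; rewrite inE ?eqxx ?jr ?orbT.
Qed.

Lemma foldr_orP (I : eqType) (P : I -> Prop) (r : seq I) :
  foldr (fun i A => P i \/ A) False r <-> exists2 i, i \in r & P i.
Proof.
elim: r => [|i r IH] /=; first by split=> // -[].
rewrite IH; split=> [[Pi|[j jr Pj]]|[j]].
- by exists i; rewrite ?inE ?eqxx.
- by exists j; rewrite // inE jr orbT.
- by rewrite inE => /orP[/eqP ->|jr Pj]; [left|right; exists j].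
Qed.

Lemma fo_bigand_satP (S : signature) (M : model S) (s : assignment M)
    (I : finType) (P : pred I) (F : I -> fo S) :
  fo_sat s (\big[@FAnd S/fo_top S]_(i | P i) F i) <->
  forall i, P i -> fo_sat s (F i).
Proof.
rewrite fo_bigand_sat foldr_andP; split=> H i; last by move=> _; exact: H.
exact: (H i (mem_index_enum i)).
Qed.

Lemma fo_bigor_satP (S : signature) (M : model S) (s : assignment M)
    (I : finType) (P : pred I) (F : I -> fo S) :
  fo_sat s (\big[@FOr S/fo_bot S]_(i | P i) F i) <->
  exists2 i, P i & fo_sat s (F i).
Proof.
rewrite fo_bigor_sat foldr_orP; split=> [[i _ [Pi Fi]]|[i Pi Fi]]; first by exists i.
by exists i => //; exact: mem_index_enum.
Qed.

Lemma fo_bigand_sentence (S : signature) (I : finType) (P : pred I) (F : I -> fo S) :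
  (forall i, fo_sentence (F i)) ->
  fo_sentence (\big[@FAnd S/fo_top S]_(i | P i) F i).
Proof.
move=> F0; elim/big_rec: _ => [|i p _ p0]; first exact: fo_top_sentence.
by rewrite /fo_sentence /= F0 p0 setU0.
Qed.

(** * Normal team properties *)

Definition tot (M : Type) (t : nat -> M) : assignment M := fun v => Some (t v).

Definition updt (M : Type) (t : nat -> M) (v : nat) (m : M) : nat -> M :=
  fun w => if w == v then m else t w.

Lemma upd_tot (M : Type) (t : nat -> M) v m : upd (tot t) v m = tot (updt t v m).
Proof. by apply: funext => w; rewrite /upd /tot /updt; case: eqP. Qed.

(** Total valuations make definability a semantic notion: closure properties are proved without
    tracking free variables. *)
Definition fodef (S : signature) (P : forall M : model S, (nat -> M) -> Prop) :=
  exists p : fo S, forall (M : model S) (t : nat -> M), P M t <-> fo_sat (tot t) p.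

Section FODefinable.
Variable S : signature.
Implicit Types P Q : forall M : model S, (nat -> M) -> Prop.

Lemma fodef_ext P Q : (forall M t, P M t <-> Q M t) -> fodef P -> fodef Q.
Proof. by move=> PQ [p pP]; exists p => M t; rewrite -PQ. Qed.

Lemma fodef_and P Q : fodef P -> fodef Q -> fodef (fun M t => P M t /\ Q M t).
Proof. by move=> [p pP] [q qQ]; exists (FAnd p q) => M t /=; rewrite pP qQ. Qed.

Lemma fodef_or P Q : fodef P -> fodef Q -> fodef (fun M t => P M t \/ Q M t).
Proof. by move=> [p pP] [q qQ]; exists (FOr p q) => M t /=; rewrite pP qQ. Qed.

Lemma fodef_not P : fodef P -> fodef (fun M t => ~ P M t).
Proof.
move=> [p pP]; exists (fo_neg p) => M t; rewrite pP.
by rewrite fo_neg_sat // => v _; exists (t v).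
Qed.

Lemma fodef_ex v P : fodef P -> fodef (fun M t => exists m, P M (updt t v m)).
Proof.
move=> [p pP]; exists (FEx v p) => M t /=.
by split=> -[m pm]; exists m; move: pm; rewrite upd_tot pP.
Qed.

Lemma fodef_literal (l : literal S) : fodef (fun (M : model S) (t : nat -> M) => literal_sat (tot t) l).
Proof. by exists (FLit l). Qed.

Lemma fodef_eq v w : fodef (fun (M : model S) (t : nat -> M) => t v = t w).
Proof.
exists (FLit (LEq true (Var v) (Var w))) => M t /=; split=> [E|[m [n [[<-] [<-]]]]//].
by exists (t v), (t w).
Qed.

Lemma fodef_cst (A : Prop) : fodef (fun (M : model S) (_ : nat -> M) => A).
Proof.
have [a|na] := pselect A.
  by exists (fo_top S) => M t; split=> // _; exact: fo_top_sat.
by exists (fo_bot S) => M t; split=> // /fo_bot_sat.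
Qed.

Lemma fodef_finall (I : finType) (P : I -> forall M : model S, (nat -> M) -> Prop) :
  (forall i, fodef (P i)) -> fodef (fun M t => forall i, P i M t).
Proof.
move=> /choice[p pP]; exists (\big[@FAnd S/fo_top S]_i p i) => M t.
rewrite fo_bigand_satP; split=> H i; first by move=> _; apply/pP.
by apply/pP; exact: H.
Qed.

Fixpoint term_ren (f : nat -> nat) (t : term S) : term S :=
  match t with Var x => Var (f x) | App g a => App (fun i => term_ren f (a i)) end.

Lemma term_ren_val (M : model S) f (t : nat -> M) u :
  term_val (tot (t \o f)) u = term_val (tot t) (term_ren f u).
Proof.
elim: u => [x|g a IH] //=; apply: funext => m; apply: propext.
split=> -[b [bv ->]]; exists b; split=> // i.
  by rewrite -IH; exact: bv.
by rewrite IH; exact: bv.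
Qed.

(** The renaming [f] need not be injective. To avoid capture, each bound variable is moved above the
    images of the variables free in its scope. *)
Lemma fo_rename (p : fo S) (f : nat -> nat) : exists q : fo S,
  forall (M : model S) (t : nat -> M), fo_sat (tot (t \o f)) p <-> fo_sat (tot t) q.
Proof.
have fresh (r : fo S) g v : exists v' : nat,
    forall w, fo_fv r w -> w <> v -> g w <> v' :> nat.
  have [B BP] := fo_bound r; exists (\max_(i < B) g i).+1 => w /BP wB _ E.
  by have := leq_bigmax (F := fun i : 'I_B => g i) (Ordinal wB); rewrite /= E ltnn.
have updE (r : fo S) g v v' (M : model S) (t : nat -> M) m :
    (forall w, fo_fv r w -> w <> v -> g w <> v' :> nat) ->
    fo_sat (tot (updt (t \o g) v m)) r <->
    fo_sat (tot (updt t v' m \o updt g v v')) r.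
  move=> fr; apply: fo_sat_eq => w rw; rewrite /tot /updt /=.
  case: (w =P v) => [_|wv]; first by rewrite eqxx.
  by case: eqP => // E; case: (fr w rw wv).
elim: p f => [l|p IHp q IHq|p IHp q IHq|v p IHp|v p IHp] f.
- case: l => [b u w|b r a].
    by exists (FLit (LEq b (term_ren f u) (term_ren f w))) => M t /=; rewrite -!term_ren_val.
  exists (FLit (LRel b (fun i => term_ren f (a i)))) => M t /=.
  split=> -[c [cv cr]]; exists c; split=> // i.
    by rewrite -term_ren_val; exact: cv.
  by rewrite term_ren_val; exact: cv.
- have [p' pP] := IHp f; have [q' qP] := IHq f.
  by exists (FAnd p' q') => M t /=; rewrite pP qP.
- have [p' pP] := IHp f; have [q' qP] := IHq f.
  by exists (FOr p' q') => M t /=; rewrite pP qP.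
- have [v' fr] := fresh p f v; have [p' pP] := IHp (updt f v v').
  exists (FEx v' p') => M t /=; split=> -[m pm]; exists m; move: pm.
    by rewrite !upd_tot => /(updE _ _ _ _ _ _ _ fr)/pP.
  by rewrite !upd_tot => /pP/(updE _ _ _ _ _ _ _ fr).
- have [v' fr] := fresh p f v; have [p' pP] := IHp (updt f v v').
  exists (FAll v' p') => M t /=; split=> pm m; move: (pm m).
    by rewrite !upd_tot => /(updE _ _ _ _ _ _ _ fr)/pP.
  by rewrite !upd_tot => /pP/(updE _ _ _ _ _ _ _ fr).
Qed.

Lemma fodef_rename f P : fodef P -> fodef (fun M t => P M (t \o f)).
Proof.
by move=> [p pP]; have [q qP] := fo_rename p f; exists q => M t; rewrite pP qP.
Qed.

(** The defining formula has finitely many free variables, so the infinite block of quantifiers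
    reduces to a finite one, built by induction on the bound [B]. *)
Lemma fodef_exs (b : pred nat) P : fodef P ->
  fodef (fun M t => exists2 t', forall v, ~~ b v -> t' v = t v & P M t').
Proof.
move=> Pd; have [p pP] := Pd; have [B BP] := fo_bound p.
pose Q n (M : model S) (t : nat -> M) :=
  exists2 t', forall v, ~~ (b v && (v < n)) -> t' v = t v & P M t'.
suff: fodef (Q B).
  apply: fodef_ext => M t; split=> -[t' t't Pt'].
    by exists t' => // v nb; apply: t't; rewrite (negbTE nb).
  exists (fun v => if v < B then t' v else t v).
    by move=> v; case: ltnP => // vB; rewrite andbT => /t't.
  apply/pP; move: Pt' => /pP; apply fo_sat_eq => v /BP vB.
  by rewrite /tot vB.
elim: B {BP} => [|n IH].
  apply: fodef_ext Pd => M t; split=> [Pt|[t' t't]]; first by exists t.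
  by have -> : t' = t by apply: funext => v; apply: t't; rewrite andbF.
have [bn|nbn] := boolP (b n).
  apply: fodef_ext (fodef_ex n IH) => M t; split=> [[m [t' t't Pt']]|[t' t't Pt']].
    exists t' => // v; rewrite ltnS leq_eqVlt negb_and negb_or => H.
    rewrite t't /updt; last by rewrite negb_and; case/orP: H => [->//|/andP[_ ->]]; rewrite orbT.
    by case: eqP => // E; move: H; rewrite E bn eqxx.
  exists (t' n), t' => // v H; rewrite /updt; case: (v =P n) => [->//|vn].
  apply: t't; move: H; rewrite !negb_and => /orP[->//|]; rewrite -leqNgt => nv.
  by rewrite -leqNgt ltn_neqAle nv andbT orbC eq_sym; move/eqP: vn => ->.
apply: fodef_ext IH => M t; split=> -[t' t't Pt']; exists t' => // v H; apply: t't;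
  move: H; rewrite !negb_and => /orP[->//|]; rewrite -!leqNgt => nv.
  by rewrite (ltnW nv) orbT.
by rewrite leq_eqVlt in nv; case/orP: nv => [/eqP <-|->]; rewrite ?nbn ?orbT.
Qed.

Lemma fodef_alls (b : pred nat) P : fodef P ->
  fodef (fun M t => forall t', (forall v, ~~ b v -> t' v = t v) -> P M t').
Proof.
move=> /fodef_not/(fodef_exs b)/fodef_not; apply: fodef_ext => M t.
split=> [H t' t't|H [t' /H]//]; apply: contrapT => nP; apply: H.
by exists t'.
Qed.

(** The property ignores the valuation and the domain is nonempty, so universal quantifiers over all
    possibly free variables do not change its truth. *)
Lemma fodef_sentence (P : model S -> Prop) :
  fodef (fun M _ => P M) ->
  exists q : fo S, fo_sentence q /\ forall M : model S, P M <-> fo_true M q.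
Proof.
move=> [p pP]; have [B BP] := fo_bound p.
exists (foldr (@FAll S) p (iota 0 B)); split.
  rewrite /fo_sentence fo_alls_fv; apply/seteqP; split=> // v [/BP vB].
  by apply; rewrite /= mem_iota.
move=> M; have [a _] := domain_two M; rewrite /fo_true fo_sat_alls; split=> [PM ms sz|H].
  suff : fo_sat (tot (fun v => odflt a (updl (@empty_assignment M) (iota 0 B) ms v))) p.
    apply fo_sat_eq => v /BP vB; rewrite /tot.
    have -> : v = nth 0 (iota 0 B) v by rewrite nth_iota.
    by rewrite (updl_nth a) ?iota_uniq // size_iota.
  exact/pP.
apply/(pP M (fun=> a)).
have := H (nseq B a); rewrite size_nseq size_iota => /(_ erefl).
apply fo_sat_eq => v /BP vB; rewrite /tot.
have -> : v = nth 0 (iota 0 B) v by rewrite nth_iota.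
by rewrite (updl_nth a) ?iota_uniq ?size_nseq ?size_iota // nth_nseq vB.
Qed.

End FODefinable.

(* The triple of valuations [s], [c], [m] is read off from one valuation, on the
   variables congruent to 0, 1 and 2 modulo 3. *)
Definition fodef3 (S : signature)
    (P : forall M : model S, (nat -> M) -> (nat -> M) -> (nat -> M) -> Prop) :=
  fodef (fun M t => P M (fun v => t (3 * v)) (fun v => t (3 * v + 1))
                        (fun v => t (3 * v + 2))).

Section Fodef3.
Variable S : signature.
Implicit Types P Q : forall M : model S, (nat -> M) -> (nat -> M) -> (nat -> M) -> Prop.

Definition join3 (T : Type) (f g h : nat -> T) : nat -> T := fun v =>
  match v %% 3 with 0 => f (v %/ 3) | 1 => g (v %/ 3) | _ => h (v %/ 3) end.

Lemma join3_0 T (f g h : nat -> T) v : join3 f g h (3 * v) = f v.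
Proof. by rewrite /join3 mulnC modnMl mulnK. Qed.

Lemma join3_1 T (f g h : nat -> T) v : join3 f g h (3 * v + 1) = g v.
Proof. by rewrite /join3 mulnC modnMDl divnMDl // addn0. Qed.

Lemma join3_2 T (f g h : nat -> T) v : join3 f g h (3 * v + 2) = h v.
Proof. by rewrite /join3 mulnC modnMDl divnMDl // addn0. Qed.

Lemma fodef3_ext P Q : (forall M s c m, P M s c m <-> Q M s c m) ->
  fodef3 P -> fodef3 Q.
Proof. by move=> PQ; apply: fodef_ext => M t. Qed.

Lemma fodef3_rename f g h P : fodef3 P ->
  fodef3 (fun M s c m => P M (s \o f) (c \o g) (m \o h)).
Proof.
move=> /(fodef_rename (join3 (fun v => 3 * f v) (fun v => 3 * g v + 1)
                             (fun v => 3 * h v + 2))).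
apply: fodef_ext => M t /=.
have E (A B C A' B' C' : nat -> M) : A = A' -> B = B' -> C = C' ->
  P M A B C <-> P M A' B' C' by move=> -> -> ->.
by apply: E; apply: funext => v /=; rewrite ?join3_0 ?join3_1 ?join3_2.
Qed.

Lemma fodef3_ex0 v P : fodef3 P ->
  fodef3 (fun M s c m => exists a, P M (updt s v a) c m).
Proof.
move=> /(fodef_ex (3 * v)); apply: fodef_ext => M t.
have E a : (fun w => updt t (3 * v) a (3 * w)) = updt (fun w => t (3 * w)) v a.
  by apply: funext => w; rewrite /updt eqn_pmul2l.
have E1 a : (fun w => updt t (3 * v) a (3 * w + 1)) = (fun w => t (3 * w + 1)).
  apply: funext => w; rewrite /updt; case: eqP => // /(congr1 (modn^~ 3)).
  by rewrite mulnC modnMDl mulnC modnMl.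
have E2 a : (fun w => updt t (3 * v) a (3 * w + 2)) = (fun w => t (3 * w + 2)).
  apply: funext => w; rewrite /updt; case: eqP => // /(congr1 (modn^~ 3)).
  by rewrite mulnC modnMDl mulnC modnMl.
by split=> -[a]; rewrite ?E ?E1 ?E2 => Pa; exists a; rewrite ?E ?E1 ?E2.
Qed.

Lemma fodef3_not P : fodef3 P -> fodef3 (fun M s c m => ~ P M s c m).
Proof. exact: fodef_not. Qed.

Lemma fodef3_and P Q : fodef3 P -> fodef3 Q ->
  fodef3 (fun M s c m => P M s c m /\ Q M s c m).
Proof. exact: fodef_and. Qed.

Lemma fodef3_or P Q : fodef3 P -> fodef3 Q ->
  fodef3 (fun M s c m => P M s c m \/ Q M s c m).
Proof. exact: fodef_or. Qed.

Lemma fodef3_all0 v P : fodef3 P ->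
  fodef3 (fun M s c m => forall a, P M (updt s v a) c m).
Proof.
move=> /fodef3_not/(fodef3_ex0 v)/fodef3_not; apply: fodef3_ext => M s c m.
split=> [H a|H [a]]; last by apply.
by apply: contrapT => nP; apply: H; exists a.
Qed.

Lemma fodef3_of0 (P : forall M : model S, (nat -> M) -> Prop) :
  fodef P -> fodef3 (fun M s _ _ => P M s).
Proof. exact: fodef_rename. Qed.

Lemma fodef3_ex1 P : fodef3 P ->
  fodef3 (fun M s _ m => exists c, P M s c m).
Proof.
move=> /(fodef_exs (fun v => v %% 3 == 1)); apply: fodef_ext => M t.
split=> [[t' t't Pt']|[c Pc]].
  exists (fun v => t' (3 * v + 1)); move: Pt'.
  have E : (fun v => t' (3 * v)) = (fun v => t (3 * v)).
    by apply: funext => v; apply: t't; rewrite mulnC modnMl.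
  have E2 : (fun v => t' (3 * v + 2)) = (fun v => t (3 * v + 2)).
    by apply: funext => v; apply: t't; rewrite mulnC modnMDl.
  by rewrite E E2.
exists (fun v => if v %% 3 == 1 then c (v %/ 3) else t v).
  by move=> v /negbTE ->.
move: Pc.
have E (A B C A' B' C' : nat -> M) : A = A' -> B = B' -> C = C' ->
  P M A B C -> P M A' B' C' by move=> -> -> ->.
by apply: E; apply: funext => v; rewrite mulnC ?modnMl ?modnMDl // divnMDl // addn0.
Qed.

Lemma fodef3_all2 P : fodef3 P ->
  fodef3 (fun M s c _ => forall m, P M s c m).
Proof.
move=> /(fodef_alls (fun v => v %% 3 == 2)); apply: fodef_ext => M t.
have E (A B C A' B' C' : nat -> M) : A = A' -> B = B' -> C = C' ->
  P M A B C -> P M A' B' C' by move=> -> -> ->.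
split=> [H m|H t' t't].
  move: (H (fun v => if v %% 3 == 2 then m (v %/ 3) else t v)).
  move=> /(_ (fun v nv => ifN _ _ nv)).
  by apply: E; apply: funext => v; rewrite mulnC ?modnMl ?modnMDl // divnMDl // addn0.
move: (H (fun v => t' (3 * v + 2))); apply: E => //.
  by apply: funext => v; rewrite t't // mulnC modnMl.
by apply: funext => v; rewrite t't // mulnC modnMDl.
Qed.

End Fodef3.

Definition teamprop (S : signature) := forall M : model S, set (nat -> M) -> Prop.

Definition nf_basic (S : signature) (Q : teamprop S) : Prop :=
  exists (I : finType) (psi : forall M : model S, (nat -> M) -> Prop)
    (fl : forall M : model S, (nat -> M) -> (nat -> M) -> Prop)
    (rho : I -> forall M : model S, (nat -> M) -> (nat -> M) -> (nat -> M) -> Prop),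
  [/\ fodef3 (fun M _ c _ => psi M c), fodef3 (fun M s c _ => fl M s c),
      forall i, fodef3 (rho i) &
      forall M X, Q M X <-> exists c, [/\ psi M c, forall s, X s -> fl M s c &
        forall i m, exists2 s, X s & rho i M s c m]].

Inductive nf (S : signature) : teamprop S -> Prop :=
| NfBasic Q of nf_basic Q : nf Q
| NfOr Q Q' of nf Q & nf Q' : nf (fun M X => Q M X \/ Q' M X)
| NfExt Q Q' of nf Q & (forall M X, Q M X <-> Q' M X) : nf Q'.

Section NormalTeamProperties.
Variable S : signature.
Implicit Types Q : teamprop S.

(** Packs the parameters of two properties into one valuation [c], on the even and the odd
    variables. *)
Definition join2 (T : Type) (f g : nat -> T) : nat -> T := fun v =>
  if odd v then g v./2 else f v./2.

Lemma join2_even T (f g : nat -> T) : join2 f g \o double = f.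
Proof. by apply: funext => v; rewrite /join2 /= odd_double doubleK. Qed.

Lemma join2_odd T (f g : nat -> T) : join2 f g \o (fun v => v.*2.+1) = g.
Proof. by apply: funext => v; rewrite /join2 /= odd_double uphalf_double. Qed.

Definition tsplit Q Q' : teamprop S := fun M X =>
  exists Y Z, [/\ X = Y `|` Z, Q M Y & Q' M Z].

Definition tand Q Q' : teamprop S := fun M X => Q M X /\ Q' M X.

Definition tex v Q : teamprop S := fun M X =>
  exists H : (nat -> M) -> set M, (forall s, X s -> H s !=set0) /\
    Q M [set t | exists s m, [/\ X s, H s m & t = updt s v m]].

Definition tall v Q : teamprop S := fun M X =>
  Q M [set t | exists s m, X s /\ t = updt s v m].

Definition tren (f : nat -> nat) Q : teamprop S := fun M X =>
  Q M [set t \o f | t in X].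

Let even_r P : @fodef3 S P -> fodef3 (fun M s c m => P M s (c \o double) m).
Proof. exact: (@fodef3_rename S id double id). Qed.

Let odd_r P : @fodef3 S P -> fodef3 (fun M s c m => P M s (c \o (fun v => v.*2.+1)) m).
Proof. exact: (@fodef3_rename S id (fun v => v.*2.+1) id). Qed.

Lemma nf_basic_and Q Q' : nf_basic Q -> nf_basic Q' -> nf_basic (tand Q Q').
Proof.
move=> [I [psi [fl [rho [psiP flP rhoP QP]]]]] [I' [psi' [fl' [rho' [psiP' flP' rhoP' QP']]]]].
exists (I + I')%type, (fun M c => psi M (c \o double) /\ psi' M (c \o (fun v => v.*2.+1))),
  (fun M s c => fl M s (c \o double) /\ fl' M s (c \o (fun v => v.*2.+1))),
  (fun i M s c m => match i with inl i => rho i M s (c \o double) m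
                    | inr i => rho' i M s (c \o (fun v => v.*2.+1)) m end).
split; [exact: fodef3_and (even_r psiP) (odd_r psiP')
       |exact: fodef3_and (even_r flP) (odd_r flP')| |].
  by move=> [i|i]; [exact: even_r|exact: odd_r].
move=> M X; split.
  move=> [/QP[c [c1 c2 c3]] /QP'[c' [c1' c2' c3']]]; exists (join2 c c').
  rewrite join2_even join2_odd; split=> // [s Xs|[i|i] m].
    by split; [exact: c2|exact: c2'].
    exact: c3.
  exact: c3'.
move=> [c [[p p'] f r]]; split.
  by apply/QP; exists (c \o double); split=> // [s /f[]|i m] //; exact: (r (inl i) m).
apply/QP'; exists (c \o (fun v => v.*2.+1)); split=> // [s /f[]|i m] //.
exact: (r (inr i) m).
Qed.

(* Since the flat part of each side is downward closed and the other conditions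
   are upward closed, the best split takes all the rows satisfying the flat part. *)
Lemma nf_basic_split Q Q' : nf_basic Q -> nf_basic Q' -> nf_basic (tsplit Q Q').
Proof.
move=> [I [psi [fl [rho [psiP flP rhoP QP]]]]] [I' [psi' [fl' [rho' [psiP' flP' rhoP' QP']]]]].
exists (I + I')%type, (fun M c => psi M (c \o double) /\ psi' M (c \o (fun v => v.*2.+1))),
  (fun M s c => fl M s (c \o double) \/ fl' M s (c \o (fun v => v.*2.+1))),
  (fun i M s c m => match i with
     | inl i => fl M s (c \o double) /\ rho i M s (c \o double) m
     | inr i => fl' M s (c \o (fun v => v.*2.+1)) /\
                rho' i M s (c \o (fun v => v.*2.+1)) m end).
split; [exact: fodef3_and (even_r psiP) (odd_r psiP')
       |exact: fodef3_or (even_r flP) (odd_r flP')| |].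
  by move=> [i|i]; [exact: fodef3_and (even_r flP) (even_r (rhoP i))
                   |exact: fodef3_and (odd_r flP') (odd_r (rhoP' i))].
move=> M X; split.
  move=> [Y [Z [-> /QP[c [c1 c2 c3]] /QP'[c' [c1' c2' c3']]]]]; exists (join2 c c').
  rewrite join2_even join2_odd; split=> // [s [Ys|Zs]|[i|i] m].
  - by left; exact: c2.
  - by right; exact: c2'.
  - by have [s Ys r] := c3 i m; exists s; [left|split=> //; exact: c2].
  - by have [s Ys r] := c3' i m; exists s; [right|split=> //; exact: c2'].
move=> [c [[p p'] f r]].
exists [set s | X s /\ fl M s (c \o double)],
  [set s | X s /\ fl' M s (c \o (fun v => v.*2.+1))]; split.
- apply/seteqP; split=> s /=; last by case=> -[].
  by move=> Xs; case: (f s Xs); [left|right].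
- apply/QP; exists (c \o double); split=> // [s []|i m] //.
  by have [s Xs [fs rs]] := r (inl i) m; exists s.
- apply/QP'; exists (c \o (fun v => v.*2.+1)); split=> // [s []|i m] //.
  by have [s Xs [fs rs]] := r (inr i) m; exists s.
Qed.

(** The largest choice is the best one: [H s] collects all the values that keep the flat condition.
    The other conditions only ask for witnesses, so extra rows do no harm. *)
Lemma nf_basic_ex v Q : nf_basic Q -> nf_basic (tex v Q).
Proof.
move=> [I [psi [fl [rho [psiP flP rhoP QP]]]]].
exists I, psi, (fun M s c => exists a, fl M (updt s v a) c),
  (fun i M s c m => exists a, fl M (updt s v a) c /\ rho i M (updt s v a) c m).
split=> //; first exact: (fodef3_ex0 v flP).
  by move=> i; exact: (fodef3_ex0 v (fodef3_and flP (rhoP i))).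
move=> M X; split.
  move=> [H [H0 /QP[c [c1 c2 c3]]]]; exists c; split=> // [s Xs|i m].
    by have [a Ha] := H0 s Xs; exists a; apply: c2; exists s, a.
  have [t [s [a [Xs Ha tE]]] r] := c3 i m; exists s => //; exists a.
  by rewrite -tE; split=> //; apply: c2; exists s, a.
move=> [c [p f r]]; exists (fun s => [set a | fl M (updt s v a) c]); split.
  by move=> s /f[a fa]; exists a.
apply/QP; exists c; split=> // [t [s [a [Xs fa ->]]]//|i m].
have [s Xs [a [fa ra]]] := r i m.
by exists (updt s v a) => //; exists s, a.
Qed.

(** The flat condition must survive every value of [v], while a required witness may come from any
    of them; hence a universal quantifier in [fl] and an existential one in [rho]. *)
Lemma nf_basic_all v Q : nf_basic Q -> nf_basic (tall v Q).
Proof.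
move=> [I [psi [fl [rho [psiP flP rhoP QP]]]]].
exists I, psi, (fun M s c => forall a, fl M (updt s v a) c),
  (fun i M s c m => exists a, rho i M (updt s v a) c m).
split=> //; first exact: (fodef3_all0 v flP).
  by move=> i; exact: (fodef3_ex0 v (rhoP i)).
move=> M X; split.
  move=> /QP[c [c1 c2 c3]]; exists c; split=> // [s Xs a|i m].
    by apply: c2; exists s, a.
  by have [t [s [a [Xs ->]]] r] := c3 i m; exists s => //; exists a.
move=> [c [p f r]]; apply/QP; exists c; split=> // [t [s [a [Xs ->]]]|i m].
  exact: f.
by have [s Xs [a ra]] := r i m; exists (updt s v a) => //; exists s, a.
Qed.

Lemma nf_basic_ren f Q : nf_basic Q -> nf_basic (tren f Q).
Proof.
move=> [I [psi [fl [rho [psiP flP rhoP QP]]]]].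
exists I, psi, (fun M s c => fl M (s \o f) c), (fun i M s c m => rho i M (s \o f) c m).
split=> //; first exact: (fodef3_rename f id id flP).
  by move=> i; exact: (fodef3_rename f id id (rhoP i)).
move=> M X; rewrite /tren QP; split=> -[c [p g r]]; exists c; split=> //.
- by move=> s Xs; apply: g; exists s.
- by move=> i m; have [_ [s Xs <-] rs] := r i m; exists s.
- by move=> _ [s Xs <-]; exact: g.
- by move=> i m; have [s Xs rs] := r i m; exists (s \o f) => //; exists s.
Qed.

(** An operator that commutes with disjunction and respects equivalence has to be examined on basic
    properties only. *)
Lemma nf_unary (O : teamprop S -> teamprop S) :
  (forall Q, nf_basic Q -> nf_basic (O Q)) ->
  (forall Q Q' M X, O (fun M X => Q M X \/ Q' M X) M X <-> O Q M X \/ O Q' M X) ->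
  (forall Q Q' M X, (forall X, Q M X <-> Q' M X) -> O Q M X <-> O Q' M X) ->
  forall Q, nf Q -> nf (O Q).
Proof.
move=> Ob Oor Oext Q; elim=> {Q} [Q|Q Q' _ IH _ IH'|Q Q' _ IH QQ'].
- by move=> Qb; apply: NfBasic; exact: Ob.
- by apply: NfExt (NfOr IH IH') _ => M X; rewrite Oor.
- by apply: NfExt IH _ => M X; apply: Oext.
Qed.

Lemma nf_binary (O : teamprop S -> teamprop S -> teamprop S) :
  (forall Q Q', nf_basic Q -> nf_basic Q' -> nf_basic (O Q Q')) ->
  (forall Q Q' R M X, O (fun M X => Q M X \/ Q' M X) R M X <-> O Q R M X \/ O Q' R M X) ->
  (forall Q Q' R M X, O R (fun M X => Q M X \/ Q' M X) M X <-> O R Q M X \/ O R Q' M X) ->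
  (forall Q Q' R R' M X, (forall X, Q M X <-> Q' M X) -> (forall X, R M X <-> R' M X) ->
     O Q R M X <-> O Q' R' M X) ->
  forall Q R, nf Q -> nf R -> nf (O Q R).
Proof.
move=> Ob Ol Or Oext Q R Qn; elim: Qn R => {Q} [Q Qb|Q Q' _ IH _ IH'|Q Q' _ IH QQ'] R Rn.
- apply: (nf_unary (O := O Q)) Rn => [R'|R' R'' M X|R' R'' M X RR'].
  + exact: Ob.
  + exact: Or.
  + by apply: Oext.
- by apply: NfExt (NfOr (IH R Rn) (IH' R Rn)) _ => M X; rewrite Ol.
- by apply: NfExt (IH R Rn) _ => M X; apply: Oext.
Qed.

Lemma nf_and Q Q' : nf Q -> nf Q' -> nf (tand Q Q').
Proof.
apply: nf_binary; first exact: nf_basic_and.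
- by move=> Q1 Q2 R M X; rewrite /tand; tauto.
- by move=> Q1 Q2 R M X; rewrite /tand; tauto.
- by move=> Q1 Q2 R R' M X E E'; rewrite /tand E E'.
Qed.

Lemma nf_split Q Q' : nf Q -> nf Q' -> nf (tsplit Q Q').
Proof.
apply: nf_binary; first exact: nf_basic_split.
- move=> Q1 Q2 R M X; split=> [[Y [Z [E [q|q] r]]]|[|] [Y [Z [E q r]]]].
  + by left; exists Y, Z.
  + by right; exists Y, Z.
  + by exists Y, Z; split=> //; left.
  + by exists Y, Z; split=> //; right.
- move=> Q1 Q2 R M X; split=> [[Y [Z [E r [q|q]]]]|[|] [Y [Z [E q r]]]].
  + by left; exists Y, Z.
  + by right; exists Y, Z.
  + by exists Y, Z; split=> //; left.
  + by exists Y, Z; split=> //; right.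
- by move=> Q1 Q2 R R' M X E E'; split=> -[Y [Z [? /E ? /E' ?]]]; exists Y, Z.
Qed.

Lemma nf_ex v Q : nf Q -> nf (tex v Q).
Proof.
apply: nf_unary; first exact: nf_basic_ex.
- move=> Q1 Q2 M X; split=> [[H [H0 [q|q]]]|[|] [H [H0 q]]].
  + by left; exists H.
  + by right; exists H.
  + by exists H; split=> //; left.
  + by exists H; split=> //; right.
- by move=> Q1 Q2 M X E; split=> -[H [? /E ?]]; exists H.
Qed.

Lemma nf_all v Q : nf Q -> nf (tall v Q).
Proof.
apply: nf_unary; first exact: nf_basic_all.
- by [].
- by move=> Q1 Q2 M X E; exact: E.
Qed.

Lemma nf_ren f Q : nf Q -> nf (tren f Q).
Proof.
apply: nf_unary; first exact: nf_basic_ren.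
- by [].
- by move=> Q1 Q2 M X E; exact: E.
Qed.

Lemma nf_literal (l : literal S) : nf (fun M X => forall t, X t -> literal_sat (tot t) l).
Proof.
apply: NfBasic; exists void, (fun _ _ => True), (fun M s c => literal_sat (tot s) l),
  (of_void _); split=> //.
- by apply: fodef_cst.
- exact: (fodef3_of0 (fodef_literal l)).
- move=> M X; have [a _] := domain_two M.
  by split=> [H|[c [_ H _]]//]; exists (fun=> a); split.
Qed.

(** With a single row, every required witness is that row, so the condition becomes first order.
    Renaming by [v %/ 3] makes the value read at [3 * v] equal to [t v]. *)
Lemma nf_basic_singleton Q : nf_basic Q -> fodef (fun M t => Q M [set t]).
Proof.
move=> [I [psi [fl [rho [psiP flP rhoP QP]]]]].
have rP : fodef3 (fun M s c _ => forall i, forall m, rho i M s c m).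
  by apply: fodef_finall => i; exact: fodef3_all2 (rhoP i).
have := fodef3_ex1 (fodef3_and psiP (fodef3_and flP rP)).
move=> /(fodef_rename (fun v => v %/ 3)); apply: fodef_ext => M t.
have E : (fun v => (t \o divn^~ 3) (3 * v)) = t.
  by apply: funext => v; rewrite /= mulnC mulnK.
have := E; rewrite /= => {}E; rewrite E QP; split=> -[c].
  move=> [p [f r]]; exists c; split=> // [s ->//|i m].
  by exists t.
move=> [p f r]; exists c; split=> //; split; first exact: f.
by move=> i m; have [s -> ] := r i m.
Qed.

Lemma nf_singleton Q : nf Q -> fodef (fun M t => Q M [set t]).
Proof.
elim=> {Q} [Q|Q Q' _ IH _ IH'|Q Q' _ IH QQ']; first exact: nf_basic_singleton.
  exact: fodef_or.
by apply: fodef_ext IH => M t; exact: QQ'.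
Qed.

End NormalTeamProperties.

Lemma fodef3_lift (S : signature)
    (P : forall M : model sig0, (nat -> M) -> (nat -> M) -> (nat -> M) -> Prop) :
  fodef3 P -> fodef3 (fun (M : model S) s c m => P (bare M) s c m).
Proof.
move=> [p pP]; exists (fo_lift S p) => M t; rewrite fo_lift_sat.
exact: (pP (bare M)).
Qed.

Lemma nf_lift (S : signature) (Q : teamprop sig0) :
  nf Q -> nf (fun (M : model S) X => Q (bare M) X).
Proof.
elim=> {Q} [Q [I [psi [fl [rho [psiP flP rhoP QP]]]]]|Q Q' _ IH _ IH'|Q Q' _ IH QQ'].
- apply: NfBasic; exists I, (fun M c => psi (bare M) c), (fun M s c => fl (bare M) s c),
    (fun i M s c m => rho i (bare M) s c m); split.
  + exact: fodef3_lift psiP.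
  + exact: fodef3_lift flP.
  + by move=> i; exact: fodef3_lift (rhoP i).
  + by move=> M X; rewrite QP.
- exact: NfOr.
- by apply: NfExt IH _ => M X; exact: QQ'.
Qed.

(* The relation of a team of total valuations is read on its first variables. *)
Definition nf_dep (D : dependency) : Prop :=
  exists2 Q : teamprop sig0, nf Q & forall (M : domain) (X : set (nat -> M)),
    dep_mem D [set (fun i : 'I_(dep_arity D) => t (val i)) | t in X] <-> Q (bare M) X.

(** * Team formulas as operations on sets of total valuations *)

Section Translation.
Variable S : signature.

Definition extends (M : Type) (s : assignment M) (t : nat -> M) : Prop :=
  forall v m, s v = Some m -> t v = m.

(** The correspondence is many to many: a row may have several total extensions, and rows with
    different domains may share one. *)
Definition represents (M : Type) (X : set (assignment M)) (X' : set (nat -> M)) : Prop :=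
  (forall s, X s -> exists2 t, X' t & extends s t) /\
  (forall t, X' t -> exists2 s, X s & extends s t).

Definition team_def (M : Type) (V : set nat) (X : set (assignment M)) : Prop :=
  forall s, X s -> forall v, V v -> exists m, s v = Some m.

Lemma extends_upd (M : Type) (s : assignment M) t v m :
  extends s t -> extends (upd s v m) (updt t v m).
Proof.
move=> st w n; rewrite /upd /updt; case: eqP => [_ [->//]|_]; exact: st.
Qed.

(** By induction, each team connective becomes the matching operation on sets of total valuations;
    subteams and choices are carried across [represents] in both directions. Since the free
    variables are defined in every row, literals and atoms see the same values on both sides. *)
Lemma nf_team_sat (p : tform S) (A : set dependency) (g : bool) :
  A `<=` nf_dep -> in_logic (Plain @` A) g p ->
  exists2 Q : teamprop S, nf Q & forall (M : model S) X X',
    team_def (tform_fv p) X -> represents X X' -> team_sat X p <-> Q M X'.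
Proof.
move=> An; elim: p => [l|a x|p IHp q IHq|p IHp q IHq|p IHp q IHq|v p IHp|v p IHp] /=.
- move=> _; exists (fun M X => forall t, X t -> literal_sat (tot t) l); first exact: nf_literal.
  move=> M X X' Xd [XX' X'X].
  have E s t : X s -> extends s t -> literal_sat s l <-> literal_sat (tot t) l.
    move=> Xs st; apply: literal_sat_eq => v vl; have [m sv] := Xd s Xs v vl.
    by rewrite sv /tot (st v m sv).
  split=> H t; first by move=> /X'X[s Xs st]; apply/(E s) => //; exact: H.
  by move=> Xt; have [t' X't' st] := XX' t Xt; apply/(E t t') => //; exact: H.
- move=> [D AD Da]; move: x; rewrite -Da => {a Da} x /=.
  have [Q Qn QP] := An _ AD.
  (* A relation is read on the first variables, so [f] sends the [i]-th of them to [x i]; the value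
     0 elsewhere is a placeholder. *)
  pose f v := if insub v is Some i then x i else 0.
  exists (tren f (fun (M : model S) X => Q (bare M) X)); first exact: (nf_ren f (nf_lift S Qn)).
  move=> M X X' Xd [XX' X'X]; rewrite /tren -QP.
  suff -> : team_rel X x = [set (fun i : 'I_(dep_arity D) => t (val i)) | t in [set t \o f | t in X']] by [].
  have fE (t : nat -> M) : (fun i : 'I_(dep_arity D) => (t \o f) (val i)) = t \o x.
    by apply: funext => i; rewrite /= /f insubT //= => H; congr (t (x _)); exact: val_inj.
  apply/seteqP; split=> [a [s Xs sa]|_ [_ [t X't <-] <-]].
    have [t X't st] := XX' s Xs; exists (t \o f); first by exists t.
    by rewrite fE; apply: funext => i /=; exact: st (sa i).
  have [s Xs st] := X'X t X't; exists s => // i /=.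
  have /= -> := congr1 (@^~ i) (fE t).
  have [|m sm] := Xd s Xs (x i); first by exists i.
  by rewrite sm (st _ _ sm).
- move=> [/IHp[P Pn PP] /IHq[Q Qn QP]]; exists (tand P Q); first exact: nf_and.
  move=> M X X' Xd r; rewrite /tand (PP M X X') ?(QP M X X') // => s Xs v pv.
    by apply: Xd => //; right.
  by apply: Xd => //; left.
- move=> [/IHp[P Pn PP] /IHq[Q Qn QP]]; exists (tsplit P Q); first exact: nf_split.
  move=> M X X' Xd [XX' X'X]; split.
    move=> [Y [Z [E Yp Zq]]].
    exists [set t | X' t /\ exists2 s, Y s & extends s t],
      [set t | X' t /\ exists2 s, Z s & extends s t]; split.
    + apply/seteqP; split=> t /=; last by case=> -[].
      move=> X't; have [s] := X'X t X't; rewrite E => -[Ys|Zs] st.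
        by left; split=> //; exists s.
      by right; split=> //; exists s.
    + apply/(PP _ Y) => //; first by move=> s Ys v pv; apply: Xd; [rewrite E; left|left].
      split=> [s Ys|t [_ []]//]; last by move=> s; exists s.
      have [|t X't st] := XX' s; first by rewrite E; left.
      by exists t => //; split=> //; exists s.
    + apply/(QP _ Z) => //; first by move=> s Ys v pv; apply: Xd; [rewrite E; right|right].
      split=> [s Ys|t [_ []]//]; last by move=> s; exists s.
      have [|t X't st] := XX' s; first by rewrite E; right.
      by exists t => //; split=> //; exists s.
  move=> [Y' [Z' [E Yp Zq]]].
  exists [set s | X s /\ exists2 t, Y' t & extends s t],
    [set s | X s /\ exists2 t, Z' t & extends s t]; split.
  + apply/seteqP; split=> s /=; last by case=> -[].
    move=> Xs; have [t] := XX' s Xs; rewrite E => -[Ys|Zs] st.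
      by left; split=> //; exists t.
    by right; split=> //; exists t.
  + apply/(PP _ _ Y') => //; first by move=> s [Ys _] v pv; apply: Xd => //; left.
    split=> [s [_ []]//|t Yt]; first by move=> t; exists t.
    have [|s Xs st] := X'X t; first by rewrite E; left.
    by exists s => //; split=> //; exists t.
  + apply/(QP _ _ Z') => //; first by move=> s [Ys _] v pv; apply: Xd => //; right.
    split=> [s [_ []]//|t Yt]; first by move=> t; exists t.
    have [|s Xs st] := X'X t; first by rewrite E; right.
    by exists s => //; split=> //; exists t.
- move=> [_ /IHp[P Pn PP] /IHq[Q Qn QP]]; exists (fun M X => P M X \/ Q M X); first exact: NfOr.
  move=> M X X' Xd r; rewrite (PP M X X') ?(QP M X X') // => s Xs v pv.
    by apply: Xd => //; right.
  by apply: Xd => //; left.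
- move=> /IHp[P Pn PP]; exists (tex v P); first exact: nf_ex.
  move=> M X X' Xd [XX' X'X]; split.
    move=> [H [H0 Hp]].
    (* As [t] may extend several rows, it receives the choices of all of them. *)
    exists (fun t => [set m | exists s, [/\ X s, extends s t & H s m]]); split.
      by move=> t /X'X[s Xs st]; have [m Hm] := H0 s Xs; exists m, s.
    move: Hp; apply PP; first by move=> _ [s [m [Xs Hm ->]]] w pw; apply: upd_def pw; exact: Xd.
    split=> [_ [s [m [Xs Hm ->]]]|_ [t [m [X't [s [Xs st Hm]] ->]]]].
      have [t X't st] := XX' s Xs; exists (updt t v m); last exact: extends_upd.
      by exists t, m; split=> //; exists s.
    by exists (upd s v m); [exists s, m|exact: extends_upd].
  move=> [H [H0 Hp]].
  exists (fun s => [set m | exists t, [/\ X' t, extends s t & H t m]]); split.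
    by move=> s /XX'[t X't st]; have [m Hm] := H0 t X't; exists m, t.
  move: Hp; apply PP; first by move=> _ [s [m [Xs Hm ->]]] w pw; apply: upd_def pw; exact: Xd.
  split=> [_ [s [m [Xs [t [X't st Hm]] ->]]]|_ [t [m [X't Hm ->]]]].
    by exists (updt t v m); [exists t, m|exact: extends_upd].
  have [s Xs st] := X'X t X't; exists (upd s v m); last exact: extends_upd.
  by exists s, m; split=> //; exists t.
- move=> /IHp[P Pn PP]; exists (tall v P); first exact: nf_all.
  move=> M X X' Xd [XX' X'X]; rewrite /tall; apply: PP.
    by move=> _ [s [m [Xs ->]]] w pw; apply: upd_def pw; exact: Xd.
  split=> [_ [s [m [Xs ->]]]|_ [t [m [X't ->]]]].
    have [t X't st] := XX' s Xs; exists (updt t v m); last exact: extends_upd.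
    by exists t, m.
  have [s Xs st] := X'X t X't; exists (upd s v m); last exact: extends_upd.
  by exists s, m.
Qed.

End Translation.

(** Every valuation [t] extends the empty assignment, so the truth of a sentence is its normal
    property at [[set t]], which is first order in [t] and independent of [t]. *)
Lemma nf_strongly_fo (F : set dependency) : F `<=` nf_dep -> strongly_fo_family F.
Proof.
move=> Fn S p pF p0; have [Q Qn QP] := nf_team_sat Fn pF.
apply: fodef_sentence; apply: fodef_ext (nf_singleton Qn) => M t.
rewrite -(QP M [set @empty_assignment M] [set t]) //.
  by move=> s _ v; rewrite p0.
by split=> [s ->|t' ->]; [exists t|exists (@empty_assignment M)].
Qed.

(** The parameter [c] guesses the common tuple. *)
Lemma nf_dep_const k : nf_dep (dep_const k).
Proof.
exists (fun (M : model sig0) X => exists c : nat -> M,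
    forall s, X s -> forall i : 'I_k, s (val i) = c (val i)).
  apply: NfBasic; exists void, (fun _ _ => True),
    (fun M s c => forall i : 'I_k, s (val i) = c (val i)), (of_void _).
  split=> //.
  - exact: fodef_cst.
  - by apply: fodef_finall => i; exact: fodef_eq.
  - by move=> M X; split=> [[c H]|[c [_ H _]]]; exists c.
move=> M X /=; split=> [H|[c H] _ _ [s Xs <-] [t Xt <-]].
  have [[t Xt]|/nonemptyPn X0] := pselect (X !=set0); last first.
    by have [a _] := domain_two M; exists (fun=> a) => s; rewrite X0.
  exists t => s Xs i.
  by have /(congr1 (@^~ i)) := H _ _ (ex_intro2 _ _ s Xs erefl) (ex_intro2 _ _ t Xt erefl).
by apply: funext => i; rewrite !H.
Qed.

Lemma nf_dep_all k : nf_dep (dep_all k).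
Proof.
exists (fun (M : model sig0) X => forall m : nat -> M,
    exists2 s, X s & forall i : 'I_k, s (val i) = m (val i)).
  apply: NfBasic; exists unit, (fun _ _ => True), (fun _ _ _ => True),
    (fun _ M s c m => forall i : 'I_k, s (val i) = m (val i)).
  split=> //.
  - exact: fodef_cst.
  - exact: fodef_cst.
  - by move=> _; apply: fodef_finall => i; exact: fodef_eq.
  - move=> M X; have [a _] := domain_two M.
    by split=> [H|[c [_ _ H]] m]; [exists (fun=> a)|exact: (H tt)].
move=> M X /=; split=> [H m|H].
  have : setT (fun i : 'I_k => m (val i)) by [].
  rewrite -H => -[s Xs sm]; exists s => // i.
  by rewrite -[RHS](congr1 (@^~ i) sm).
have [a0 _] := domain_two M.
apply/seteqP; split=> // a _.
have [s Xs sa] := H (fun v => if insub v is Some i then a i else a0).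
by exists s => //; apply: funext => i; rewrite sa valK.
Qed.

Lemma nf_dep_dep0 (p : fo sig0) : fo_sentence p -> nf_dep (dep0 p).
Proof.
move=> p0; exists (fun (M : model sig0) X => fo_true (bare M) p); last by [].
have pd : fodef (fun (M : model sig0) (_ : nat -> M) => fo_true (bare M) p).
  exists (fo_lift sig0 p) => M t; rewrite fo_lift_sat.
  exact: fo_sentence_sat.
apply: NfBasic; exists void, (fun (M : model sig0) (_ : nat -> M) => fo_true (bare M) p), (fun _ _ _ => True),
  (of_void _); split=> //.
- exact: fodef_cst.
- move=> M X; have [a _] := domain_two M.
  by split=> [H|[c [H _ _]]//]; exists (fun=> a); split.
Qed.

(** The definition is used for the tuple of the first [k] variables; restricting total valuations to
    them gives a team with a fixed finite domain, as definability demands. *)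
Lemma nf_dep_definable (D : dependency) :
  definable_in (@FO_D0_gor_const_all sig0) D -> nf_dep D.
Proof.
move=> /(_ _ val_inj)[p [pL pfv pP]].
have [|Q Qn QP] := nf_team_sat _ pL.
  move=> E [[[q q0 <-]|[k _ <-]]|[k _ <-]].
  - exact: nf_dep_dep0.
  - exact: nf_dep_const.
  - exact: nf_dep_all.
exists Q => // M X; set k := dep_arity D.
pose res (t : nat -> M) : assignment M := fun v => if v < k then Some (t v) else None.
have dX : team_on (iota 0 k) [set res t | t in X].
  by move=> _ [t _ <-] v; rewrite mem_iota /res; case: ltnP.
have xV (i : 'I_k) : val i \in iota 0 k by rewrite mem_iota /=.
have <- : team_rel [set res t | t in X] val =
    [set (fun i : 'I_k => t (val i)) | t in X].
  apply/seteqP; split=> [a [_ [t Xt <-] ta]|_ [t Xt <-]].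
    by exists t => //; apply: funext => i; have := ta i; rewrite /res ltn_ord => -[].
  by exists (res t); [exists t|move=> i; rewrite /res ltn_ord].
rewrite -(QP (bare M) [set res t | t in X] X); first exact: pP dX xV.
  move=> _ [t Xt <-] v /pfv[i _ <-]; exists (t (val i)).
  by rewrite /res ltn_ord.
split=> [_ [t Xt <-]|t Xt]; [exists t => //|exists (res t); first by exists t].
  by move=> v m; rewrite /res; case: ifP => // _ [].
by move=> v m; rewrite /res; case: ifP => // _ [].
Qed.

(** * From the normal form to team formulas *)

Fixpoint fo_team (S : signature) (p : fo S) : tform S :=
  match p with
  | FLit l => TLit l
  | FAnd p q => TAnd (fo_team p) (fo_team q)
  | FOr p q => TOr (fo_team p) (fo_team q)
  | FEx v p => TEx v (fo_team p)
  | FAll v p => TAll v (fo_team p)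
  end.

(** Flatness of first-order formulas: splits and choices can be made row by row, always keeping
    everything that satisfies the subformula. *)
Lemma fo_team_sat (S : signature) (M : model S) (p : fo S) (X : set (assignment M)) :
  team_sat X (fo_team p) <-> forall s, X s -> fo_sat s p.
Proof.
elim: p X => [l|p IHp q IHq|p IHp q IHq|v p IHp|v p IHp] X //=.
- rewrite IHp IHq; split=> [[H H'] s Xs|H]; first by split; [exact: H|exact: H'].
  by split=> s /H[].
- split=> [[Y [Z [-> /IHp H /IHq H']]] s [/H|/H']|H]; [by left|by right|].
  exists [set s | X s /\ fo_sat s p], [set s | X s /\ fo_sat s q]; split.
  + apply/seteqP; split=> s /=; last by case=> -[].
    by move=> Xs; case: (H s Xs); [left|right].
  + by apply/IHp => s [].
  + by apply/IHq => s [].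
- split=> [[H [H0 /IHp Hp]] s Xs|H].
    by have [m Hm] := H0 s Xs; exists m; apply: Hp; exists s, m.
  exists (fun s => [set m | fo_sat (upd s v m) p]); split; first by move=> s /H[m pm]; exists m.
  by apply/IHp => _ [s [m [Xs pm ->]]].
- rewrite IHp; split=> [H s Xs m|H _ [s [m [Xs ->]]]]; last exact: H.
  by apply: H; exists s, m.
Qed.

Lemma fo_team_fv (S : signature) (p : fo S) : tform_fv (fo_team p) = fo_fv p.
Proof. by elim: p => //= [p -> q ->|p -> q ->|v p ->|v p ->]. Qed.

Lemma fo_team_in_logic (S : signature) A g (p : fo S) : in_logic A g (fo_team p).
Proof. by elim: p => //=. Qed.

Lemma team_sat_exs (S : signature) (M : model S) (p : tform S) vs (X : set (assignment M)) :
  team_sat X (foldr (@TEx S) p vs) <->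
  exists X', [/\ team_sat X' p,
    forall s, X s -> exists2 ms, size ms = size vs & X' (updl s vs ms) &
    forall t, X' t -> exists s ms, [/\ X s, size ms = size vs & t = updl s vs ms]].
Proof.
elim: vs X => [|v vs IH] X /=.
  split=> [Xp|[X' [X'p XX' X'X]]].
    by exists X; split=> // [s Xs|s Xs]; [exists [::]|exists s, [::]].
  suff -> : X = X' by [].
  apply/seteqP; split=> s; first by move=> /XX'[[|//]].
  by move=> /X'X[t [ms [Xt sz ->]]]; case: ms sz.
split.
  move=> [H [H0 /IH[X' [X'p XX' X'X]]]]; exists X'; split=> // [s Xs|t /X'X].
    have [m Hm] := H0 s Xs; have [|ms sz X'ms] := XX' (upd s v m); first by exists s, m.
    by exists (m :: ms) => //=; rewrite sz.
  move=> [_ [ms [[s [m [Xs Hm ->]]] sz ->]]].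
  by exists s, (m :: ms); split=> //=; rewrite sz.
move=> [X' [X'p XX' X'X]].
exists (fun s => [set m | exists2 ms, size ms = size vs & X' (updl (upd s v m) vs ms)]); split.
  by move=> s /XX'[[//|m ms] /= [sz] X'ms]; exists m, ms.
apply/IH; exists X'; split=> // [_ [s [m [Xs [ms sz X'ms] ->]]]|t X't]; first by exists ms.
have [s [[|m ms] [Xs]]] := X'X t X't; first by [].
move=> -[sz] tE; exists (upd s v m), ms; split=> //; exists s, m; split=> //.
by exists ms => //; move: X't; rewrite tE.
Qed.

Lemma tform_exs_fv (S : signature) (p : tform S) vs :
  tform_fv (foldr (@TEx S) p vs) = tform_fv p `\` [set v | v \in vs].
Proof.
elim: vs => [|v vs IH] /=; first by apply/seteqP; split=> [w|w []//]; split.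
rewrite IH; apply/seteqP; split=> w /=.
  by move=> [[pw /negP wvs] /= wv]; split=> //=; rewrite inE => /orP[/eqP|/(negP wvs)].
move=> [pw /negP]; rewrite inE negb_or => /andP[/eqP wv /negP wvs].
by split=> //; split.
Qed.

Lemma tform_exs_in_logic (S : signature) A g (p : tform S) vs :
  in_logic A g p -> in_logic A g (foldr (@TEx S) p vs).
Proof. by elim: vs. Qed.

Section CodomAssignments.
Variables (k : nat) (x : 'I_k -> nat).

Lemma codom_uniq_inj : uniq (codom x) -> injective x.
Proof. by move/injectiveP. Qed.

Lemma size_codom_ord (T : Type) (a : 'I_k -> T) : size (codom a) = k.
Proof. by rewrite size_codom card_ord. Qed.

Lemma nth_codom_ord (T : Type) (a : 'I_k -> T) m0 (i : 'I_k) : nth m0 (codom a) (val i) = a i.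
Proof.
rewrite /codom /image_mem (nth_map i) ?nth_ord_enum //.
by rewrite size_enum_ord ltn_ord.
Qed.

Lemma updl_codom (M : Type) (s : assignment M) (a : 'I_k -> M) i :
  injective x -> updl s (codom x) (codom a) (x i) = Some (a i).
Proof.
move=> xi; rewrite -(nth_codom_ord x 0 i) (updl_nth (a i)) ?nth_codom_ord //.
- exact/injectiveP.
- by rewrite !size_codom_ord.
- by rewrite size_codom_ord ltn_ord.
Qed.

Lemma seq_codom (M : Type) (m0 : M) (ms : seq M) : size ms = size (codom x) ->
  ms = codom (fun i : 'I_k => nth m0 ms i).
Proof.
rewrite size_codom_ord => sz; apply: (@eq_from_nth _ m0) => [|i].
  by rewrite size_codom_ord.
rewrite sz => ik; by rewrite -[i]/(val (Ordinal ik)) nth_codom_ord.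
Qed.

End CodomAssignments.

Section MatrixSemantics.
Variables (k : nat) (x : 'I_k -> nat) (t : qmatrix x).
Let vars := mx_vars t.
Let theta := mx_fo t.

Lemma mx_inj : injective x.
Proof. by have := mx_uniq t; rewrite cat_uniq => /andP[/codom_uniq_inj]. Qed.

Lemma mx_vars_uniq : uniq vars.
Proof. by have := mx_uniq t; rewrite cat_uniq => /and3P[]. Qed.

Lemma mx_vars_notin i : x i \notin vars.
Proof.
have := mx_uniq t; rewrite cat_uniq => /and3P[_ /hasPn H _].
by apply: contraTN (codom_f x i) => /H.
Qed.

Lemma mx_vars_codom v : v \in vars -> v \notin codom x.
Proof.
by have := mx_uniq t; rewrite cat_uniq => /and3P[_ /hasPn H _] /H.
Qed.

Definition mx_env (M : Type) (ys : seq M) (a : 'I_k -> M) : assignment M :=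
  updl (updl (@empty_assignment M) vars ys) (codom x) (codom a).

Definition mx_sem (M : domain) (R : set ('I_k -> M)) : Prop :=
  exists2 ys, size ys = size vars &
    forall a, R a -> fo_sat (M := bare M) (mx_env ys a) theta.

Lemma qmatrix_fo_true (M : domain) (R : set ('I_k -> M)) :
  fo_true (relmodel R) (qmatrix_fo t) <-> mx_sem R.
Proof.
have [m0 _] := domain_two M.
rewrite /fo_true /qmatrix_fo fo_sat_exs.
have E ys a : fo_sat (M := relmodel R) (mx_env ys a)
    (FOr (FLit (@LRel (sigR k) false tt (fun i => Var (x i)))) (fo_lift (sigR k) theta))
    <-> (R a -> fo_sat (M := bare M) (mx_env ys a) theta).
  rewrite /= fo_lift_sat; split.
    move=> [[c [cv nR]] Ra|//]; case: nR.
    suff -> : c = a by [].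
    apply: funext => i; have /= := cv i.
    by rewrite /mx_env updl_codom; [case|exact: mx_inj].
  have [Ra /(_ Ra)|nRa _] := pselect (R a); first by right.
  by left; exists a; split=> // i; rewrite /mx_env updl_codom //; exact: mx_inj.
split=> -[ys sz H]; exists ys => //.
  by move: H => /fo_sat_alls H a; apply/E; apply: H; rewrite !size_codom_ord.
apply/fo_sat_alls => ms /(seq_codom m0) ->.
by apply/E; exact: H.
Qed.

Lemma mx_env_eq (M : domain) (s : assignment M) ys a :
  size ys = size vars -> (forall i, s (x i) = Some (a i)) ->
  fo_sat (M := bare M) (updl s vars ys) theta <->
  fo_sat (M := bare M) (mx_env ys a) theta.
Proof.
move=> sz sa; apply: fo_sat_eq => v /(mx_fv (q := t)); rewrite /= mem_cat => /orP[/codomP[i ->]|vv].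
  by rewrite updl_notin ?mx_vars_notin // sa /mx_env updl_codom //; exact: mx_inj.
rewrite /mx_env (updl_notin _ _ (mx_vars_codom vv)).
exact: updl_in.
Qed.

Lemma mx_env_def (M : domain) (s : assignment M) ys v :
  size ys = size vars -> (forall i, exists m, s (x i) = Some m) ->
  fo_fv theta v -> exists m, updl s vars ys v = Some m.
Proof.
move=> sz sd /(mx_fv (q := t)); rewrite /= mem_cat => /orP[/codomP[i ->]|vv].
  by rewrite updl_notin ?mx_vars_notin.
have [m0 _] := domain_two M; exists (nth m0 ys (index v vars)).
rewrite -{1}(nth_index 0 vv); apply: updl_nth => //; first exact: mx_vars_uniq.
by rewrite index_mem.
Qed.

(** The constancy atom forces one tuple y for all rows, which turns the lax quantifier into a
    uniform one. *)
Definition mx_tform : tform sig0 :=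
  foldr (@TEx sig0)
    (TAnd (@TAtom sig0 (Plain (dep_const (size vars))) (fun i => nth 0 vars i))
          (fo_team theta)) vars.

(** The negation requires, for every tuple y, a row violating theta. So the violating pairs must
    make y range over all tuples, and the split with a true formula discards the rows that violate
    nothing. *)
Definition mx_neg_tform : tform sig0 :=
  TOr (fo_team (fo_top sig0))
   (foldr (@TEx sig0)
     (TAnd (fo_team (fo_neg theta))
       (@TAtom sig0 (Plain (dep_all (size vars))) (fun i => nth 0 vars i))) vars).

Lemma updl_vars_inj (M : Type) (s s' : assignment M) ys ys' :
  size ys = size vars -> size ys' = size vars ->
  (forall i, i < size vars ->
    updl s vars ys (nth 0 vars i) = updl s' vars ys' (nth 0 vars i)) -> ys = ys'.
Proof.
move=> sz sz' E; case: ys sz E => [|m0 ys] sz E.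
  by apply/esym/size0nil; rewrite sz' -sz.
apply: (@eq_from_nth _ m0) => [|i]; first by rewrite sz'.
rewrite sz => iv; have := E i iv.
by rewrite !(updl_nth m0) ?mx_vars_uniq // => -[].
Qed.

Lemma mx_tform_sat (M : domain) (X : set (assignment M)) :
  (forall s, X s -> forall i, exists m, s (x i) = Some m) ->
  team_sat (M := bare M) X mx_tform <-> mx_sem (team_rel X x).
Proof.
move=> Xd; have [m0 _] := domain_two M; rewrite team_sat_exs; split.
  move=> [X' [/= [X'c /fo_team_sat X't] XX' X'X]].
  have [[s0 X0]|/nonemptyPn X0] := pselect (X !=set0); last first.
    by exists (nseq (size vars) m0); rewrite ?size_nseq // => a [s]; rewrite X0.
  have [ys sz X'ys] := XX' s0 X0; exists ys => // a [s Xs sa].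
  have [ms szm X'ms] := XX' s Xs.
  have E : ms = ys.
    apply: (updl_vars_inj (s := s) (s' := s0)) => // i iv.
    have rel s1 zs : size zs = size vars -> X' (updl s1 vars zs) ->
        team_rel X' (fun i : 'I_(size vars) => nth 0 vars i) (fun i => nth m0 zs i).
      by move=> sz1 X'1; exists (updl s1 vars zs) => // j; rewrite (updl_nth m0) ?mx_vars_uniq.
    have := X'c _ _ (rel _ _ szm X'ms) (rel _ _ sz X'ys).
    move=> /(congr1 (@^~ (Ordinal iv))) /= Ei.
    by rewrite !(updl_nth m0) ?mx_vars_uniq // Ei.
  by apply/(mx_env_eq sz sa); rewrite -E; exact: X't.
move=> [ys sz H]; exists [set updl s vars ys | s in X]; split=> /=.
- split.
    move=> a b [_ [s Xs <-] sa] [_ [s' Xs' <-] sb]; apply: funext => i.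
    have := sa i; have := sb i.
    by rewrite !(updl_nth m0) ?mx_vars_uniq // => -[<-] [<-].
  apply/fo_team_sat => _ [s Xs <-]; have [a sa] := choice (Xd s Xs).
  by apply/(mx_env_eq sz sa); apply: H; exists s.
- by move=> s Xs; exists ys => //; exists s.
- by move=> _ [s Xs <-]; exists s, ys.
Qed.

Lemma mx_neg_tform_sat (M : domain) (X : set (assignment M)) :
  (forall s, X s -> forall i, exists m, s (x i) = Some m) ->
  team_sat (M := bare M) X mx_neg_tform <-> ~ mx_sem (team_rel X x).
Proof.
move=> Xd; have [m0 _] := domain_two M; rewrite /mx_neg_tform /=; split.
  move=> [Y [Z [E _ /team_sat_exs[X' [/= [/fo_team_sat X't X'a] ZX' X'Z]]]]] [ys sz H].
  have : setT (fun i : 'I_(size vars) => nth m0 ys i) by [].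
  rewrite -X'a => -[t' X't' t'E].
  have [s [ms [Zs szm tE]]] := X'Z _ X't'.
  have msE : ms = ys.
    apply: (updl_vars_inj (s := s) (s' := s)) => // i iv.
    by rewrite -tE (t'E (Ordinal iv)) (updl_nth m0) ?mx_vars_uniq.
  have Xs : X s by rewrite E; right.
  have [a sa] := choice (Xd s Xs).
  have /fo_neg_sat := X't _ X't'; rewrite tE; apply.
    by move=> v; exact: mx_env_def (Xd s Xs).
  by apply/(mx_env_eq szm sa); rewrite msE; apply: H; exists s.
move=> H.
exists X, [set s | X s /\ exists2 ms, size ms = size vars &
    ~ fo_sat (M := bare M) (updl s vars ms) theta]; split.
- by apply/seteqP; split=> s /=; [left|case=> [//|[]]].
- by apply/(fo_team_sat (M := bare M) (fo_top sig0)) => s _; exact: fo_top_sat.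
apply/team_sat_exs; exists [set u | exists s ms, [/\ X s, size ms = size vars,
    ~ fo_sat (M := bare M) (updl s vars ms) theta & u = updl s vars ms]]; split=> /=.
- split.
    apply/fo_team_sat => _ [s [ms [Xs sz nt ->]]]; apply/fo_neg_sat => //.
    by move=> v; exact: mx_env_def (Xd s Xs).
  apply/seteqP; split=> // c _.
  have /existsNP[a /not_implyP[[s Xs sa] na]] : ~ forall a, team_rel X x a ->
      fo_sat (M := bare M) (mx_env (codom c) a) theta.
    by move=> Ha; apply: H; exists (codom c) => //; rewrite size_codom_ord.
  have sz : size (codom c) = size vars by rewrite size_codom_ord.
  exists (updl s vars (codom c)).
    by exists s, (codom c); split=> //; rewrite mx_env_eq //; exact: na.
  by move=> i; rewrite (updl_nth m0) ?mx_vars_uniq // nth_codom_ord.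
- by move=> s [Xs [ms sz nt]]; exists ms => //; exists s, ms.
- move=> u [s [ms [Xs sz nt ->]]]; exists s, ms; split=> //.
  by split=> //; exists ms.
Qed.

Lemma mx_tform_fv : tform_fv mx_tform `<=` range x.
Proof.
rewrite tform_exs_fv /= fo_team_fv => v [[[i _ <-]|/(mx_fv (q := t))] /=].
  by rewrite mem_nth.
by rewrite mem_cat => /orP[/codomP[i ->] _|->//]; exists i.
Qed.

Lemma mx_neg_tform_fv : tform_fv mx_neg_tform `<=` range x.
Proof.
rewrite /mx_neg_tform /= tform_exs_fv /= fo_team_fv fo_neg_fv => v [[[->|->] []//]|].
move=> [[/(mx_fv (q := t))|[i _ <-]] /=]; last by rewrite mem_nth.
by rewrite mem_cat => /orP[/codomP[i ->] _|->//]; exists i.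
Qed.

End MatrixSemantics.

(** * Change of the tuple of variables *)

Section Copy.
Variables (k : nat) (x x0 : 'I_k -> nat) (w : nat) (p : tform sig0).

Definition copy_eqs (y z : 'I_k -> nat) : fo sig0 :=
  \big[@FAnd sig0/fo_top sig0]_(i < k) FLit (LEq true (Var (y i)) (Var (z i))).

Lemma copy_eqs_fv y z : fo_fv (copy_eqs y z) `<=` range y `|` range z.
Proof.
rewrite /copy_eqs; elim/big_rec: _ => [|i q _ IH]; first by rewrite fo_top_sentence.
move=> v /= [[->|->]|/IH//]; [by left; exists i|by right; exists i].
Qed.

Lemma copy_eqs_sat (M : domain) (s : assignment M) y z :
  fo_sat (M := bare M) s (copy_eqs y z) <->
  forall i, exists m, s (y i) = Some m /\ s (z i) = Some m.
Proof.
rewrite fo_bigand_satP; split=> [H i|H i _].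
  by have [m [n [ym zn /= mn]]] := H i isT; exists m; rewrite {2}mn.
by have [m [ym zm]] := H i; exists m, m.
Qed.

(* The values of [x] are moved to [x0] through the fresh variables [w + i],
   because [x] and [x0] may overlap. *)
Definition copy_tform : tform sig0 :=
  foldr (@TEx sig0)
    (TAnd (fo_team (copy_eqs (fun i => w + i) x))
      (foldr (@TEx sig0)
        (TAnd (fo_team (copy_eqs x0 (fun i => w + i))) p) (codom x0)))
    (codom (fun i : 'I_k => w + i)).

Hypotheses (xi : injective x) (x0i : injective x0).
Hypotheses (xw : forall i, x i < w) (x0w : forall i, x0 i < w).
Hypothesis p_fv : tform_fv p `<=` range x0.

Let wi : injective (fun i : 'I_k => w + i).
Proof. by move=> i j /addnI /val_inj. Qed.

Let x_notin i : x i \notin codom (fun i : 'I_k => w + i).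
Proof. by apply/codomP => -[j E]; have := xw i; rewrite E ltnNge leq_addr. Qed.

Let w_notin (i : 'I_k) : w + i \notin codom x0.
Proof. by apply/codomP => -[j E]; have := x0w j; rewrite -E ltnNge leq_addr. Qed.

Lemma copy_tform_fv : tform_fv copy_tform `<=` range x.
Proof.
rewrite /copy_tform tform_exs_fv /= tform_exs_fv /= !fo_team_fv => v [[H|[H nH]] nv].
  by case: (copy_eqs_fv H) => -[i _ E] //; [case: nv; rewrite /= -E codom_f|exists i].
case: H => [/copy_eqs_fv[|]|/p_fv] [i _ E].
- by case: nH; rewrite /= -E codom_f.
- by case: nv; rewrite /= -E codom_f.
- by case: nH; rewrite /= -E codom_f.
Qed.

(** The equations determine all the quantified values, so a row [s] with values [a] on [x] has the
    single extension [row s a], in which [x0] carries [a]. *)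
Lemma copy_tform_sat (P : forall M : domain, set ('I_k -> M) -> Prop) :
  (forall (M : domain) (X : set (assignment M)),
     (forall s, X s -> forall i, exists m, s (x0 i) = Some m) ->
     team_sat (M := bare M) X p <-> P M (team_rel X x0)) ->
  forall (M : domain) (X : set (assignment M)),
     (forall s, X s -> forall i, exists m, s (x i) = Some m) ->
     team_sat (M := bare M) X copy_tform <-> P M (team_rel X x).
Proof.
move=> pP M X Xd; have [m0 _] := domain_two M.
pose row (s : assignment M) (a : 'I_k -> M) : assignment M :=
  updl (updl s (codom (fun i : 'I_k => w + i)) (codom a)) (codom x0) (codom a).
have row0 s a i : row s a (x0 i) = Some (a i) by rewrite /row updl_codom.
rewrite /copy_tform team_sat_exs; split.
  move=> [X1 [/= [/fo_team_sat X1e /team_sat_exs[X2 [/= [/fo_team_sat X2e X2p] X12 X21]]] XX1 X1X]].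
  have step s ms : X s -> size ms = size (codom (fun i : 'I_k => w + i)) ->
      X1 (updl s (codom (fun i : 'I_k => w + i)) ms) ->
      exists2 a : 'I_k -> M, forall i, s (x i) = Some (a i) & ms = codom a.
    move=> Xs sz X1s; exists (fun i => nth m0 ms i); last exact: seq_codom sz.
    move=> i; have /copy_eqs_sat/(_ i)[m []] := X1e _ X1s.
    rewrite {1}(seq_codom m0 sz) (@updl_codom _ (fun i : 'I_k => w + i)) // => -[<-].
    by rewrite updl_notin.
  have step2 s (a : 'I_k -> M) ns : X2 (updl (updl s (codom (fun i : 'I_k => w + i)) (codom a)) (codom x0) ns) ->
      size ns = size (codom x0) -> ns = codom a.
    move=> X2s sz; transitivity (codom (fun i : 'I_k => nth m0 ns i)); first exact: seq_codom sz.
    suff -> : (fun i : 'I_k => nth m0 ns i) = a by []; apply: funext => i.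
    have /copy_eqs_sat/(_ i)[m []] := X2e _ X2s.
    rewrite {1}(seq_codom m0 sz) updl_codom // => -[<-].
    by rewrite updl_notin // (@updl_codom _ (fun i : 'I_k => w + i)) // => -[->].
  have X2E t : X2 t <-> exists s a, [/\ X s, forall i, s (x i) = Some (a i) & t = row s a].
    split.
      move=> X2t; have [s1 [ns [X1s1 szn tE]]] := X21 t X2t.
      have [s [ms [Xs szm s1E]]] := X1X _ X1s1.
      have [|a sa msE] := step s ms Xs szm; first by rewrite -s1E.
      exists s, a; split=> //; rewrite tE s1E msE; congr updl.
      by apply: (step2 s) => //; rewrite -msE -s1E -tE.
    move=> [s [a [Xs sa ->]]].
    have [ms szm X1ms] := XX1 s Xs; have [b sb msE] := step s ms Xs szm X1ms.
    have ba : b = a by apply: funext => i; have := sb i; rewrite sa => -[].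
    have [ns szn X2ns] := X12 _ X1ms; move: X2ns; rewrite msE ba => X2ns.
    by have := X2ns; rewrite (step2 _ _ _ X2ns szn).
  have X2d t : X2 t -> forall i, exists m, t (x0 i) = Some m.
    by move=> /X2E[s [a [Xs sa ->]]] i; exists (a i).
  suff -> : team_rel X x = team_rel X2 x0 by apply/pP.
  apply/seteqP; split=> a.
    by move=> [s Xs sa]; exists (row s a) => //; apply/X2E; exists s, a.
  move=> [t /X2E[s [b [Xs sb ->]]] ta]; exists s => // i.
  by have := ta i; rewrite row0 sb.
move=> PX.
exists [set t | exists s a, [/\ X s, forall i, s (x i) = Some (a i) &
  t = updl s (codom (fun i : 'I_k => w + i)) (codom a)]]; split=> /=.
- split.
    apply/fo_team_sat => _ [s [a [Xs sa ->]]]; apply/copy_eqs_sat => i; exists (a i).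
    by rewrite (@updl_codom _ (fun i : 'I_k => w + i)) // updl_notin.
  apply/team_sat_exs; exists [set t | exists s a, [/\ X s, forall i, s (x i) = Some (a i) &
    t = row s a]]; split=> /=.
  + split.
      apply/fo_team_sat => _ [s [a [Xs sa ->]]]; apply/copy_eqs_sat => i; exists (a i).
      by rewrite row0 /row updl_notin // (@updl_codom _ (fun i : 'I_k => w + i)).
    apply/pP; first by move=> _ [s [a [Xs sa ->]]] i; exists (a i).
    move: PX; suff -> : team_rel X x = team_rel [set t | exists s a,
      [/\ X s, forall i, s (x i) = Some (a i) & t = row s a]] x0 by [].
    apply/seteqP; split=> a.
      by move=> [s Xs sa]; exists (row s a) => //; exists s, a.
    move=> [_ [s [b [Xs sb ->]]] ta]; exists s => // i.
    by have := ta i; rewrite row0 sb.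
  + move=> _ [s [a [Xs sa ->]]]; exists (codom a); rewrite ?size_codom_ord //.
    by exists s, a.
  + move=> _ [s [a [Xs sa ->]]].
    exists (updl s (codom (fun i : 'I_k => w + i)) (codom a)), (codom a).
    by rewrite !size_codom_ord; split=> //; exists s, a.
- move=> s Xs; have [a sa] := choice (Xd s Xs).
  by exists (codom a); rewrite ?size_codom_ord //; exists s, a.
- move=> _ [s [a [Xs sa ->]]]; exists s, (codom a); rewrite !size_codom_ord.
  by split.
Qed.

End Copy.

Section Expressible.
Variable k : nat.
Implicit Types P Q : forall M : domain, set ('I_k -> M) -> Prop.

(** All injective tuples are allowed, so that conditions first written with different tuples can be
    combined. Only definedness on [x] is asked of the rows, which the intermediate teams satisfy. *)
Definition expressible P : Prop :=
  forall x : 'I_k -> nat, injective x ->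
    exists p : tform sig0, [/\ FO_D0_gor_const_all p, tform_fv p `<=` range x &
      forall (M : domain) (X : set (assignment M)),
        (forall s, X s -> forall i, exists m, s (x i) = Some m) ->
        team_sat (M := bare M) X p <-> P M (team_rel X x)].

Lemma expressible_ext P Q : (forall M R, P M R <-> Q M R) ->
  expressible P -> expressible Q.
Proof.
move=> PQ Pe x xi; have [p [pL pfv pP]] := Pe x xi.
by exists p; split=> // M X Xd; rewrite pP // PQ.
Qed.

Lemma expressible_and P Q : expressible P -> expressible Q ->
  expressible (fun M R => P M R /\ Q M R).
Proof.
move=> Pe Qe x xi; have [p [pL pfv pP]] := Pe x xi; have [q [qL qfv qP]] := Qe x xi.
exists (TAnd p q); split=> //; first by move=> v [/pfv|/qfv].
by move=> M X Xd /=; rewrite pP // qP.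
Qed.

Lemma expressible_or P Q : expressible P -> expressible Q ->
  expressible (fun M R => P M R \/ Q M R).
Proof.
move=> Pe Qe x xi; have [p [pL pfv pP]] := Pe x xi; have [q [qL qfv qP]] := Qe x xi.
exists (TGOr p q); split=> //; first by move=> v [/pfv|/qfv].
by move=> M X Xd /=; rewrite pP // qP.
Qed.

Lemma expressible_domain (p : fo sig0) : fo_sentence p ->
  expressible (fun M _ => fo_true (bare M) p).
Proof.
move=> p0 x xi; exists (@TAtom sig0 (Plain (dep0 p)) (fun _ : 'I_0 => 0)); split=> //.
- by exists (dep0 p) => //; left; left; exists p.
- by move=> v [[]].
Qed.

Lemma expressible_forall n (P : 'I_n -> forall M : domain, set ('I_k -> M) -> Prop) :
  (forall i, expressible (P i)) -> expressible (fun M R => forall i, P i M R).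
Proof.
elim: n P => [|n IH] P Pe.
  apply: expressible_ext (expressible_domain (fo_top_sentence sig0)) => M R.
  by split=> [_ []//|_]; exact: fo_top_sat.
have := expressible_and (Pe ord0) (IH (fun i => P (lift ord0 i)) (fun i => Pe _)).
apply: expressible_ext => M R; split=> [[P0 PS] i|H]; last by split.
by case: (unliftP ord0 i) => [j|] ->.
Qed.

Lemma expressible_exists n (P : 'I_n -> forall M : domain, set ('I_k -> M) -> Prop) :
  (forall i, expressible (P i)) -> expressible (fun M R => exists i, P i M R).
Proof.
elim: n P => [|n IH] P Pe.
  have b0 : fo_sentence (fo_bot sig0).
    by rewrite /fo_sentence fo_neg_fv; exact: fo_top_sentence.
  apply: expressible_ext (expressible_domain b0) => M R.
  by split=> [/fo_bot_sat//|[[]]].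
have := expressible_or (Pe ord0) (IH (fun i => P (lift ord0 i)) (fun i => Pe _)).
apply: expressible_ext => M R; split=> [[P0|[j Pj]]|[i]].
- by exists ord0.
- by exists (lift ord0 j).
- by case: (unliftP ord0 i) => [j|] -> Pi; [right; exists j|left].
Qed.

Lemma expressible_copy (x0 : 'I_k -> nat) (p : tform sig0) P :
  injective x0 -> FO_D0_gor_const_all p -> tform_fv p `<=` range x0 ->
  (forall (M : domain) (X : set (assignment M)),
     (forall s, X s -> forall i, exists m, s (x0 i) = Some m) ->
     team_sat (M := bare M) X p <-> P M (team_rel X x0)) ->
  expressible P.
Proof.
move=> x0i pL pfv pP x xi.
pose w := (\max_i maxn (x i) (x0 i)).+1.
have xw i : x i < w by rewrite ltnS (leq_trans (leq_maxl _ (x0 i))) // (leq_bigmax i).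
have x0w i : x0 i < w by rewrite ltnS (leq_trans (leq_maxr (x i) _)) // (leq_bigmax i).
exists (copy_tform x x0 w p); split.
- apply: tform_exs_in_logic; split; first exact: fo_team_in_logic.
  by apply: tform_exs_in_logic; split; first exact: fo_team_in_logic.
- exact: copy_tform_fv.
- by move=> M X Xd; exact: copy_tform_sat.
Qed.

Lemma expressible_matrix (x0 : 'I_k -> nat) (t : qmatrix x0) :
  expressible (fun M R => mx_sem t R).
Proof.
apply: (expressible_copy (p := mx_tform t) (mx_inj t)).
- apply: tform_exs_in_logic; split; last exact: fo_team_in_logic.
  by exists (dep_const (size (mx_vars t))) => //; left; right; exists (size (mx_vars t)).
- exact: mx_tform_fv.
- exact: mx_tform_sat.
Qed.

Lemma expressible_matrix_neg (x0 : 'I_k -> nat) (t : qmatrix x0) :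
  expressible (fun M R => ~ mx_sem t R).
Proof.
apply: (expressible_copy (p := mx_neg_tform t) (mx_inj t)).
- split; first exact: (fo_team_in_logic _ _ (fo_top sig0)).
  apply: tform_exs_in_logic; split; first exact: fo_team_in_logic.
  by exists (dep_all (size (mx_vars t))) => //; right; exists (size (mx_vars t)).
- exact: mx_neg_tform_fv.
- exact: mx_neg_tform_sat.
Qed.

End Expressible.

Lemma qmatrix_fo_sentence k (x : 'I_k -> nat) (t : qmatrix x) :
  fo_sentence (qmatrix_fo t).
Proof.
rewrite /fo_sentence /qmatrix_fo fo_exs_fv fo_alls_fv; apply/seteqP; split=> // v.
move=> [[H nx] nv]; case: H => /=.
  by move=> [i]; move: nx => /= + E; rewrite E codom_f.
rewrite -[X in X v]/(fo_fv (fo_lift (sigR k) (mx_fo t))) fo_lift_fv.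
by move=> /(mx_fv (q := t)); rewrite /= mem_cat => /orP[/nx|/nv].
Qed.

Lemma normal_form_true k (x : 'I_k -> nat) l (d : 'I_l -> disjunct x)
    (M : domain) (R : set ('I_k -> M)) :
  fo_true (relmodel R) (normal_form d) <->
  exists i, [/\ fo_true (bare M) (dj_psi (d i)),
    forall j, mx_sem (dj_theta (d := d i) j) R & forall j, ~ mx_sem (dj_xi (d := d i) j) R].
Proof.
rewrite /fo_true /normal_form fo_bigor_satP.
have E i : fo_sat (M := relmodel R) (@empty_assignment M) (disjunct_fo (d i)) <->
    [/\ fo_true (bare M) (dj_psi (d i)),
      forall j, mx_sem (dj_theta (d := d i) j) R & forall j, ~ mx_sem (dj_xi (d := d i) j) R].
  rewrite /disjunct_fo /= fo_lift_sat !fo_bigand_satP; split.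
    move=> [H1 [H2 H3]]; split=> // j; first by apply/qmatrix_fo_true; exact: H2.
    have /fo_neg_true H := H3 j isT; rewrite -qmatrix_fo_true; apply: H.
    exact: qmatrix_fo_sentence.
  move=> [H1 H2 H3]; split=> //; split=> j _; first by apply/qmatrix_fo_true; exact: H2.
  by apply/fo_neg_true; rewrite ?qmatrix_fo_true //; exact: qmatrix_fo_sentence.
by split=> [[i _ /E]|[i /E]]; exists i.
Qed.

Lemma expressible_definable (D : dependency) :
  expressible (fun M R => @dep_mem D M R) -> definable_in (@FO_D0_gor_const_all sig0) D.
Proof.
move=> De x xi; have [p [pL pfv pP]] := De x xi; exists p; split=> // M V X XV xV.
rewrite pP // => s Xs i; have := XV s Xs (x i); rewrite xV.
by case: (s (x i)) => // m _; exists m.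
Qed.

(** A matrix condition and its negation are both expressible and disjunction is global, so the
    complement follows by De Morgan. *)
Lemma normal_form_definable (D : dependency) (DR : fo (sigR (dep_arity D))) :
  defines D DR -> has_normal_form DR ->
  definable_in (@FO_D0_gor_const_all sig0) D /\
  definable_in (@FO_D0_gor_const_all sig0) (dep_compl D).
Proof.
move=> DRD [x [l [d dP]]].
have DE (M : domain) (R : set ('I_(dep_arity D) -> M)) : dep_mem D R <-> exists i,
    [/\ fo_true (bare M) (dj_psi (d i)), forall j, mx_sem (dj_theta (d := d i) j) R &
        forall j, ~ mx_sem (dj_xi (d := d i) j) R].
  by rewrite (DRD M R) dP normal_form_true.
split; apply: expressible_definable.
  apply: (@expressible_ext _ (fun M R => exists i, fo_true (bare M) (dj_psi (d i)) /\
    (forall j, mx_sem (dj_theta (d := d i) j) R) /\ forall j, ~ mx_sem (dj_xi (d := d i) j) R)).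
    by move=> M R; rewrite DE; split=> -[i]; [move=> [? []]|move=> []]; exists i.
  apply: expressible_exists => i; apply: expressible_and.
    exact: expressible_domain (dj_psiP (d i)).
  apply: expressible_and; apply: expressible_forall => j.
    exact: expressible_matrix.
  exact: expressible_matrix_neg.
apply: (@expressible_ext _ (fun M R => forall i, fo_true (bare M) (fo_neg (dj_psi (d i))) \/
  (exists j, ~ mx_sem (dj_theta (d := d i) j) R) \/ exists j, mx_sem (dj_xi (d := d i) j) R)).
  move=> M R /=; rewrite DE.
  have N i : fo_true (bare M) (fo_neg (dj_psi (d i))) <-> ~ fo_true (bare M) (dj_psi (d i)).
    exact: fo_neg_true (dj_psiP (d i)).
  split=> [H [i [H1 H2 H3]]|H i].
    by case: (H i) => [/N|[[j]|[j /H3]]]; [|apply|].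
  apply: contrapT => /not_orP[/N/contrapT H1 /not_orP[/forallNP H2 /forallNP H3]].
  by apply: H; exists i; split=> // j; apply: contrapT.
apply: expressible_forall => i; apply: expressible_or.
  by apply: expressible_domain; rewrite /fo_sentence fo_neg_fv; exact: dj_psiP.
apply: expressible_or; apply: expressible_exists => j.
  exact: expressible_matrix_neg.
exact: expressible_matrix.
Qed.

(** * Colourings and equality patterns *)

Section Similarity.
Variable k : nat.

(** Within one coloured set, similar tuples are those conjugate under a colour preserving
    permutation ([sim_perm]). Allowing two coloured sets lets tuples be compared across different
    domains. *)
Definition sim (K M N : Type) (c : M -> K) (d : N -> K) (y : 'I_k -> M) (x : 'I_k -> N) :=
  (forall i j, y i = y j <-> x i = x j) /\ (forall i, c (y i) = d (x i)).

(** With equal colourings this is the closure of [T] under colour preserving permutations; with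
    different ones it transports [T] to another coloured set. *)
Definition tr (K M N : Type) (c : M -> K) (d : N -> K) (T : set ('I_k -> M)) :
    set ('I_k -> N) := [set x | exists2 y, T y & sim c d y x].

Definition invariant_under (K M : Type) (c : M -> K) (T : set ('I_k -> M)) :=
  forall y x, sim c c y x -> T y -> T x.

Lemma sim_sym (K M N : Type) (c : M -> K) (d : N -> K) y x : sim c d y x -> sim d c x y.
Proof. by move=> [E C]; split=> [i j|i]; rewrite ?E ?C. Qed.

Lemma sim_trans (K M N O : Type) (c : M -> K) (d : N -> K) (e : O -> K) y x z :
  sim c d y x -> sim d e x z -> sim c e y z.
Proof. by move=> [E C] [E' C']; split=> [i j|i]; rewrite ?E ?C. Qed.

Lemma sim_color (K K' M N : Type) (c : M -> K) (d : N -> K) (c' : M -> K') (d' : N -> K') y x :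
  (forall m n, c m = d n -> c' m = d' n) -> sim c d y x -> sim c' d' y x.
Proof. by move=> H [E C]; split=> // i; exact: H. Qed.

Lemma sim_inj (K M N : Type) (c : N -> K) (f : M -> N) (x : 'I_k -> M) :
  injective f -> sim (c \o f) c x (f \o x).
Proof. by move=> fi; split=> // i j /=; split=> [->|/fi]. Qed.

Lemma invariant_color (K K' M : Type) (c : M -> K) (c' : M -> K') T :
  (forall m n, c m = c n -> c' m = c' n) -> invariant_under c' T -> invariant_under c T.
Proof. by move=> H Ti y x /(sim_color H); exact: Ti. Qed.

Lemma tr_invariant (K M N : Type) (c : M -> K) (d : N -> K) T : invariant_under d (tr c d T).
Proof. by move=> y x yx [z Tz zy]; exists z => //; exact: sim_trans zy yx. Qed.

Lemma sub_tr (K M : Type) (c : M -> K) (T : set ('I_k -> M)) : T `<=` tr c c T.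
Proof. by move=> x Tx; exists x. Qed.

Lemma tr_sub (K M : Type) (c : M -> K) (T U : set ('I_k -> M)) :
  invariant_under c U -> T `<=` U -> tr c c T `<=` U.
Proof. by move=> Ui TU x [y /TU Uy yx]; exact: Ui yx Uy. Qed.

Lemma tr_mono (K M N : Type) (c : M -> K) (d : N -> K) (T U : set ('I_k -> M)) :
  T `<=` U -> tr c d T `<=` tr c d U.
Proof. by move=> TU x [y /TU Uy yx]; exists y. Qed.

End Similarity.

Definition swap (M : Type) (a b m : M) : M :=
  if `[< m = a >] then b else if `[< m = b >] then a else m.

Lemma swapK (M : Type) (a b : M) : involutive (swap a b).
Proof.
move=> m; rewrite /swap; case: (asboolP (m = a)) => [->|ma].
  by case: asboolP => // _; rewrite asboolT.
case: (asboolP (m = b)) => [->|mb]; first by rewrite asboolT.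
by rewrite !asboolF.
Qed.

Lemma swapl (M : Type) (a b : M) : swap a b a = b.
Proof. by rewrite /swap asboolT. Qed.

Lemma swap_out (M : Type) (a b m : M) : m <> a -> m <> b -> swap a b m = m.
Proof. by move=> ma mb; rewrite /swap !asboolF. Qed.

Lemma swap_color (M K : Type) (c : M -> K) (a b m : M) :
  c a = c b -> c (swap a b m) = c m.
Proof. by move=> ab; rewrite /swap; case: asboolP => [->|_] //; case: asboolP => [->|]. Qed.

(** Coordinates are corrected one at a time by transposing two points of the same colour; equality
    of patterns ensures that the coordinates already correct are not disturbed. *)
Lemma sim_perm k (K M : Type) (c : M -> K) (y x : 'I_k -> M) : sim c c y x ->
  exists f g : M -> M, [/\ cancel f g, cancel g f, forall m, c (f m) = c m &
    forall i, f (y i) = x i].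
Proof.
move=> [E C].
suff H n : n <= k -> exists f g : M -> M, [/\ cancel f g, cancel g f,
    forall m, c (f m) = c m & forall i : 'I_k, i < n -> f (y i) = x i].
  by have [f [g [fg gf cf fyx]]] := H k (leqnn k); exists f, g; split=> // i; exact: fyx.
elim: n => [|n IH] nk; first by exists id, id.
have [f [g [fg gf cf fyx]]] := IH (ltnW nk).
pose a := f (y (Ordinal nk)); pose b := x (Ordinal nk).
exists (swap a b \o f), (g \o swap a b); split.
- by move=> m /=; rewrite swapK fg.
- by move=> m /=; rewrite gf swapK.
- by move=> m /=; rewrite swap_color // /a cf C.
move=> i; rewrite ltnS leq_eqVlt => /orP[/eqP iE|ilt] /=.
  have -> : i = Ordinal nk by apply: val_inj.
  by rewrite -/a swapl.
rewrite fyx //; have [ab|nab] := pselect (x i = b).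
  have <- : a = x i by rewrite -fyx // /a; congr f; apply/esym/E.
  by rewrite swapl -ab -fyx // /a; congr f; apply/E.
have xa : x i <> a.
  by rewrite -fyx // => /(can_inj fg)/E.
exact: swap_out.
Qed.

Lemma color_bij (M N K : Type) (c : M -> K) (d : N -> K) :
  (forall q, exists f g, [/\ forall m, c m = q -> d (f m) = q /\ g (f m) = m &
     forall n, d n = q -> c (g n) = q /\ f (g n) = n]) ->
  exists (f : M -> N) (g : N -> M), [/\ cancel f g, cancel g f & forall m, d (f m) = c m].
Proof.
move=> /choice[F /choice[G FG]].
have H m : d (F (c m) m) = c m by have [/(_ m erefl)[]] := FG (c m).
exists (fun m => F (c m) m), (fun n => G (d n) n); split=> // [m|n].
  by rewrite H; have [/(_ m erefl)[]] := FG (c m).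
have [_ /(_ n erefl)[E1 E2]] := FG (d n).
by rewrite E1 E2.
Qed.

Definition unbounded (A : set nat) : Prop := forall n, exists2 m, n <= m & A m.

Lemma unbounded_enum (A : set nat) : unbounded A ->
  exists e : nat -> nat, [/\ injective e, forall n, A (e n), forall n, n <= e n &
    forall m, A m -> exists n, e n = m].
Proof.
move=> Au.
have nextP n : exists m, [/\ n <= m, A m & forall m', n <= m' -> A m' -> m <= m'].
  have ex : exists m, (n <= m) && `[< A m >].
    by have [m nm Am] := Au n; exists m; rewrite nm asboolT.
  case: (ex_minnP ex) => m /andP[nm /asboolP Am] mmin; exists m; split=> // m' nm' Am'.
  by apply: mmin; rewrite nm' asboolT.
have [next nP] := choice nextP.
pose e n := iter n (fun a => next a.+1) (next 0).
have eS n : e n < e n.+1 by rewrite /e /=; have [] := nP (e n).+1.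
have einc m n : m < n -> e m < e n.
  elim: n => // n IH; rewrite ltnS leq_eqVlt => /orP[/eqP -> //|/IH mn].
  exact: ltn_trans mn (eS n).
have en n : n <= e n by elim: n => // n IH; apply: leq_ltn_trans IH (eS n).
exists e; split=> //.
- by move=> m n emn; case: (ltngtP m n) => // /einc; rewrite emn ltnn.
- by case=> [|n]; rewrite /e /=; [have [] := nP 0|have [] := nP (e n).+1].
move=> m Am.
have e0 : e 0 <= m by have [_ _ H] := nP 0; exact: H.
have bnd n : e n <= m -> n <= m by move=> enm; exact: leq_trans (en n) enm.
have [n enm nmax] := ex_maxnP (ex_intro (fun n => e n <= m) 0 e0) bnd.
exists n; apply/eqP; rewrite eqn_leq enm /= leqNgt; apply/negP => lt.
have : e n.+1 <= m by have [_ _ H] := nP (e n).+1; exact: H.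
by move=> /nmax; rewrite ltnn.
Qed.

Lemma unbounded_fibers (A B : set nat) : unbounded A -> unbounded B ->
  exists f g : nat -> nat, [/\ forall m, A m -> B (f m) /\ g (f m) = m &
    forall n, B n -> A (g n) /\ f (g n) = n].
Proof.
move=> /unbounded_enum[a [ai aA _ As]] /unbounded_enum[b [bi bB _ Bs]].
have /choice[r rP] : forall m, exists n, A m -> a n = m.
  by move=> m; have [/As[n <-]|nA] := pselect (A m); [exists n|exists 0].
have /choice[s sP] : forall m, exists n, B m -> b n = m.
  by move=> m; have [/Bs[n <-]|nA] := pselect (B m); [exists n|exists 0].
exists (b \o r), (a \o s); split=> m Am; split=> //=.
  have -> : s (b (r m)) = r m by apply: bi; exact: sP.
  exact: rP.
have -> : r (a (s m)) = s m by apply: ai; exact: rP.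
exact: sP.
Qed.

Lemma no_injection (n : nat) (f : nat -> nat) :
  injective f -> ~ (forall m, f m < n).
Proof.
move=> fi fn.
have := @leq_card 'I_n.+1 'I_n (fun i => Ordinal (fn i)).
rewrite !card_ord ltnn => H; suff: false by [].
by apply: H => i j /(congr1 val)/fi/val_inj.
Qed.

(** Keeping the first occurrence of each value of [e] removes repetitions, and [h] shows that
    infinitely many values remain. *)
Lemma injective_enum (M : Type) (h e : nat -> M) : injective h ->
  (forall n, exists m, e m = h n) ->
  exists2 e' : nat -> M, injective e' & (forall n, exists m, e' n = e m) /\
    (forall n, exists m, e n = e' m).
Proof.
move=> hi he.
pose A n := forall m, m < n -> e m <> e n.
have first n : exists2 m, A m & e m = e n.
  have ex : exists m, `[< e m = e n >] by exists n; exact: asboolT.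
  case: (ex_minnP ex) => m /asboolP emn mmin; exists m => // m' m'm E.
  by have := mmin m'; rewrite asboolT ?E // leqNgt m'm => /(_ isT).
have Au : unbounded A.
  move=> n; apply: contrapT => nA.
  have An m : A m -> m < n.
    by move=> Am; rewrite ltnNge; apply/negP => nm; apply: nA; exists m.
  have /choice[a aP] : forall j, exists i, i < n /\ e i = h j.
    by move=> j; have [m mh] := he j; have [i Ai ei] := first m; exists i; rewrite ei An.
  apply: (@no_injection n a) => [i j aij|j]; last by case: (aP j).
  by apply: hi; have [_ <-] := aP i; have [_ <-] := aP j; rewrite aij.
have [b [bi bA _ bs]] := unbounded_enum Au; exists (e \o b).
  move=> i j E; apply: bi; have Ai := bA i; have Aj := bA j.
  by case: (ltngtP (b i) (b j)) => // [/Aj|/Ai]; case.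
split=> n; first by exists (b n).
by have [m /bs[j <-] E] := first n; exists j.
Qed.

(** * A sentence of FO(E) for relations between two bounds *)

Lemma team_sat_alls (S : signature) (M : model S) (p : tform S) vs (X : set (assignment M)) :
  team_sat X (foldr (@TAll S) p vs) <->
  team_sat [set t | exists s ms, [/\ X s, size ms = size vs & t = updl s vs ms]] p.
Proof.
elim: vs X => [|v vs IH] X /=.
  set Y := (X in _ <-> team_sat X p); suff -> : Y = X by [].
  apply/seteqP; split=> s; last by move=> Xs; exists s, [::].
  by move=> [t [ms [Xt sz ->]]]; case: ms sz.
rewrite IH; set Y := (X in team_sat X p <-> _); set Z := (X in _ <-> team_sat X p).
suff -> : Y = Z by [].
apply/seteqP; split=> t.
  move=> [_ [ms [[s [m [Xs ->]]] sz ->]]]; exists s, (m :: ms).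
  by rewrite /= sz.
move=> [s [[|m ms] [Xs]]] //= [sz] ->; exists (upd s v m), ms; split=> //.
by exists s, m.
Qed.

Section FamilySentence.
Variable k : nat.

(* The arity of a relation Om(u, i, y, x), written as a successor for [inord]. *)
Definition famar : nat := (1 + k + k).+1.

Definition uncurry_fam (M : Type) (Om : M -> M -> ('I_k -> M) -> ('I_k -> M) -> Prop) :
    set ('I_famar -> M) :=
  [set w | Om (w (inord 0)) (w (inord 1)) (fun j => w (inord (2 + j)))
              (fun j => w (inord (2 + k + j)))].

Definition fam_y (j : 'I_k) : nat := 2 + j.
Definition fam_x (j : 'I_k) : nat := 2 + k + j.

Lemma fam_y_inj : injective fam_y.
Proof. by move=> i j /addnI/val_inj. Qed.

Lemma fam_x_inj : injective fam_x.
Proof. by move=> i j /addnI/val_inj. Qed.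

Lemma fam_y_x j : fam_y j \notin codom fam_x.
Proof.
apply/codomP => -[i /eqP]; rewrite /fam_y /fam_x -addnA eqn_add2l => /eqP E.
by have := ltn_ord j; rewrite E ltnNge leq_addr.
Qed.

Lemma fam_small v : v < 2 -> (v \notin codom fam_x) /\ (v \notin codom fam_y).
Proof.
move=> v2; split; apply/codomP => -[i E]; move: v2; rewrite E /fam_x /fam_y ?addnA.
  by rewrite ltnNge -addnA leq_addr.
by rewrite ltnNge leq_addr.
Qed.

Definition fam_row (M : Type) (u i : M) (y x : 'I_k -> M) : assignment M :=
  updl (updl (upd (upd (@empty_assignment M) 0 u) 1 i) (codom fam_y) (codom y))
       (codom fam_x) (codom x).

Lemma fam_row0 M (u i : M) y x : fam_row u i y x 0 = Some u.
Proof. by have [H H'] := @fam_small 0 isT; rewrite /fam_row !updl_notin. Qed.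

Lemma fam_row1 M (u i : M) y x : fam_row u i y x 1 = Some i.
Proof. by have [H H'] := @fam_small 1 isT; rewrite /fam_row !updl_notin. Qed.

Lemma fam_rowy M (u i : M) y x (j : 'I_k) : fam_row u i y x (2 + j) = Some (y j).
Proof.
rewrite /fam_row updl_notin ?fam_y_x //.
by rewrite -[2 + j]/(fam_y j) updl_codom //; exact: fam_y_inj.
Qed.

Lemma fam_rowx M (u i : M) y x (j : 'I_k) : fam_row u i y x (2 + k + j) = Some (x j).
Proof. by rewrite /fam_row -[2 + k + j]/(fam_x j) updl_codom //; exact: fam_x_inj. Qed.

Lemma fam_row_inj M (u i u' i' : M) y x y' x' :
  fam_row u i y x = fam_row u' i' y' x' -> [/\ u = u', i = i', y = y' & x = x'].
Proof.
move=> E; split.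
- by have := congr1 (@^~ 0) E; rewrite !fam_row0 => -[].
- by have := congr1 (@^~ 1) E; rewrite !fam_row1 => -[].
- by apply: funext => j; have := congr1 (@^~ (2 + j)) E; rewrite !fam_rowy => -[].
- by apply: funext => j; have := congr1 (@^~ (2 + k + j)) E; rewrite !fam_rowx => -[].
Qed.

Lemma famar_case v : v < famar ->
  [\/ v = 0, v = 1, exists j : 'I_k, v = 2 + j | exists j : 'I_k, v = 2 + k + j].
Proof.
rewrite /famar; case: v => [|[|v]]; [by constructor 1|by constructor 2|].
rewrite !addSn add0n !ltnS => vk; have [vk'|kv] := ltnP v k.
  by constructor 3; exists (Ordinal vk').
have vk' : v - k < k by rewrite ltn_subLR.
by constructor 4; exists (Ordinal vk'); rewrite /= ?addSn ?add0n subnKC.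
Qed.

Lemma fam_literal_sat (M : domain) Om (u i : M) y x :
  literal_sat (M := relmodel (uncurry_fam Om)) (fam_row u i y x)
    (@LRel (sigR famar) true tt (fun j => Var (val j))) <-> Om u i y x.
Proof.
have inordE n : n < famar -> val (inord n : 'I_famar) = n by move=> nf; rewrite /= inordK.
have y_lt (j : 'I_k) : 2 + j < famar.
  by rewrite /famar !addSn add0n !ltnS ltn_addr.
have x_lt (j : 'I_k) : 2 + k + j < famar.
  by rewrite /famar !addSn add0n !ltnS ltn_add2l.
split=> [[c [cv]] /=|Omr].
  rewrite /uncurry_fam /=.
  have -> : c (inord 0) = u.
    by have /= := cv (inord 0); rewrite [X in fam_row _ _ _ _ X]inordE // fam_row0 => -[].
  have -> : c (inord 1) = i.
    by have /= := cv (inord 1); rewrite [X in fam_row _ _ _ _ X]inordE // fam_row1 => -[].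
  have -> : (fun j : 'I_k => c (inord (2 + j))) = y.
    apply: funext => j; have /= := cv (inord (2 + j)).
    by rewrite [X in fam_row _ _ _ _ X]inordE // fam_rowy => -[].
  have -> // : (fun j : 'I_k => c (inord (2 + k + j))) = x.
  apply: funext => j; have /= := cv (inord (2 + k + j)).
  by rewrite [X in fam_row _ _ _ _ X]inordE // fam_rowx => -[].
exists (fun j => odflt u (fam_row u i y x (val j))); split.
  move=> j /=; case: (famar_case (ltn_ord j)) => [->|->|[l ->]|[l ->]].
  - by rewrite fam_row0.
  - by rewrite fam_row1.
  - by rewrite fam_rowy.
  - by rewrite fam_rowx.
rewrite /uncurry_fam /= !inordE // fam_row0 fam_row1 /=.
have -> : (fun j : 'I_k => odflt u (fam_row u i y x (val (inord (2 + j) : 'I_famar)))) = y.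
  by apply: funext => j; rewrite inordE // fam_rowy.
have -> // : (fun j : 'I_k => odflt u (fam_row u i y x (val (inord (2 + k + j) : 'I_famar)))) = x.
by apply: funext => j; rewrite inordE // fam_rowx.
Qed.

End FamilySentence.

(** [W] is the final team of [fam_tform] read as a relation. The third condition reflects that y is
    quantified universally after i; [E] sees only the projection to x. *)
Definition fam_sem (E : dependency) (M : domain)
    (Om : M -> M -> ('I_(dep_arity E) -> M) -> ('I_(dep_arity E) -> M) -> Prop) : Prop :=
  exists W : M -> M -> ('I_(dep_arity E) -> M) -> ('I_(dep_arity E) -> M) -> Prop,
  [/\ forall u i y x, W u i y x -> Om u i y x,
      forall u, exists i y x, W u i y x,
      forall u i y x y', W u i y x -> exists x', W u i y' x' &
      dep_mem E [set x | exists u i y, W u i y x]].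

Section FamilyDefinable.
Variable E : dependency.
Let k := dep_arity E.

(* forall u, exists i, forall y, exists x, (Om(u, i, y, x) /\ E x) *)
Definition fam_tform : tform (sigR (famar k)) :=
  TAll 0 (TEx 1 (foldr (@TAll _) (foldr (@TEx _)
    (TAnd (TLit (@LRel (sigR (famar k)) true tt (fun j => Var (val j))))
          (@TAtom (sigR (famar k)) (Plain E) (@fam_x k)))
    (codom (@fam_x k))) (codom (@fam_y k)))).

Lemma tform_alls_fv (S : signature) (p : tform S) vs :
  tform_fv (foldr (@TAll S) p vs) = tform_fv p `\` [set v | v \in vs].
Proof. by rewrite -tform_exs_fv; elim: vs => //= v vs ->. Qed.

Lemma fam_tform_sentence : tform_sentence fam_tform.
Proof.
rewrite /tform_sentence /fam_tform /= tform_alls_fv tform_exs_fv /=.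
apply/seteqP; split=> // v [[[[H nx] ny] n1] n0].
case: H => [[j vE]|[j _ E']]; last by apply: nx; rewrite /= -E' codom_f.
case: (famar_case (ltn_ord j)) => [j0|j1|[l jE]|[l jE]].
- by apply: n0; rewrite vE; exact: j0.
- by apply: n1; rewrite vE; exact: j1.
- by apply: ny; rewrite vE; apply/codomP; exists l.
- by apply: nx; rewrite vE; apply/codomP; exists l.
Qed.

Lemma fam_tform_true (M : domain) Om :
  team_true (relmodel (uncurry_fam Om)) fam_tform <-> @fam_sem E M Om.
Proof.
have [m0 _] := domain_two M.
rewrite /team_true /fam_tform /=; set X1 := (X in exists H, (forall s, X s -> _) /\ _).
have X1E s : X1 s <-> exists u, s = upd (@empty_assignment M) 0 u.
  by split=> [[_ [u [-> ->]]]|[u ->]]; [exists u|exists (@empty_assignment M), u].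
split.
  move=> [H [H0 /team_sat_alls/team_sat_exs]] [X4 [/= [X4l X4E] X34 X43]].
  have X4row t : X4 t -> exists u i (y x : 'I_k -> M), [/\ t = fam_row u i y x &
      H (upd (@empty_assignment M) 0 u) i].
    move=> /X43[_ [xs [[_ [ys [[s [i [/X1E[u ->] Hi ->]]] szy ->]] szx ->]]]].
    exists u, i, (fun j => nth m0 ys j), (fun j => nth m0 xs j); split=> //.
    have Ey : ys = codom (fun j : 'I_k => nth m0 ys j) := seq_codom m0 szy.
    have Ex : xs = codom (fun j : 'I_k => nth m0 xs j) := seq_codom m0 szx.
    by rewrite [in LHS]Ey [in LHS]Ex.
  have ext u i (y : 'I_k -> M) : H (upd (@empty_assignment M) 0 u) i -> exists x : 'I_k -> M, X4 (fam_row u i y x).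
    move=> Hi.
    have [|xs szx X4x] := X34 (updl (upd (upd (@empty_assignment M) 0 u) 1 i)
        (codom (@fam_y k)) (codom y)).
      exists (upd (upd (@empty_assignment M) 0 u) 1 i), (codom y); split=> //.
        exists (upd (@empty_assignment M) 0 u), i; split=> //.
        by apply/X1E; exists u.
      by rewrite !size_codom_ord.
    exists (fun j => nth m0 xs j); move: X4x.
    by rewrite [in X in X -> _](seq_codom m0 szx : xs = codom (fun j : 'I_k => nth m0 xs j)).
  exists (fun u i y x => X4 (fam_row u i y x)); split.
  - by move=> u i y x X4x; apply/fam_literal_sat; exact: X4l X4x.
  - move=> u; have [|i Hi] := H0 (upd (@empty_assignment M) 0 u); first by apply/X1E; exists u.
    by have [x X4x] := ext u i (fun=> m0) Hi; exists i, (fun=> m0), x.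
  - move=> u i y x y' /X4row[u' [i' [y1 [x1 [rE Hi]]]]].
    have [uE iE _ _] := fam_row_inj rE; rewrite uE iE.
    exact: ext.
  - suff <- : team_rel X4 (@fam_x k) = [set x | exists u i y, X4 (fam_row u i y x)] by [].
    apply/seteqP; split=> x.
      move=> [t X4t tx]; have [u [i [y [x' [tE _]]]]] := X4row t X4t.
      exists u, i, y; suff -> : x = x' by rewrite -tE.
      by apply: funext => j; have := tx j; rewrite tE fam_rowx => -[].
    by move=> [u [i [y X4x]]]; exists (fam_row u i y x) => // j; rewrite fam_rowx.
move=> [W [WOm W0 Wy WE]].
exists (fun s => [set i | exists u y x, s 0 = Some u /\ W u i y x]); split.
  by move=> s /X1E[u ->]; have [i [y [x Wx]]] := W0 u; exists i, u, y, x.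
apply/team_sat_alls/team_sat_exs.
exists [set t | exists u i y x, W u i y x /\ t = fam_row u i y x]; split.
- split; first by move=> _ [u [i [y [x [Wx ->]]]]]; apply/fam_literal_sat; exact: WOm.
  rewrite /=; suff -> : team_rel [set t | exists u i y x, W u i y x /\ t = fam_row u i y x]
      (@fam_x k) = [set x | exists u i y, W u i y x] by [].
  apply/seteqP; split=> x.
    move=> [_ [u [i [y [x' [Wx ->]]]]] tx]; exists u, i, y; suff -> : x = x' by [].
    by apply: funext => j; have := tx j; rewrite fam_rowx => -[].
  move=> [u [i [y Wx]]]; exists (fam_row u i y x); first by exists u, i, y, x.
  by move=> j; rewrite fam_rowx.
- move=> _ [_ [ys [[s [i [/X1E[u ->] [u' [y [x [u0 Wx]]]] ->]]] szy ->]]].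
  move: u0 Wx; rewrite {1}/upd /= => -[<-] Wx.
  have [x' Wx'] := Wy _ _ _ _ (fun j => nth m0 ys j) Wx.
  exists (codom x'); first by rewrite !size_codom_ord.
  exists u, i, (fun j => nth m0 ys j), x'; split=> //.
  by rewrite [in LHS](seq_codom m0 szy : ys = codom (fun j : 'I_k => nth m0 ys j)).
- move=> _ [u [i [y [x [Wx ->]]]]].
  exists (updl (upd (upd (@empty_assignment M) 0 u) 1 i) (codom (@fam_y k)) (codom y)), (codom x).
  split=> //; last by rewrite !size_codom_ord.
  exists (upd (upd (@empty_assignment M) 0 u) 1 i), (codom y); split=> //.
    exists (upd (@empty_assignment M) 0 u), i; split=> //; first by apply/X1E; exists u.
    by exists u, y, x.
  by rewrite !size_codom_ord.
Qed.

(** Towards the normal form, strong first-orderness is exploited only through this equivalence, to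
    which the ultraproduct and submodel theorems then apply. *)
Lemma fam_sem_fo : strongly_fo E ->
  exists q : fo (sigR (famar k)), fo_sentence q /\
    forall (M : domain) Om, fo_true (relmodel (uncurry_fam Om)) q <-> @fam_sem E M Om.
Proof.
move=> /(_ (sigR (famar k)) fam_tform)[||q [q0 qP]].
- rewrite /FO_of /= ; do 2 (elim: (codom _) => //=).
  by split=> //; exists E.
- exact: fam_tform_sentence.
by exists q; split=> // M Om; rewrite -qP fam_tform_true.
Qed.

End FamilyDefinable.

(** * Ultraproducts *)

Definition free_ultra (U : set (set nat)) : Prop :=
  [/\ forall A B, U A -> U B -> U (A `&` B), forall A B, A `<=` B -> U A -> U B,
      forall A, U A \/ U (~` A), ~ U set0 & forall N, U [set n | N <= n]].

Lemma free_ultra_exists : exists U, free_ultra U.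
Proof.
have [U [UU sU]] := ultraFilterLemma eventually_filter.
have UP : ProperFilter U := ultra_proper; have UF : Filter U := filter_filter.
exists U; split.
- by move=> A B; exact: filterI.
- by move=> A B; exact: filterS.
- by move=> A; exact: in_ultra_setVsetC.
- exact: filter_not_empty.
- by move=> N; apply: sU; exists N.
Qed.

Section AlmostEverywhere.
Variables (U : set (set nat)) (hU : free_ultra U).
Implicit Types P Q : nat -> Prop.

Definition ae P : Prop := U [set n | P n].

Lemma ae_mono P Q : (forall n, P n -> Q n) -> ae P -> ae Q.
Proof. by have [_ US _ _ _] := hU; move=> PQ; apply: US => n; exact: PQ. Qed.

Lemma ae_and P Q : ae P -> ae Q -> ae (fun n => P n /\ Q n).
Proof. by have [UI _ _ _ _] := hU; exact: UI. Qed.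

Lemma ae_not P : ae (fun n => ~ P n) <-> ~ ae P.
Proof.
have [_ US UC U0 _] := hU; split=> [nP aP|naP]; last by case: (UC [set n | P n]).
by apply: U0; apply: US (ae_and nP aP) => n [].
Qed.

Lemma ae_true P : (forall n, P n) -> ae P.
Proof.
have [_ US _ _ UN] := hU.
by move=> HP; apply: US (UN 0) => n _; exact: HP.
Qed.

Lemma ae_ge N : ae (fun n => N <= n).
Proof. by have [_ _ _ _ UN] := hU; exact: UN. Qed.

Lemma ae_ex P : ae P -> exists n, P n.
Proof.
have [_ US _ U0 _] := hU; move=> aP; apply: contrapT => nP; apply: U0.
by apply: US aP => n Pn; apply: nP; exists n.
Qed.

Lemma ae_imp P Q : ae (fun n => P n -> Q n) <-> (ae P -> ae Q).
Proof.
split=> [aPQ aP|aPQ]; first by apply: ae_mono (ae_and aPQ aP) => n [H /H].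
have [/aPQ|/ae_not] := pselect (ae P); first exact: ae_mono.
by apply: ae_mono => n nP /nP.
Qed.

Lemma ae_andE P Q : ae (fun n => P n /\ Q n) <-> ae P /\ ae Q.
Proof.
split=> [H|[]]; last exact: ae_and.
by split; apply: ae_mono H => n [].
Qed.

Lemma ae_orE P Q : ae (fun n => P n \/ Q n) <-> ae P \/ ae Q.
Proof.
split=> [H|[]]; [|by apply: ae_mono; left|by apply: ae_mono; right].
apply: contrapT => /not_orP[/ae_not nP /ae_not nQ].
by have [n [[nPn nQn] [/nPn|/nQn]]] := ae_ex (ae_and (ae_and nP nQ) H).
Qed.

Lemma ae_iff P Q : ae (fun n => P n <-> Q n) -> ae P <-> ae Q.
Proof.
by move=> H; split=> aP; apply: ae_mono (ae_and H aP) => n [PQ] /PQ.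
Qed.

Lemma ae_fin (I : finType) (P : I -> nat -> Prop) :
  (forall i, ae (P i)) -> ae (fun n => forall i, P i n).
Proof.
move=> aP.
have : ae (fun n => forall i, i \in enum I -> P i n).
  elim: (enum I) => [|i r IH]; first exact: ae_true.
  apply: ae_mono (ae_and (aP i) IH) => n [Pi Pr] j.
  by rewrite inE => /orP[/eqP ->|/Pr].
by apply: ae_mono => n H i; apply: H; rewrite mem_enum.
Qed.

Lemma ae_color (K : nat) (f : nat -> nat) :
  (forall n, f n < K) -> exists2 q, q < K & ae (fun n => f n = q).
Proof.
move=> fK; apply: contrapT => nq.
have /ae_ex[n H] : ae (fun n => forall q : 'I_K, f n <> q).
  by apply: ae_fin => q; apply/ae_not => aq; apply: nq; exists q.
exact: (H (Ordinal (fK n))).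
Qed.

Variable M : nat -> domain.

(* Not [set (forall n, M n)], whose universe is above that of domains. *)
Definition upoint := {C : (forall n, M n) -> Prop |
  exists f, C = fun g => ae (fun n => f n = g n)}.

Definition ucls (f : forall n, M n) : upoint :=
  exist _ (fun g => ae (fun n => f n = g n)) (ex_intro _ f erefl).

Definition urep (C : upoint) : forall n, M n := sval (cid (svalP C)).

Lemma ucls_eq f g : ucls f = ucls g <-> ae (fun n => f n = g n).
Proof.
split=> [/(congr1 sval)/(congr1 (@^~ g)) /= E|H]; first by rewrite E; exact: ae_true.
apply: eq_exist; apply: funext => h; apply: propext; split=> fh.
  by apply: ae_mono (ae_and H fh) => n [<- <-].
by apply: ae_mono (ae_and H fh) => n [-> ->].
Qed.

Lemma urepK C : ucls (urep C) = C.
Proof.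
rewrite /urep; case: (cid (svalP C)) => f /= fE.
by case: C fE => C h /= fE; apply: eq_exist; rewrite fE.
Qed.

Lemma uclsK f : ae (fun n => urep (ucls f) n = f n).
Proof. by apply/ucls_eq; rewrite urepK. Qed.

Lemma udomain_two : exists a b : upoint, a <> b.
Proof.
pose a n : M n := sval (cid (domain_two (M n))).
pose b n : M n := sval (cid (svalP (cid (domain_two (M n))))).
exists (ucls a), (ucls b) => /ucls_eq/ae_ex[n].
by rewrite /a /b; case: cid => ? /= ?; case: cid.
Qed.

Definition udom : domain := Domain udomain_two.

Definition urel k (R : forall n, set ('I_k -> M n)) : set ('I_k -> udom) :=
  [set c | ae (fun n => R n (fun i => urep (c i) n))].

Lemma ae_choice (P : forall n, M n -> Prop) :
  ae (fun n => exists m, P n m) -> exists f : forall n, M n, ae (fun n => P n (f n)).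
Proof.
move=> H.
have f n : {m : M n | (exists m, P n m) -> P n m}.
  have [a _] := cid (domain_two (M n)).
  by case: (pselect (exists m, P n m)) => [/cid[m Pm]|nP]; [exists m|exists a].
exists (fun n => sval (f n)); apply: ae_mono H => n; exact: svalP (f n).
Qed.

Lemma urel_eq k (c : 'I_k -> udom) (f : forall n, 'I_k -> M n) :
  (forall i, c i = ucls (fun n => f n i)) ->
  ae (fun n => (fun i => urep (c i) n) = f n).
Proof.
move=> cf; have H : ae (fun n => forall i, urep (c i) n = f n i).
  by apply: ae_fin => i; rewrite cf; exact: uclsK.
by apply: ae_mono H => n H; apply: funext.
Qed.

End AlmostEverywhere.

Arguments urel {U} hU {M k} R.

Definition var_of K (t : term (sigR K)) : nat :=
  match t with Var x => x | App f _ => match f with end end.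

Lemma term_val_var K (M : model (sigR K)) (t : nat -> M) u m :
  term_val (tot t) u m <-> t (var_of u) = m.
Proof. by case: u => [x|[]] /=; rewrite /tot; split=> [[]|->]. Qed.

Lemma literal_sat_eqE K (M : model (sigR K)) (t : nat -> M) b u w :
  literal_sat (tot t) (LEq b u w) <->
  if b then t (var_of u) = t (var_of w) else t (var_of u) <> t (var_of w).
Proof.
split=> [[m [n [/term_val_var <- /term_val_var <-]]]//|H].
by exists (t (var_of u)), (t (var_of w)); split=> //; exact/term_val_var.
Qed.

Lemma literal_sat_relE K (M : domain) (R : set ('I_K -> M)) (t : nat -> M) b (a : 'I_K -> _) :
  literal_sat (M := relmodel R) (tot t) (@LRel (sigR K) b tt a) <->
  if b then R (fun i => t (var_of (a i))) else ~ R (fun i => t (var_of (a i))).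
Proof.
split=> [[c [cv]]|H] /=.
  suff -> : (fun i => t (var_of (a i))) = c by [].
  by apply: funext => i; apply/(term_val_var (M := relmodel R)); exact: cv.
exists (fun i => t (var_of (a i))); split=> // i.
exact/(term_val_var (M := relmodel R)).
Qed.

Section Los.
Variables (U : set (set nat)) (hU : free_ultra U) (M : nat -> domain).
Let uM := udom hU M.

(** Los's theorem. A witness chosen coordinatewise agrees only almost everywhere with the
    representative [urep] of its class; [cls] bridges the two. *)
Lemma los K (R : forall n, set ('I_K -> M n)) (p : fo (sigR K)) (t : nat -> uM) :
  fo_sat (M := relmodel (urel hU R)) (tot t) p <->
  ae U (fun n => fo_sat (M := relmodel (R n)) (tot (fun v => urep (t v) n)) p).
Proof.
have ex v q (s : nat -> uM) :
    (forall s : nat -> uM, fo_sat (M := relmodel (urel hU R)) (tot s) q <->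
      ae U (fun n => fo_sat (M := relmodel (R n)) (tot (fun v => urep (s v) n)) q)) ->
    (forall m : uM, fo_sat (M := relmodel (urel hU R)) (upd (tot s) v m) q <->
      ae U (fun n => fo_sat (M := relmodel (R n))
            (upd (tot (fun v => urep (s v) n)) v (urep m n)) q)).
  move=> IH m; rewrite upd_tot IH; apply: ae_iff => //; apply: ae_true => // n.
  rewrite upd_tot; suff -> : (fun w => urep (updt s v m w) n) =
    updt (fun w => urep (s w) n) v (urep m n) by [].
  by apply: funext => w; rewrite /updt; case: eqP.
have cls v q (s : nat -> uM) (f : forall n, M n) :
    ae U (fun n => fo_sat (M := relmodel (R n)) (upd (tot (fun v => urep (s v) n)) v (f n)) q) <->
    ae U (fun n => fo_sat (M := relmodel (R n))
         (upd (tot (fun v => urep (s v) n)) v (urep (ucls U f) n)) q).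
  by apply: (ae_iff hU); apply: (ae_mono hU) (uclsK hU f) => n ->.
elim: p t => [l|p IHp q IHq|p IHp q IHq|v p IHp|v p IHp] t.
- case: l => [b u w|b [] a].
    rewrite -[fo_sat _ _]/(literal_sat (M := relmodel (urel hU R)) (tot t) (LEq b u w)).
    rewrite literal_sat_eqE.
    have eqE m n' : m = n' :> uM <-> ae U (fun n => urep m n = urep n' n).
      by rewrite -(ucls_eq hU) !urepK.
    case: b; rewrite eqE; last rewrite -(ae_not hU).
      apply: (ae_iff hU); apply: (ae_true hU) => n; symmetry.
      exact: (literal_sat_eqE (M := relmodel (R n)) _ true).
    apply: (ae_iff hU); apply: (ae_true hU) => n; symmetry.
    exact: (literal_sat_eqE (M := relmodel (R n)) _ false).
  rewrite -[fo_sat _ _]/(literal_sat (M := relmodel (urel hU R)) (tot t) (LRel b a)) literal_sat_relE.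
  case: b; last rewrite -(ae_not hU).
    apply: (ae_iff hU); apply: (ae_true hU) => n; symmetry.
    exact: (literal_sat_relE (R n) _ true).
  apply: (ae_iff hU); apply: (ae_true hU) => n; symmetry.
  exact: (literal_sat_relE (R n) _ false).
- by rewrite /= IHp IHq -(ae_andE hU).
- by rewrite /= IHp IHq -(ae_orE hU).
- rewrite /=; split=> [[m /(ex _ _ _ IHp)]|].
    by apply: (ae_mono hU) => n; exists (urep m n).
  move=> /(ae_choice hU)[f /cls pf]; exists (ucls U f).
  exact/(ex _ _ _ IHp).
- rewrite /=; split=> [H|H m].
    apply: contrapT => /(ae_not hU) N.
    have /(ae_choice hU)[f] : ae U (fun n => exists m, ~ fo_sat (M := relmodel (R n))
        (upd (tot (fun v => urep (t v) n)) v m) p).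
      by apply: (ae_mono hU) N => n /existsNP.
    move=> /(ae_not hU); apply; apply/cls/(ex _ _ _ IHp); exact: H.
  by apply/(ex _ _ _ IHp); apply: (ae_mono hU) H => n; exact.
Qed.

Lemma los_true K (R : forall n, set ('I_K -> M n)) (p : fo (sigR K)) : fo_sentence p ->
  fo_true (relmodel (urel hU R)) p <-> ae U (fun n => fo_true (relmodel (R n)) p).
Proof.
move=> p0; have [a _] := domain_two uM.
rewrite /fo_true (fo_sentence_sat _ (tot (fun=> a) : assignment (relmodel (urel hU R))) p0) los.
by apply: (ae_iff hU); apply: (ae_true hU) => n; exact: fo_sentence_sat.
Qed.

End Los.

(** * Countable elementary submodels *)

Lemma nat_two : exists a b : nat, a <> b.
Proof. by exists 0, 1. Qed.

Definition natD : domain := Domain nat_two.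

Section Subformulas.
Variable S : signature.

Fixpoint subforms (p : fo S) : seq (fo S) :=
  p :: match p with
       | FLit _ => [::]
       | FAnd p q | FOr p q => subforms p ++ subforms q
       | FEx _ p | FAll _ p => subforms p
       end.

Fixpoint subform_in (p : fo S) (l : seq (fo S)) : Prop :=
  if l is q :: l' then q = p \/ subform_in p l' else False.

Lemma subform_in_cat p l l' : subform_in p (l ++ l') <-> subform_in p l \/ subform_in p l'.
Proof. by elim: l => [|q l IH] /=; [split=> [|[]]; auto|rewrite IH; tauto]. Qed.

Lemma subform_in_nth p l : subform_in p l -> exists i, nth (fo_top S) l i = p.
Proof.
elim: l => //= q l IH [->|/IH[i <-]]; first by exists 0.
by exists i.+1.
Qed.

Lemma subforms_self p : subform_in p (subforms p).
Proof. by case: p => *; left. Qed.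

End Subformulas.

Definition pick_in (M : Type) (m0 : M) (P : M -> Prop) : M :=
  if pselect (exists m, P m) is left h then sval (cid h) else m0.

Lemma pick_inP (M : Type) (m0 : M) (P : M -> Prop) : (exists m, P m) -> P (pick_in m0 P).
Proof. by rewrite /pick_in; case: pselect => // h _; exact: svalP (cid h). Qed.

Section Skolem.
Variables (K : nat) (M : domain) (m0 : M).

Definition witness (R : set ('I_K -> M)) (p : fo (sigR K)) (l : seq M) : M :=
  match p with
  | FEx v q => pick_in m0 (fun m =>
      fo_sat (M := relmodel R) (tot (updt (nth m0 l) v m)) q)
  | FAll v q => pick_in m0 (fun m =>
      ~ fo_sat (M := relmodel R) (tot (updt (nth m0 l) v m)) q)
  | _ => m0
  end.

(** The Tarski-Vaught criterion: the range of [e] contains witnesses for existential subformulas and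
    counterexamples for universal ones. By [trunc], finite lists of parameters are enough. *)
Lemma witness_elementary (e : nat -> M) (R : set ('I_K -> M)) (p : fo (sigR K)) :
  injective e ->
  (forall q, subform_in q (subforms p) -> forall l, exists m, witness R q (map e l) = e m) ->
  forall t : nat -> nat, fo_sat (M := relmodel R) (tot (e \o t)) p <->
    fo_sat (M := @relmodel K natD [set w | R (e \o w)]) (tot (t : nat -> natD)) p.
Proof.
move=> ei.
have upE (t : nat -> nat) v m : updt (e \o t) v (e m) = e \o updt t v m.
  by apply: funext => w; rewrite /updt /=; case: eqP.
have trunc (q : fo (sigR K)) (t : nat -> nat) v : exists l, forall m,
    fo_sat (M := relmodel R) (tot (updt (e \o t) v m)) q <->
    fo_sat (M := relmodel R) (tot (updt (nth m0 (map e l)) v m)) q.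
  have [B BP] := fo_bound q; exists (map t (iota 0 B)) => m.
  apply: fo_sat_eq => w /BP wB; rewrite /tot /updt; case: eqP => // _.
  by rewrite -map_comp (nth_map 0) ?size_iota // nth_iota.
elim: p => [l|p IHp q IHq|p IHp q IHq|v p IHp|v p IHp] H t.
- case: l {H} => [b u w|b [] a].
    rewrite -[X in X <-> _]/(literal_sat (M := relmodel R) (tot (e \o t)) (LEq b u w)).
    rewrite -[X in _ <-> X]/(literal_sat (M := @relmodel K natD [set w | R (e \o w)])
      (tot (t : nat -> natD)) (LEq b u w)).
    rewrite !literal_sat_eqE /=; case: b; first by split=> [/ei|->].
    by split=> [E /(congr1 e)|E /ei].
  rewrite -[X in X <-> _]/(literal_sat (M := relmodel R) (tot (e \o t)) (LRel b a)).
  rewrite -[X in _ <-> X]/(literal_sat (M := @relmodel K natD [set w | R (e \o w)])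
      (tot (t : nat -> natD)) (LRel b a)).
  by rewrite !literal_sat_relE.
- by rewrite /= IHp ?IHq // => r rp; apply: H => /=; right; rewrite subform_in_cat; auto.
- by rewrite /= IHp ?IHq // => r rp; apply: H => /=; right; rewrite subform_in_cat; auto.
- have {}IHp := IHp (fun q qp => H q (or_intror qp)); rewrite /=; split=> [[m]|[m]].
    rewrite upd_tot; have [l lP] := trunc p t v; rewrite lP => pm.
    have [m' m'E] := H _ (subforms_self (FEx v p)) l.
    exists m'; rewrite upd_tot; apply/IHp; rewrite -upE lP -m'E /=.
    exact: (@pick_inP _ m0 (fun m => fo_sat (M := relmodel R)
      (tot (updt (nth m0 (map e l)) v m)) p) (ex_intro _ m pm)).
  by rewrite upd_tot => /IHp pm; exists (e m); rewrite upd_tot upE.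
- have {}IHp := IHp (fun q qp => H q (or_intror qp)); rewrite /=; split=> [pm m|pm m].
    by rewrite upd_tot; apply/IHp; rewrite -upE -upd_tot.
  rewrite upd_tot; have [l lP] := trunc p t v; apply: contrapT; rewrite lP => npm.
  have [m' m'E] := H _ (subforms_self (FAll v p)) l.
  have := pm m'; rewrite upd_tot => /IHp; rewrite -upE lP -m'E /=.
  exact: (@pick_inP _ m0 (fun m => ~ fo_sat (M := relmodel R)
      (tot (updt (nth m0 (map e l)) v m)) p) (ex_intro _ m npm)).
Qed.

End Skolem.

Section Hull.
Variables (M : Type) (h : nat -> M) (op : nat -> seq M -> M).

Fixpoint hull_val (t : GenTree.tree nat) : M :=
  match t with
  | GenTree.Leaf n => h n
  | GenTree.Node n ts => op n (map hull_val ts)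
  end.

(** The closure of the range of [h] under the operations consists of the values of finite trees,
    hence is countable; it is infinite because [h] is injective. *)
Lemma hull : injective h -> exists e : nat -> M, [/\ injective e,
  forall n, exists m, h n = e m & forall n l, exists m, op n (map e l) = e m].
Proof.
move=> hi.
pose tree n : GenTree.tree nat := odflt (GenTree.Leaf 0) (unpickle n).
pose e0 n := hull_val (tree n).
have treeK t : tree (pickle t) = t by rewrite /tree pickleK.
have he n : exists m, e0 m = h n.
  by exists (pickle (GenTree.Leaf n)); rewrite /e0 treeK.
have [e ei [ee0 e0e]] := injective_enum hi he; exists e; split=> //.
  by move=> n; have [m <-] := he n; exact: e0e.
have [a aP] := choice ee0.
move=> n l; have -> : map e l = map hull_val (map (tree \o a) l).
  by rewrite -map_comp; apply: eq_map => i; rewrite /= aP.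
have [m mE] := e0e (pickle (GenTree.Node n (map (tree \o a) l))).
by exists m; rewrite -mE /e0 treeK.
Qed.

End Hull.

(** Countably many sentences are preserved at once, each in relations whose parameters are taken
    from the very submodel being built; closing under [g] adds further Skolem functions when
    needed. *)
Lemma lowenheim_skolem (K : nat) (M : domain) (h : nat -> M) (q : nat -> fo (sigR K))
    (R : nat -> seq M -> set ('I_K -> M)) (g : nat -> seq M -> M) :
  injective h -> (forall n, fo_sentence (q n)) ->
  exists e : nat -> M, [/\ injective e, forall n, exists m, h n = e m,
    forall n l, exists m, g n (map e l) = e m &
    forall n l, fo_true (relmodel (R n (map e l))) (q n) <->
      fo_true (@relmodel K natD [set w | R n (map e l) (e \o w)]) (q n)].
Proof.
move=> hi q0; pose m0 := h 0.
(* For an index [(n, i, z)] the first [z] arguments are parameters of the relation, and the others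
   are values for the variables of the [i]-th subformula. *)
pose op (N : nat) (l : seq M) : M :=
  match unpickle N : option (nat + nat * nat * nat) with
  | Some (inl n) => g n l
  | Some (inr (n, i, z)) =>
      witness m0 (R n (take z l)) (nth (fo_top _) (subforms (q n)) i) (drop z l)
  | None => m0
  end.
have [e [ei he eop]] := hull op hi; exists e; split=> //.
  by move=> n l; have := eop (pickle (inl n : nat + nat * nat * nat)) l; rewrite /op pickleK.
move=> n l; rewrite /fo_true.
rewrite (fo_sentence_sat _ (tot (e \o (fun=> 0)) : assignment (relmodel (R n (map e l)))) (q0 n)).
rewrite (@witness_elementary _ _ m0 e) //; last first.
  move=> p /subform_in_nth[i <-] l'.
  have := eop (pickle (inr (n, i, size l) : nat + nat * nat * nat)) (l ++ l').
  by rewrite /op pickleK map_cat -(size_map e l) take_size_cat // drop_size_cat.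
exact: fo_sentence_sat.
Qed.

(** * Elementarity of lying between two bounds *)

Section Between.
Variable E : dependency.
Let k := dep_arity E.

(** Nonemptiness is built in because quantifiers lead from a nonempty team to a nonempty team. *)
Definition between (M : domain) (T Q : set ('I_k -> M)) : Prop :=
  exists P : set ('I_k -> M), [/\ dep_mem E P, T `<=` P, P `<=` Q & P !=set0].

(** For y in [T] the only admissible x is y itself, which forces [T] into the relation tested by
    [E]; for any other y every point of [Q] will do. *)
Definition between_fam (M : domain) (T Q : set ('I_k -> M)) (u i : M) (y x : 'I_k -> M) :=
  (T y -> x = y) /\ Q x.

Lemma between_famP (M : domain) (T Q : set ('I_k -> M)) :
  fam_sem (between_fam T Q) <-> between T Q.
Proof.
have [a _] := domain_two M; split.
  move=> [W [WOm W0 Wy WE]]; have [i [y [x Wx]]] := W0 a.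
  exists [set x | exists u i y, W u i y x]; split=> //.
  - move=> z Tz; have [x' Wx'] := Wy _ _ _ _ z Wx.
    by have [/(_ Tz) E' _] := WOm _ _ _ _ Wx'; exists a, i, z; rewrite -{2}E'.
  - by move=> z [u [i' [y' /WOm[]]]].
  - by exists x, a, i, y.
move=> [P [PE TP PQ [x0 Px0]]].
exists (fun _ _ y x => (T y -> x = y) /\ P x); split.
- by move=> u i y x [H /PQ].
- by move=> u; exists a, x0, x0.
- move=> _ _ y x y' _; have [Ty'|nTy'] := pselect (T y').
    by exists y'; split=> //; exact: TP.
  by exists x0.
- suff -> : [set x | exists (u i : M) y, (T y -> x = y) /\ P x] = P by [].
  by apply/seteqP; split=> x; [move=> [_ [_ [y []]]]|move=> Px; exists a, a, x].
Qed.

Lemma between_sub (M : domain) (T T' Q Q' : set ('I_k -> M)) :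
  T' `<=` T -> Q `<=` Q' -> between T Q -> between T' Q'.
Proof.
move=> TT QQ [P [PE TP PQ P0]]; exists P; split=> //.
  exact: subset_trans TP.
exact: subset_trans QQ.
Qed.

Lemma between_iso (M N : domain) (f : M -> N) (g : N -> M)
    (T Q : set ('I_k -> M)) (T' Q' : set ('I_k -> N)) :
  cancel f g -> cancel g f ->
  (forall x, T' x -> T (g \o x)) -> (forall x, Q (g \o x) -> Q' x) ->
  between T Q -> between T' Q'.
Proof.
move=> fg gf TT QQ [P [PE TP PQ [x0 Px0]]]; exists [set f \o a | a in P]; split.
- by apply: dep_iso PE; exists g.
- move=> x /TT/TP Px; exists (g \o x) => //.
  by apply: funext => i; rewrite /= gf.
- move=> _ [x Px <-]; apply: QQ; have -> : g \o (f \o x) = x; last exact: PQ.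
  by apply: funext => i; rewrite /= fg.
- by exists (f \o x0), x0.
Qed.

Hypothesis Es : strongly_fo E.

Section Ultra.
Variables (U : set (set nat)) (hU : free_ultra U) (M : nat -> domain).

Lemma fam_los (Om : forall n, M n -> M n -> ('I_k -> M n) -> ('I_k -> M n) -> Prop) :
  @fam_sem E (udom hU M) (fun u i y x => ae U (fun n => Om n (urep u n) (urep i n)
      (fun j => urep (y j) n) (fun j => urep (x j) n))) <->
  ae U (fun n => @fam_sem E (M n) (Om n)).
Proof.
have [q [q0 qP]] := fam_sem_fo Es; rewrite -qP.
rewrite -[X in relmodel X]/(urel hU (fun n => uncurry_fam (Om n))) los_true //.
by apply: (ae_iff hU); apply: (ae_true hU) => n; exact: qP.
Qed.

Lemma between_los (T Q : forall n, set ('I_k -> M n)) :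
  between (urel hU T) (urel hU Q) <-> ae U (fun n => between (T n) (Q n)).
Proof.
rewrite -between_famP.
have -> : ae U (fun n => between (T n) (Q n)) <->
    ae U (fun n => fam_sem (between_fam (T n) (Q n))).
  by apply: (ae_iff hU); apply: (ae_true hU) => n; rewrite between_famP.
rewrite -fam_los.
set Om := between_fam _ _; set Om' := (X in _ <-> fam_sem X).
suff -> : Om = Om' by [].
do 4 apply: funext => ?; apply: propext; rewrite /Om /Om' /between_fam (ae_andE hU) (ae_imp hU).
suff H (y x : 'I_k -> udom hU M) : x = y <->
    ae U (fun n => (fun j => urep (x j) n) = (fun j => urep (y j) n)) by rewrite H.
split=> [->|H]; first exact: ae_true.
apply: funext => j; rewrite -[LHS]urepK -[RHS]urepK; apply/(ucls_eq hU).
by apply: (ae_mono hU) H => n /(congr1 (@^~ j)).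
Qed.

End Ultra.

Lemma fam_ls (M : domain) (h : nat -> M)
    (Om : nat -> seq M -> M -> M -> ('I_k -> M) -> ('I_k -> M) -> Prop)
    (g : nat -> seq M -> M) : injective h ->
  exists e : nat -> M, [/\ injective e, forall n, exists m, h n = e m,
    forall n l, exists m, g n (map e l) = e m &
    forall n l, @fam_sem E M (Om n (map e l)) <->
      @fam_sem E natD (fun u i y x => Om n (map e l) (e u) (e i) (e \o y) (e \o x))].
Proof.
move=> hi; have [q [q0 qP]] := fam_sem_fo Es.
have [e [ei he ge eP]] := lowenheim_skolem (q := fun=> q)
  (fun n l => uncurry_fam (Om n l)) g hi (fun=> q0).
exists e; split=> // n l; rewrite -qP eP.
exact: (qP natD (fun u i y x => Om n (map e l) (e u) (e i) (e \o y) (e \o x))).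
Qed.

Lemma between_fam_pull (M : domain) (e : nat -> M) (T Q : set ('I_k -> M)) : injective e ->
  @fam_sem E natD (fun u i y x => between_fam T Q (e u) (e i) (e \o y) (e \o x)) <->
  @between natD [set x | T (e \o x)] [set x | Q (e \o x)].
Proof.
move=> ei; rewrite -between_famP.
set Om := (X in fam_sem X <-> _); set Om' := (X in _ <-> fam_sem X).
suff -> : Om = Om' by [].
do 4 apply: funext => ?; apply: propext; rewrite /Om /Om' /between_fam /=.
suff H (y x : 'I_k -> nat) : e \o x = e \o y <-> x = y by rewrite H.
split=> [H|->//]; apply: funext => j; apply: ei.
exact: (congr1 (@^~ j) H).
Qed.

Lemma between_ls (M : domain) (h : nat -> M) (T Q : nat -> seq M -> set ('I_k -> M))
    (g : nat -> seq M -> M) : injective h ->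
  exists e : nat -> M, [/\ injective e, forall n, exists m, h n = e m,
    forall n l, exists m, g n (map e l) = e m &
    forall n l, between (T n (map e l)) (Q n (map e l)) <->
      @between natD [set x | T n (map e l) (e \o x)] [set x | Q n (map e l) (e \o x)]].
Proof.
move=> hi; have [e [ei he ge eP]] := fam_ls (fun n l => between_fam (T n l) (Q n l)) g hi.
exists e; split=> // n l; rewrite -between_famP eP.
exact: between_fam_pull.
Qed.

Lemma between_ls1 (M : domain) (h : nat -> M) (T Q : set ('I_k -> M)) : injective h ->
  exists e : nat -> M, [/\ injective e, forall n, exists m, h n = e m &
    between T Q <-> @between natD [set x | T (e \o x)] [set x | Q (e \o x)]].
Proof.
move=> hi.
have [e [ei he _ eP]] := between_ls (fun _ _ => T) (fun _ _ => Q) (fun _ _ => h 0) hi.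
by exists e; split=> //; exact: (eP 0 [::]).
Qed.

End Between.

(** * Alternating chains *)

Section Cut.
Variables (U : set (set nat)) (hU : free_ultra U) (k : nat).
Let uN := udom hU (fun=> natD).

Definition nonstandard (i : uN) : Prop := forall m, ae U (fun n => m <= urep i n).

Definition cut (Q : nat -> set ('I_k -> nat)) : set ('I_k -> uN) :=
  [set x | exists2 i, nonstandard i &
    ae U (fun n => Q (urep i n) (fun j => urep (x j : uN) n : nat))].

End Cut.

Arguments cut {U} hU {k} Q.

Lemma descending (T : Type) (Q : nat -> set T) :
  (forall i, Q i.+1 `<=` Q i) -> forall i j, i <= j -> Q j `<=` Q i.
Proof.
move=> Qd i j /subnK <-; elim: (j - i) => // n IH; rewrite addSn.
exact: subset_trans (Qd _) IH.
Qed.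

(* A nonempty union of members of a chain of type omega^* is one of them, whereas
   the nonstandard members of the ultrapower of the chain have union [cut Q]. *)
Lemma cut_notin (U : set (set nat)) (hU : free_ultra U) (E : dependency)
    (Q : nat -> set ('I_(dep_arity E) -> nat)) :
  strongly_fo E -> (forall i, Q i.+1 `<=` Q i) -> (forall i, Q i !=set0) ->
  (forall i, ~ @dep_mem E natD (Q i)) -> ~ dep_mem E (cut hU Q).
Proof.
move=> Es Qd Q0 QE CE.
pose Om (u i : natD) (y x : 'I_(dep_arity E) -> natD) := (Q i y -> x = y) /\ Q i x.
have nOm : ~ fam_sem Om.
  move=> [W [WOm W0 Wy WE]].
  have ex : exists i, `[< exists u y x, W u i y x >].
    by have [i [y [x Wx]]] := W0 0; exists i; apply/asboolP; exists 0, y, x.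
  case: (ex_minnP ex) => i0 /asboolP[u0 [y0 [x0 W0x]]] imin.
  (* The rows with index [i0] already cover [Q i0], and minimality of [i0] keeps all other rows
     inside it. *)
  apply: (QE i0); suff <- : [set x | exists u i y, W u i y x] = Q i0 by [].
  apply/seteqP; split=> x.
    move=> [u [i [y Wx]]]; have [_ Qx] := WOm _ _ _ _ Wx.
    by apply: descending Qx => //; apply: imin; apply/asboolP; exists u, y, x.
  move=> Qx; have [x' Wx'] := Wy _ _ _ _ x W0x.
  by have [/(_ Qx) E' _] := WOm _ _ _ _ Wx'; exists u0, i0, x; rewrite -{2}E'.
suff : ae U (fun=> fam_sem Om) by move=> /(ae_ex hU)[].
apply/(fam_los Es hU (fun=> Om)).
have [q Qq] := choice Q0.
exists (fun u i y x => nonstandard i /\ ae U (fun n => Om (urep u n) (urep i n)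
      (fun j => urep (y j) n) (fun j => urep (x j) n))); split.
- by move=> u i y x [].
- move=> u; pose i := @ucls U (fun=> natD) id; exists i.
  have iK : ae U (fun n => urep i n = n) := @uclsK U hU (fun=> natD) id.
  pose x j := @ucls U (fun=> natD) (fun n => q n j); exists x, x; split.
    by move=> m; apply: (ae_mono hU) (ae_and hU iK (ae_ge hU m)) => n [-> ].
  have xq := @urel_eq _ hU (fun=> natD) _ x q (fun=> erefl).
  apply: (ae_mono hU) (ae_and hU iK xq) => n [-> ->].
  by split.
- move=> u i y x y' [ins _].
  pose x' j := @ucls U (fun=> natD) (fun n => if pselect (Q (urep i n) (fun j => urep (y' j) n))
    then urep (y' j) n else q (urep i n) j).
  exists x'; split=> //.
  have xq := @urel_eq _ hU (fun=> natD) _ x' (fun n j => if pselect (Q (urep i n) (fun j => urep (y' j) n))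
    then urep (y' j) n else q (urep i n) j) (fun=> erefl).
  apply: (ae_mono hU) xq => n ->; rewrite /Om.
  by case: pselect => [H|H] /=; split=> //; exact: Qq.
- set C := (X in dep_mem E X); suff -> : C = cut hU Q by [].
  apply/seteqP; split=> x; last first.
    move=> [i ins Qx]; exists i, i, x; split=> //.
    by apply: (ae_mono hU) Qx => n Qx; split.
  move=> [u [i [y [ins OmE]]]]; exists i => //.
  by apply: (ae_mono hU) OmE => n [].
Qed.

(** The even and the odd terms interleave, so they have the same cut. The odd terms avoid [D] and
    the even ones avoid its complement, hence by [cut_notin] this cut would lie in neither. *)
Lemma no_alternating_chain (D : dependency) (P : nat -> set ('I_(dep_arity D) -> nat)) :
  strongly_fo D -> strongly_fo (dep_compl D) ->
  (forall j, P j.+1 `<=` P j) -> (forall j, P j !=set0) ->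
  ~ (forall j, @dep_mem D natD (P j) <-> ~~ odd j).
Proof.
move=> Ds Dcs Pd P0 PD; have [U hU] := free_ultra_exists.
have nD : ~ dep_mem D (cut hU (fun i => P i.*2.+1)).
  apply: cut_notin => // [i|i /PD]; last by rewrite /= odd_double.
  by apply: descending => //; rewrite doubleS; apply: leqW; exact: leqnSn.
have := @cut_notin U hU (dep_compl D) (fun i => P i.*2) Dcs.
case.
- by move=> i; apply: descending => //; rewrite doubleS; apply: leqW; exact: leqnSn.
- by move=> i; exact: P0.
- by move=> i; apply; apply/PD; rewrite odd_double.
rewrite /=; suff -> : cut hU (fun i => P i.*2) = cut hU (fun i => P i.*2.+1) by [].
apply/seteqP; split=> x [i ins Px].
  (* The predecessor of a nonstandard index is nonstandard, and 2(i - 1) + 1 <= 2i. *)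
  have iK := @uclsK U hU (fun=> natD) (fun n => (urep i n).-1).
  exists (@ucls U (fun=> natD) (fun n => (urep i n).-1)).
    move=> m; apply: (ae_mono hU) (ae_and hU iK (ins m.+1)) => n [-> ].
    by case: (urep i n).
  apply: (ae_mono hU) (ae_and hU (ae_and hU iK (ins 1)) Px) => n [[-> i1]].
  apply: descending => //; rewrite -[X in _ <= X.*2](prednK i1) doubleS.
  by rewrite ltnW.
exists i => //; apply: (ae_mono hU) Px => n; exact: Pd.
Qed.

(** * Closure under permutations *)

Section Hat.
Variables (M : Type) (A : nat -> M) (Ai : injective A).

(** The permutations preserving this colouring are those that fix everything except the points [A j]
    with [n <= j]. *)
Definition acol (n : nat) (m : M) : option M :=
  if pselect (exists2 j, n <= j & A j = m) then None else Some m.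

Lemma acolN n j : n <= j -> acol n (A j) = None.
Proof. by rewrite /acol; case: pselect => // H nj; case: H; exists j. Qed.

Lemma acolS n m : ~ (exists2 j, n <= j & A j = m) -> acol n m = Some m.
Proof. by rewrite /acol; case: pselect. Qed.

Lemma acolS_lt n j : j < n -> acol n (A j) = Some (A j).
Proof.
by move=> jn; apply: acolS => -[i ni /Ai E]; move: jn; rewrite -E ltnNge ni.
Qed.

Lemma acol_None n m : acol n m = None -> exists2 j, n <= j & A j = m.
Proof. by rewrite /acol; case: pselect. Qed.

Lemma acol_Some n m m' : acol n m = Some m' -> m = m'.
Proof. by rewrite /acol; case: pselect => // _ []. Qed.

(** The action on [M] of a map of the indices of [A]. *)
Definition hat (f : nat -> nat) (m : M) : M :=
  if pselect (exists j, A j = m) is left h then A (f (sval (cid h))) else m.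

Lemma hatA f j : hat f (A j) = A (f j).
Proof.
rewrite /hat; case: pselect => [h|nh]; last by case: nh; exists j.
by congr (A (f _)); apply: Ai; exact: (svalP (cid h)).
Qed.

Lemma hat_out f m : ~ (exists j, A j = m) -> hat f m = m.
Proof. by rewrite /hat; case: pselect. Qed.

Lemma hat_comp f g m : hat (f \o g) m = hat f (hat g m).
Proof.
have [[j <-]|nm] := pselect (exists j, A j = m); first by rewrite !hatA.
by rewrite !hat_out.
Qed.

Lemma hatK f g : cancel f g -> cancel (hat f) (hat g).
Proof.
move=> fg m; rewrite -hat_comp; have [[j <-]|nm] := pselect (exists j, A j = m).
  by rewrite hatA /= fg.
by rewrite hat_out.
Qed.

Lemma hat_acol n f g m : cancel f g -> (forall j, j < n -> f j = j) ->
  acol n (hat f m) = acol n m.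
Proof.
move=> fg fn; have [[j <-]|nm] := pselect (exists j, A j = m); last by rewrite hat_out.
rewrite hatA; have [jn|nj] := ltnP j n; first by rewrite fn.
rewrite !acolN // leqNgt; apply/negP => fjn.
have /(can_inj fg) E := fn _ fjn; by move: fjn; rewrite E ltnNge nj.
Qed.

Lemma acol_perm n (f g : M -> M) : cancel f g -> cancel g f ->
  (forall m, acol n (f m) = acol n m) ->
  exists t t' : nat -> nat, [/\ cancel t t', cancel t' t,
    forall j, j < n -> t j = j & forall m, f m = hat t m].
Proof.
move=> fg gf fc.
have gc m : acol n (g m) = acol n m by rewrite -fc gf.
have H (h : M -> M) : (forall m, acol n (h m) = acol n m) -> forall j, exists i,
    h (A j) = A i.
  move=> hc j; have [jn|nj] := ltnP j n.
    by exists j; apply: (@acol_Some n); rewrite hc acolS_lt.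
  have /acol_None[i _ <-] : acol n (h (A j)) = None by rewrite hc acolN.
  by exists i.
have [t tP] := choice (H f fc); have [t' t'P] := choice (H g gc).
exists t, t'; split.
- by move=> j; apply: Ai; rewrite -t'P -tP fg.
- by move=> j; apply: Ai; rewrite -tP -t'P gf.
- by move=> j jn; apply: Ai; rewrite -tP; apply: (@acol_Some n); rewrite fc acolS_lt.
move=> m; have [[j <-]|nm] := pselect (exists j, A j = m); first by rewrite hatA.
rewrite hat_out //; apply: (@acol_Some n); rewrite fc acolS // => -[j _ E].
by apply: nm; exists j.
Qed.

End Hat.

(* Baire category in the space of permutations of nat: each [bad N] is an open
   dense set, presented by initial segments of length L. *)
Lemma diagonal_perm (n0 : nat) (bad : nat -> (nat -> nat) -> nat -> Prop) :
  (forall N (s s' : nat -> nat), (forall L, (forall j, j < L -> s j = s' j) ->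
      bad N s L -> bad N s' L)) ->
  (forall N (s s' : nat -> nat) n, cancel s s' -> cancel s' s ->
     (forall j, j < n0 -> s j = j) -> n0 <= n ->
     exists t t' L, [/\ cancel t t', cancel t' t, forall j, j < n -> t j = j &
       bad N (s \o t) L]) ->
  exists s s' : nat -> nat, [/\ cancel s s', cancel s' s, forall j, j < n0 -> s j = j &
    forall N, exists L, bad N s L].
Proof.
move=> bad_ext kill.
pose ok (x : (nat -> nat) * (nat -> nat) * nat) :=
  [/\ cancel x.1.1 x.1.2, cancel x.1.2 x.1.1 & forall j, j < n0 -> x.1.1 j = j].
(* A state consists of a permutation, its inverse and a bound below which the permutation is frozen.
   Stage [N] also freezes the inverse on 0, ..., N, which makes the limit surjective. *)
pose step N (x y : (nat -> nat) * (nat -> nat) * nat) :=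
  [/\ [/\ x.2 <= y.2 & N < y.2], forall j, j < x.2 -> y.1.1 j = x.1.1 j,
      forall j, j <= N -> y.1.2 j = x.1.2 j & exists2 L, L <= y.2 & bad N y.1.1 L].
have stepP (Nx : nat * {x | ok x}) : exists y : {x | ok x}, step Nx.1 (sval Nx.2) (sval y).
  case: Nx => N [[[s s'] b] [/= ss' s's sn]].
  pose n := maxn n0 (maxn b (\max_(j < N.+1) (s' j).+1)).
  have n0n : n0 <= n by rewrite leq_maxl.
  have [t [t' [L [tt' t't tn bL]]]] := kill N s s' n ss' s's sn n0n.
  have okst : ok (s \o t, t' \o s', maxn (maxn b N.+1) L).
    split=> /= [j|j|j jn] /=; first by rewrite ss' tt'.
      by rewrite t't s's.
    by rewrite tn ?sn // (leq_trans jn).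
  exists (exist _ _ okst); split=> /=.
  - by rewrite !leq_max leqnn ltnSn /= orbT.
  - move=> j jb; rewrite tn //; apply: leq_trans jb _.
    by rewrite /n !leq_max leqnn orbT.
  - move=> j jN; have tj : t (s' j) = s' j.
      apply: tn; rewrite /n !leq_max; apply/orP; right; apply/orP; right.
      exact: (leq_bigmax (F := fun j : 'I_N.+1 => (s' j).+1) (@Ordinal N.+1 j jN)).
    by rewrite -{1}tj tt'.
  - by exists L; rewrite ?leq_max ?leqnn ?orbT.
have [next nextP] := choice stepP.
have ok0 : ok (id, id, 0) by [].
pose sq := fix sq N : {x | ok x} := if N is N'.+1 then next (N', sq N') else exist _ _ ok0.
pose x N := sval (sq N).
have xP N : step N (x N) (x N.+1) by exact: (nextP (N, sq N)).
have xok N : ok (x N) by exact: (svalP (sq N)).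
have b_mono N d : (x N).2 <= (x (d + N)).2.
  by elim: d => // d IH; apply: leq_trans IH _; have [[]] := xP (d + N).
have s_stab N d j : j < (x N).2 -> (x (d + N)).1.1 j = (x N).1.1 j.
  move=> jb; elim: d => // d <-; have [_ H _ _] := xP (d + N); apply: H.
  exact: leq_trans jb (b_mono N d).
have s'_stab j d : (x (d + j)).1.2 j = (x j).1.2 j.
  by elim: d => // d <-; have [_ _ H _] := xP (d + j); apply: H; exact: leq_addl.
pose s j := (x j.+1).1.1 j; pose s' j := (x j).1.2 j.
have sE m j : j < m -> (x m).1.1 j = s j.
  move=> jm; rewrite -(subnK jm); apply: s_stab.
  by have [[]] := xP j.
have s'E m j : j <= m -> (x m).1.2 j = s' j by move=> jm; rewrite -(subnK jm) s'_stab.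
exists s, s'; split.
- move=> j; pose m := maxn j.+1 (s j).
  have [c1 _ _] := xok m.
  by rewrite -(@s'E m) ?leq_maxr // -(@sE m) ?leq_maxl // c1.
- move=> j; pose m := maxn j (s' j).+1.
  have [_ c2 _] := xok m.
  by rewrite -(@sE m) ?leq_maxr // -(@s'E m) ?leq_maxl // c2.
- by move=> j jn; have [_ _ H] := xok j.+1; exact: H.
move=> N; have [_ _ _ [L Lb bL]] := xP N; exists L.
apply: bad_ext bL => j jL; have jb : j < (x N.+1).2 := leq_trans jL Lb.
by rewrite -(@sE (j.+1 + N.+1)) ?leq_addr // s_stab.
Qed.

Section PermutationClosure.
Variables (E : dependency) (Es : strongly_fo E) (M : domain).
Let k := dep_arity E.
Variables (code : (nat -> bool) -> M) (A : nat -> M) (n0 : nat) (T Q : set ('I_k -> M)).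
Hypotheses (code_inj : injective code) (Ai : injective A).
Hypothesis Qi : invariant_under (acol A n0) Q.

Local Notation ht := (hat A).

(* [f] lists the values of a partial permutation of the range of [A]. *)
Definition partial_image (f : seq nat) : set ('I_k -> M) :=
  [set x | exists2 y, T y & (forall i m, y i = A m -> m < size f) /\
     x = ht (nth 0 f) \o y].

Definition images (I : set (seq nat)) : set ('I_k -> M) :=
  [set x | exists2 f, I f & partial_image f x].

(** A point names at most one set of partial permutations, and only if the union of the images fits
    below a member of [E] inside [Q]; otherwise the coded set is empty. *)
Definition coded (c : M) : set (seq nat) := [set f | exists eta, [/\ code eta = c,
  between (images [set f | eta (pickle f)]) Q & eta (pickle f)]].

(* A witness would be a union of partial images that lies below a member of [E]
   contained in [Q] but is missing from [coded], which lists all such unions. *)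
Definition fresh_fam (u i : M) (y x : 'I_k -> M) : Prop :=
  exists f, [/\ i = A (pickle f), ~ coded u f, partial_image f y -> x = y & Q x].

(** Diagonal argument: at the code of the set of all partial permutations that a witness uses, it
    must use one outside that set. The relation of the witness itself shows that the union of their
    images fits below [Q], so the code is effective. *)
Lemma fresh_famN : ~ fam_sem fresh_fam.
Proof.
move=> [W [WOm W0 Wy WE]].
pose I : set (seq nat) := [set f | exists u y x, W u (A (pickle f)) y x].
have IQ : between (images I) Q.
  have [a _] := domain_two M; have [i [y [x Wx]]] := W0 a.
  exists [set x | exists u i y, W u i y x]; split=> //.
  - move=> z [f [u [y' [x' Wf]]] fz]; have [z' Wz'] := Wy _ _ _ _ z Wf.
    have [f' [/Ai/(pcan_inj pickleK) ff' _ H _]] := WOm _ _ _ _ Wz'.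
    by exists u, (A (pickle f)), z; rewrite -ff' in H; rewrite -{2}(H fz).
  - by move=> z [u [i' [y' /WOm[f []]]]].
  - by exists x, a, i, y.
pose eta n := `[< exists2 f, pickle f = n & I f >].
have etaI : [set f | eta (pickle f)] = I.
  apply/seteqP; split=> f /=; last by move=> If; apply/asboolP; exists f.
  by move=> /asboolP[g /(pcan_inj pickleK) ->].
have [i [y [x Wx]]] := W0 (code eta).
have [f [iE nf _ _]] := WOm _ _ _ _ Wx; apply: nf; exists eta; split=> //.
  by rewrite etaI.
by apply/asboolP; exists f => //; exists (code eta), y, x; rewrite -iE.
Qed.

Lemma hat_Q (f g : nat -> nat) x : cancel f g -> cancel g f ->
  (forall j, j < n0 -> f j = j) -> Q x -> Q (ht f \o x).
Proof.
move=> fg gf fn; apply: Qi; split=> [i j|i] /=; last by rewrite (hat_acol Ai _ fg).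
by split=> [->//|/(can_inj (hatK Ai fg))].
Qed.

(** A tuple meets the range of [A] in finitely many points, so its image depends on an initial
    segment of the permutation. *)
Lemma hat_image (s t : nat -> nat) y :
  T y -> exists L, partial_image (mkseq (s \o t) L) (ht s \o (ht t \o y)).
Proof.
move=> Ty.
have /choice[a aP] : forall i, exists m, forall m', y i = A m' -> m' < m.
  move=> i; have [[m mE]|nm] := pselect (exists m, y i = A m).
    by exists m.+1 => m'; rewrite mE => /Ai <-.
  by exists 0 => m' E'; case: nm; exists m'.
have La i m : y i = A m -> m < \max_i a i by move=> /aP/leq_trans; apply; exact: leq_bigmax.
exists (\max_i a i), y => //; split; first by rewrite size_mkseq.
apply: funext => i /=; rewrite -hat_comp //.
have [[m mE]|nm] := pselect (exists m, y i = A m).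
  by rewrite mE !hatA //= nth_mkseq //; exact: La mE.
by rewrite !hat_out // => -[m mE]; apply: nm; exists m.
Qed.

Hypothesis none : forall n, n0 <= n -> ~ between (tr (acol A n) (acol A n) T) Q.

(** Otherwise the set coded by [c] would contain all segments of [s \o t] with [t] fixing the points
    below [n]. Pulling the union of the images back by [s], under which [Q] is stable, would
    contradict [none]. *)
Lemma kill_coded (c : M) (s s' : nat -> nat) n :
  cancel s s' -> cancel s' s -> (forall j, j < n0 -> s j = j) -> n0 <= n ->
  exists t t' L, [/\ cancel t t', cancel t' t, forall j, j < n -> t j = j &
    ~ coded c (mkseq (s \o t) L)].
Proof.
move=> ss' s's sn n0n; apply: contrapT => nk.
have all_c t t' L : cancel t t' -> cancel t' t -> (forall j, j < n -> t j = j) ->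
    coded c (mkseq (s \o t) L).
  by move=> tt' t't tn; apply: contrapT => nc; apply: nk; exists t, t', L.
have [eta [etac etaQ _]] := all_c id id 0 (fun=> erefl) (fun=> erefl) (fun _ _ => erefl).
apply: (none n0n).
have s'n j : j < n0 -> s' j = j by move=> /sn E'; rewrite -{1}E' ss'.
apply: (between_iso (f := ht s') (g := ht s)) etaQ.
- exact: hatK.
- exact: hatK.
- move=> x [y Ty yx]; have [f [g [fg gf fc fyx]]] := sim_perm yx.
  have [t [t' [tt' t't tn ft]]] := acol_perm Ai fg gf fc.
  have -> : ht s \o x = ht s \o (ht t \o y).
    by apply: funext => i /=; rewrite -fyx ft.
  have [L fL] := hat_image s t Ty.
  exists (mkseq (s \o t) L) => //=.
  by have [eta' [etac' _]] := all_c t t' L tt' t't tn; have -> : eta = eta' by apply: code_inj; rewrite etac.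
- move=> x Qx; have -> : x = ht s' \o (ht s \o x).
    by apply: funext => i /=; rewrite hatK.
  exact: (hat_Q s's ss').
Qed.

(** The points of a countable elementary submodel code only countably many sets, so a single
    permutation has an initial segment outside each of them. The image under it of a member of [E]
    between [T] and [Q] witnesses [fresh_fam] there, and by elementarity [fresh_fam] has a witness
    in [M]. *)
Lemma permutation_closure_aux : between T Q -> False.
Proof.
move=> TQ.
(* The same submodel must reflect both families: [between_fam] provides the relation [P], and
   [fresh_fam] the contradiction. *)
have [e [ei eA _ eP]] := fam_ls Es
  (fun n (_ : seq M) => if n is 0 then fresh_fam else between_fam T Q) (fun _ _ => A 0) Ai.
have [P [PE TP PQ [p0 Pp0]]] := (between_fam_pull T Q ei).1
  ((eP 1 [::]).1 ((between_famP T Q).2 TQ)).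
apply: fresh_famN; apply/(eP 0 [::]) => /=.
have bad_ext N s s' L : (forall j, j < L -> s j = s' j) ->
    ~ coded (e N) (mkseq s L) -> ~ coded (e N) (mkseq s' L).
  move=> E'; suff -> : mkseq s L = mkseq s' L by [].
  by apply/eq_in_map => j; rewrite mem_iota => /E'.
have [s [s' [ss' s's sn sL]]] := @diagonal_perm n0
  (fun N s L => ~ coded (e N) (mkseq s L)) bad_ext (fun N => @kill_coded (e N)).
(* The submodel contains the whole range of [A], so it is stable under the permutation and its
   inverse. *)
have hatE (t : nat -> nat) m : exists m', ht t (e m) = e m'.
  have [[j <-]|nm] := pselect (exists j, A j = e m); last by exists m; rewrite hat_out.
  by rewrite hatA.
have [r rP] := choice (hatE s); have [r' r'P] := choice (hatE s').
have rr' : cancel r r' by move=> m; apply: ei; rewrite -r'P -rP hatK.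
have r'r : cancel r' r by move=> m; apply: ei; rewrite -rP -r'P hatK.
pose P' : set ('I_k -> nat) := [set r \o a | a in P].
have P'E : @dep_mem E natD P' by apply: dep_iso PE; exists r'.
have P'Q x : P' x -> Q (e \o x).
  move=> [a Pa <-]; have -> : e \o (r \o a) = ht s \o (e \o a).
    by apply: funext => i /=; rewrite rP.
  by apply: (hat_Q ss' s's) => //; exact: PQ.
have P'0 : P' (r \o p0) by exists p0.
have [a aP] := choice eA.
exists (fun u i y x => exists L, [/\ e i = A (pickle (mkseq s L)), ~ coded (e u) (mkseq s L),
  partial_image (mkseq s L) (e \o y) -> x = y & P' x]); split.
- move=> u i y x [L [iE nc H P'x]]; exists (mkseq s L); split=> //; last exact: P'Q.
  by move=> /H ->.
- move=> u; have [L nc] := sL u.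
  by exists (a (pickle (mkseq s L))), (r \o p0), (r \o p0), L; rewrite -aP.
- move=> u i y x y' [L [iE nc _ _]].
  have [[z Tz [zL zE]]|np] := pselect (partial_image (mkseq s L) (e \o y')); last first.
    by exists (r \o p0), L; split=> // /np.
  exists y', L; split=> //; exists (r' \o y'); last by apply: funext => j /=; rewrite r'r.
  apply: TP => /=; suff -> : e \o (r' \o y') = z by [].
  apply: funext => j /=; rewrite -r'P -[e (y' j)]/((e \o y') j) zE /=.
  have [[m mE]|nm] := pselect (exists m, A m = z j); last by rewrite !hat_out // hat_out.
  have mL : m < L by have := zL j m (esym mE); rewrite size_mkseq.
  by rewrite -mE !hatA // nth_mkseq // ss'.
- set C := (X in dep_mem E X); suff -> : C = P' by [].
  apply/seteqP; split=> x; first by move=> [u [i [y [L []]]]].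
  move=> P'x; have [L nc] := sL 0.
  by exists 0, (a (pickle (mkseq s L))), x, L; rewrite -aP.
Qed.

End PermutationClosure.

(* A family of 2^aleph_0 sets can be indexed by M, so an elementary countable
   submodel has a countable list of sets cofinal among the images of T. *)
Lemma permutation_closure (E : dependency) (M : domain) (code : (nat -> bool) -> M)
    (A : nat -> M) (n0 : nat) (T Q : set ('I_(dep_arity E) -> M)) :
  strongly_fo E -> injective code -> injective A ->
  invariant_under (acol A n0) Q -> between T Q ->
  exists2 n, n0 <= n & between (tr (acol A n) (acol A n) T) Q.
Proof.
move=> Es ci Ai Qi TQ; apply: contrapT => nH.
apply: (permutation_closure_aux Es ci Ai Qi _ TQ) => n n0n H.
by apply: nH; exists n.
Qed.

(** * Closure under finite supports *)

Lemma injection_unbounded (F : set nat) (a : nat -> nat) :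
  injective a -> (forall j, F (a j)) -> unbounded F.
Proof.
move=> ai aF n; apply: contrapT => nF; apply: (no_injection (n := n) ai) => m.
by rewrite ltnNge; apply/negP => nm; apply: nF; exists (a m).
Qed.

(** * Ultrapowers and colourings of nat *)

Section UltraPattern.
Variables (U : set (set nat)) (hU : free_ultra U) (M : nat -> domain).
Let uM := udom hU M.

Lemma urep_eq (a b : uM) : a = b <-> ae U (fun n => urep a n = urep b n).
Proof. by rewrite -(ucls_eq hU) !urepK. Qed.

Lemma ae_pattern k (x : 'I_k -> uM) :
  ae U (fun n => forall i j, urep (x i) n = urep (x j) n <-> x i = x j).
Proof.
apply: (ae_fin hU) => i; apply: (ae_fin hU) => j.
have [E|nE] := pselect (x i = x j).
  by apply: (ae_true hU) => n; split=> // _; rewrite E.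
have /(ae_not hU) := fun H => nE ((urep_eq (x i) (x j)).2 H).
by apply: (ae_mono hU) => n H; split=> // E; case: nE.
Qed.

End UltraPattern.

Section Standard.
Variables (U : set (set nat)) (hU : free_ultra U).

Definition unat : domain := udom hU (fun=> natD).

Definition std (j : nat) : unat := @ucls U (fun=> natD) (fun=> j).

Lemma std_rep j : ae U (fun n => urep (std j) n = j).
Proof. exact: (@uclsK U hU (fun=> natD)). Qed.

Lemma std_eq (m : unat) j : m = std j <-> ae U (fun n => urep m n = j).
Proof.
rewrite urep_eq; apply: (ae_iff hU); apply: (ae_mono hU) (std_rep j) => n.
by move=> ->.
Qed.

Lemma std_inj : injective std.
Proof.
move=> i j /std_eq H.
have [n [E1 E2]] := ae_ex hU (ae_and hU (std_rep i) H).
exact: etrans (esym E1) E2.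
Qed.

(** Distinct binary sequences have distinct initial segments from some length on, so the ultrapower
    contains the copy of 2^nat that [permutation_closure] requires. *)
Definition ucode (f : nat -> bool) : unat :=
  @ucls U (fun=> natD) (fun n => pickle (mkseq f n)).

Lemma ucode_inj : injective ucode.
Proof.
move=> f g /(ucls_eq hU) H; apply: funext => i.
have [n [/(pcan_inj pickleK) E ni]] := ae_ex hU (ae_and hU H (ae_ge hU i.+1)).
by have := congr1 (nth false ^~ i) E; rewrite !nth_mkseq.
Qed.

End Standard.

(** Membership in [a] is spelled with [nth] because [M] has no decidable equality; the default [m]
    is harmless, the index being below [size a]. *)
Definition scol (M : Type) (a : seq M) (m : M) : option M :=
  if pselect (exists2 i, i < size a & nth m a i = m) then Some m else None.

Lemma scol_in (M : Type) (a : seq M) m : (exists2 i, i < size a & nth m a i = m) ->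
  scol a m = Some m.
Proof. by rewrite /scol; case: pselect. Qed.

Lemma scol_out (M : Type) (a : seq M) m : ~ (exists2 i, i < size a & nth m a i = m) ->
  scol a m = None.
Proof. by rewrite /scol; case: pselect. Qed.

Lemma scol_eq (M : Type) (a : seq M) m m' :
  ((exists2 i, i < size a & nth m a i = m) -> m = m') ->
  ((exists2 i, i < size a & nth m' a i = m') -> m = m') -> scol a m = scol a m'.
Proof.
rewrite /scol; case: pselect => h; case: pselect => h' // H H'.
- by rewrite /= (H h).
- by case: h'; rewrite -(H h).
- by case: h; rewrite (H' h').
Qed.

Lemma scol_eq_in (M : Type) (a : seq M) m m' :
  scol a m = scol a m' -> (exists2 i, i < size a & nth m a i = m) -> m = m'.
Proof. by rewrite /scol; case: pselect => // h; case: pselect => // h' []. Qed.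

(** The points below [n] keep distinct colours and all the others share the colour [n], so
    invariance means stability under the permutations fixing 0, ..., n - 1. *)
Definition ccol (n m : nat) : nat := minn m n.

Lemma ccol_eq n m m' : ccol n m = ccol n m' -> m < n -> m = m'.
Proof.
rewrite /ccol => + mn; rewrite (minn_idPl (ltnW mn)).
by case: (leqP m' n) => // _ E; move: mn; rewrite E ltnn.
Qed.

Lemma ccol_ge n m : n <= m -> ccol n m = n.
Proof. by move=> nm; exact/minn_idPr. Qed.

Lemma ccol_lt n m : m < n -> ccol n m = m.
Proof. by move=> nm; apply/minn_idPl; exact: ltnW. Qed.

Lemma ccolP n m m' : (m < n -> m = m') -> (m' < n -> m = m') -> ccol n m = ccol n m'.
Proof.
move=> H H'; have [mn|nm] := ltnP m n; first by rewrite H.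
have [mn'|nm'] := ltnP m' n; first by rewrite H'.
by rewrite !ccol_ge.
Qed.

Definition pcol (A : set nat) (m : nat) : option nat :=
  if pselect (A m) then None else Some m.

Lemma pcol_in (A : set nat) m : A m -> pcol A m = None.
Proof. by rewrite /pcol; case: pselect. Qed.

Lemma pcol_out (A : set nat) m : ~ A m -> pcol A m = Some m.
Proof. by rewrite /pcol; case: pselect. Qed.

Section PureSet.
Variables (E : dependency) (Es : strongly_fo E).
Let k := dep_arity E.
Variables (S Q : set ('I_k -> natD)) (n0 : nat).
Hypotheses (Qi : invariant_under (ccol n0) Q) (SQ : between S Q).
Hypothesis none : forall n, ~ @between E natD (tr (ccol n) (ccol n) S) Q.

Variables (U : set (set nat)) (hU : free_ultra U).
Let uS : set ('I_k -> unat hU) := urel hU (fun=> S).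
Let uQ : set ('I_k -> unat hU) := urel hU (fun=> Q).

Lemma uQ_invariant : invariant_under (scol (mkseq (std hU) n0)) uQ.
Proof.
move=> y x [yxE yxC] yQ.
have col : ae U (fun n => forall i, ccol n0 (urep (y i) n) = ccol n0 (urep (x i) n)).
  apply: (ae_fin hU) => i.
  have big (z : 'I_k -> unat hU) : ~ (exists2 j, j < size (mkseq (std hU) n0) &
      nth (z i) (mkseq (std hU) n0) j = z i) -> ae U (fun n => n0 <= urep (z i) n).
    move=> nz; have H : ae U (fun n => forall j : 'I_n0, urep (z i) n <> j).
      apply: (ae_fin hU) => j; apply/(ae_not hU) => /std_eq E'; apply: nz; exists j.
        by rewrite size_mkseq.
      by rewrite nth_mkseq.
    apply: (ae_mono hU) H => n H; rewrite leqNgt; apply/negP => lt.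
    exact: (H (Ordinal lt)).
  have [yin|yout] := pselect (exists2 j, j < size (mkseq (std hU) n0) &
      nth (y i) (mkseq (std hU) n0) j = y i).
    by rewrite (scol_eq_in (yxC i) yin); exact: (ae_true hU).
  have xout : ~ (exists2 j, j < size (mkseq (std hU) n0) &
      nth (x i) (mkseq (std hU) n0) j = x i).
    by move=> xin; have := yxC i; rewrite (scol_in xin) scol_out.
  by apply: (ae_mono hU) (ae_and hU (big _ yout) (big _ xout)) => n [a b]; rewrite !ccol_ge.
apply: (ae_mono hU) (ae_and hU (ae_and hU (ae_pattern y) (ae_pattern x)) (ae_and hU col yQ)).
move=> n [[py px] [cn]]; apply: Qi; split=> // i j.
by rewrite py px.
Qed.

(** At coordinate [n] the list [a] lies below [b n]. The coordinatewise closures of [S] under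
    [ccol (b n)] form a relation inside the closure of [uS], so a success in the ultrapower would
    descend to some coordinate. *)
Lemma none_ultra (a : seq (unat hU)) : ~ between (tr (scol a) (scol a) uS) uQ.
Proof.
move=> H.
pose b n := (foldr (fun (m : unat hU) c => maxn (urep m n) c) 0 a).+1.
suff sub : urel hU (fun n => tr (ccol (b n)) (ccol (b n)) S : set ('I_k -> natD)) `<=` tr (scol a) (scol a) uS.
  have /(between_los Es hU)/(ae_ex hU)[n] := between_sub sub (@subset_refl _ uQ) H.
  exact: none.
move=> x xH.
have /choice[Y YP] : forall n, exists y, tr (ccol (b n)) (ccol (b n)) S (fun i => urep (x i) n) ->
    S y /\ sim (ccol (b n)) (ccol (b n)) y (fun i => urep (x i) n).
  move=> n; have [[y Sy yx]|nx] := pselect (tr (ccol (b n)) (ccol (b n)) S (fun i => urep (x i) n)).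
    by exists y.
  by exists (fun=> 0).
pose y i := @ucls U (fun=> natD) (fun n => Y n i).
have yY := @urel_eq _ hU (fun=> natD) _ y Y (fun=> erefl).
have yP : ae U (fun n => S (fun i => urep (y i) n) /\
    sim (ccol (b n)) (ccol (b n)) (fun i => urep (y i) n) (fun i => urep (x i) n)).
  by apply: (ae_mono hU) (ae_and hU yY xH) => n [-> /YP].
exists y; first by apply: (ae_mono hU) yP => n [].
split=> [i j|i].
  have [n [[py px] [_ [yx _]]]] := ae_ex hU (ae_and hU (ae_and hU (ae_pattern y) (ae_pattern x)) yP).
  by rewrite -py -px; exact: yx.
have small (m : unat hU) : (exists2 i, i < size a & nth m a i = m) ->
    ae U (fun n => urep m n < b n).
  move=> [j ja jm]; apply: (ae_true hU) => n; rewrite ltnS.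
  rewrite -{1}jm; elim: (a) j ja {jm} => [|c l IH] [|j] //= jl; rewrite leq_max ?leqnn //.
  by rewrite IH ?orbT.
apply: scol_eq => /small lt; apply/urep_eq; apply: (ae_mono hU) (ae_and hU lt yP).
  by move=> n [lt' [_ [_ /(_ i) c]]]; exact: ccol_eq c lt'.
by move=> n [lt' [_ [_ /(_ i) c]]]; apply/esym; exact: ccol_eq (esym c) lt'.
Qed.

End PureSet.

Section PureSetExists.
Variables (E : dependency) (Es : strongly_fo E).
Let k := dep_arity E.
Local Notation betN := (@between E natD).

(** The ultrapower has room for [permutation_closure], which makes the lower bound invariant under
    the permutations of a tail of the standard points. A countable elementary submodel brings this
    back to nat, with [A] the places of that tail beyond [n1]. The failure for every n persists
    since [none_ultra] excludes every finite list of points. *)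
Lemma pure_set_exists (S Q : set ('I_k -> natD)) (n0 : nat) :
  invariant_under (ccol n0) Q -> betN S Q ->
  (forall n, ~ betN (tr (ccol n) (ccol n) S) Q) ->
  exists (T1 Q1 : set ('I_k -> natD)) n1 (A : set nat), [/\ unbounded A,
    forall m, A m -> n1 <= m, invariant_under (pcol A) T1,
    invariant_under (ccol n1) Q1 & betN T1 Q1 /\
    forall n, ~ betN (tr (ccol n) (ccol n) T1) Q1].
Proof.
move=> Qi SQ none; have [U hU] := free_ultra_exists.
pose uS : set ('I_k -> unat hU) := urel hU (fun=> S).
pose uQ : set ('I_k -> unat hU) := urel hU (fun=> Q).
have uQi : invariant_under (scol (mkseq (std hU) n0)) uQ  by exact: (uQ_invariant (hU := hU) Qi).
have uSQ : between uS uQ by apply/(between_los Es hU); exact: (ae_true hU).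
have stdi := @std_inj _ hU.
have uQa : invariant_under (acol (std hU) n0) uQ.
  apply: invariant_color uQi => m m' E'.
  have nin j : n0 <= j -> ~ exists2 i, i < size (mkseq (std hU) n0) &
      nth (std hU j) (mkseq (std hU) n0) i = std hU j.
    rewrite size_mkseq => nj [i ij]; rewrite nth_mkseq // => /stdi E2.
    by move: nj; rewrite -E2 leqNgt ij.
  case Ea: (acol (std hU) n0 m) E' => [a|].
    move=> /esym E2; by rewrite (acol_Some Ea) (acol_Some E2).
  move=> /esym Ea'; have [j nj <-] := acol_None Ea'; have [j' nj' <-] := acol_None Ea.
  by rewrite !scol_out //; exact: nin.
have [n n0n S1Q] := permutation_closure Es (@ucode_inj _ hU) stdi uQa uSQ.
pose S1 := tr (acol (std hU) n) (acol (std hU) n) uS.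
(* Closing the submodel under this choice ensures that a tuple of the submodel similar to a tuple of
   [S1] over a finite list is similar to one that lies in the submodel. The operation [g] receives
   the list followed by the tuple, cut at [z], and returns the coordinate [i]. *)
pose pickf (l : seq (unat hU)) (x : 'I_k -> unat hU) : 'I_k -> unat hU :=
  pick_in (fun=> std hU 0) (fun y => S1 y /\ sim (scol l) (scol l) y x).
pose g N (l : seq (unat hU)) : unat hU :=
  if unpickle N : option (nat * nat) is Some (z, i) then
    if insub i is Some i' then
      pickf (take z l) (fun j => nth (std hU 0) (drop z l) (val j)) i'
    else std hU 0
  else std hU 0.
have [e [ei eh ge eP]] := between_ls Es
  (fun n l => if n is 0 then S1 else tr (scol l) (scol l) S1) (fun _ _ => uQ) g stdi.
have [a aP] := choice eh.
have ai : injective a by move=> i j E'; apply: stdi; rewrite !aP E'.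
pose A1 m := exists2 j, n <= j & e m = std hU j.
(* Above the places of the first [n0] standard points, the only ones that [uQ] distinguishes. *)
pose n1 := (\max_(j < n0) a j).+1.
exists [set x | S1 (e \o x)], [set x | uQ (e \o x)], n1, [set m | A1 m /\ n1 <= m].
split; [|by move=> m []| | |split].
- move=> N; have A1u : unbounded A1.
    apply: (@injection_unbounded _ (fun j => a (n + j))); first by move=> i j /ai/addnI.
    by move=> j; exists (n + j); rewrite ?leq_addr // aP.
  by have [m + A1m] := A1u (maxn N n1); rewrite geq_max => /andP[Nm n1m]; exists m.
- move=> y x yx; apply: (@tr_invariant _ _ _ _ (acol (std hU) n)).
  have [yxE yxC] := yx; split=> [i j|i] /=.
    by split=> [/ei/yxE ->//|/ei/yxE ->].
  have := yxC i; set A2 := [set m | _]; move: (y i) (x i) => m m'.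
  have [h|h] := pselect (A2 m); [rewrite (pcol_in h)|rewrite (pcol_out h)];
    have [h'|h'] := pselect (A2 m'); [rewrite (pcol_in h')|rewrite (pcol_out h')|
      rewrite (pcol_in h')|rewrite (pcol_out h')] => // [_|[->//]].
  by have [[j nj ->] _] := h; have [[j' nj' ->] _] := h'; rewrite !acolN.
- move=> y x [yxE yxC]; apply: uQi; split=> [i j|i] /=.
    by split=> [/ei/yxE ->//|/ei/yxE ->].
  have small m : (exists2 i, i < size (mkseq (std hU) n0) &
      nth (e m) (mkseq (std hU) n0) i = e m) -> m < n1.
    rewrite size_mkseq => -[j jn]; rewrite nth_mkseq // aP => /ei <-.
    by rewrite ltnS; exact: (leq_bigmax (F := fun j : 'I_n0 => a j) (Ordinal jn)).
  apply: scol_eq => /small lt; congr e; first exact: ccol_eq (yxC i) lt.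
  by apply/esym; exact: ccol_eq (esym (yxC i)) lt.
- exact: ((eP 0 [::]).1 S1Q).
move=> N H; apply: (none_ultra Es none (a := map e (iota 0 N))).
apply: (@between_sub _ _ (tr (scol (map e (iota 0 N))) (scol (map e (iota 0 N))) S1) _ uQ) => //.
  by apply: tr_mono; exact: sub_tr.
apply/(eP 1 (iota 0 N)); apply: between_sub H => // x /= [y S1y yx].
pose l := map e (iota 0 N); pose ex := e \o x.
have [S1z zx] : S1 (pickf l ex) /\ sim (scol l) (scol l) (pickf l ex) ex.
  exact: (@pick_inP _ (fun=> std hU 0) (fun y => S1 y /\ sim (scol l) (scol l) y ex)
    (ex_intro _ y (conj S1y yx))).
have /choice[z zP] : forall i, exists m, pickf l ex i = e m.
  move=> i; have := ge (pickle (N, val i)) (iota 0 N ++ codom x).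
  rewrite /g pickleK valK map_cat.
  have sz : size (map e (iota 0 N)) = N by rewrite size_map size_iota.
  rewrite (take_size_cat _ sz) (drop_size_cat _ sz) -/l.
  suff -> : (fun j : 'I_k => nth (std hU 0) (map e (codom x)) (val j)) = ex by [].
  apply: funext => j; rewrite (nth_map 0) ?size_codom_ord ?ltn_ord //.
  by rewrite nth_codom_ord.
have zE : pickf l ex = e \o z by apply: funext => i; rewrite zP.
move: S1z zx; rewrite zE => S1z [zxE zxC]; exists z => //; split=> [i j|i].
  by split=> H; apply: ei; [exact: (zxE i j).1 (congr1 e H)|exact: (zxE i j).2 (congr1 e H)].
have inl m : m < N -> exists2 i, i < size l & nth (e m) l i = e m.
  move=> mN; exists m; first by rewrite size_map size_iota.
  by rewrite (nth_map 0) ?size_iota // nth_iota.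
apply: ccolP => /inl h; apply: ei; first exact: scol_eq_in (zxC i) h.
by apply/esym; exact: scol_eq_in (esym (zxC i)) h.
Qed.

End PureSetExists.

Lemma nat_color_bij (K : Type) (c d : nat -> K) :
  (forall q, [\/ unbounded [set m | c m = q] /\ unbounded [set m | d m = q],
     (exists a b, (forall m, c m = q <-> m = a) /\ (forall m, d m = q <-> m = b)) |
     (forall m, c m <> q) /\ (forall m, d m <> q)]) ->
  exists f g : nat -> nat, [/\ cancel f g, cancel g f & forall m, d (f m) = c m].
Proof.
move=> H; apply: color_bij => q; case: (H q) => [[cu du]|[a [b [ca db]]]|[nc nd]].
- have [f [g [fP gP]]] := unbounded_fibers cu du.
  by exists f, g.
- exists (fun=> b), (fun=> a); split=> m.
    by move=> /ca ->; split=> //; exact/db.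
  by move=> /db ->; split=> //; exact/ca.
- by exists id, id; split=> m => [/nc|/nd].
Qed.

Lemma tuple_code k (T : Type) (x : 'I_k -> T) :
  exists r : 'I_k -> nat, forall i j, r i = r j <-> x i = x j.
Proof.
pose r i := find (fun j => `[< x j = x i >]) (enum 'I_k).
have rP i : x (nth i (enum 'I_k) (r i)) = x i.
  apply/asboolP; apply: (nth_find i (a := fun j => `[< x j = x i >])); apply/hasP; exists i.
    by rewrite mem_enum.
  exact: asboolT.
exists r => i j; split=> [E|E]; last by rewrite /r E.
rewrite -rP -[RHS]rP E (set_nth_default j) //.
rewrite /r -has_find; apply/hasP; exists j; first by rewrite mem_enum.
exact: asboolT.
Qed.

Lemma tr_pull k (K M N O : Type) (c : M -> K) (d : N -> K) (e : O -> N)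
    (T : set ('I_k -> M)) (x : 'I_k -> O) : injective e ->
  tr c d T (e \o x) <-> tr c (d \o e) T x.
Proof.
move=> ei; split=> -[y Ty [yE yC]]; exists y => //; split=> // i j; rewrite yE /=.
  by split=> [/ei|->].
by split=> [->|/ei].
Qed.

Lemma between_color_iso (E : dependency) (M N : domain) (K : Type) (c : M -> K) (d : N -> K)
    (f : M -> N) (g : N -> M) (T Q : set ('I_(dep_arity E) -> M)) :
  cancel f g -> cancel g f -> (forall m, d (f m) = c m) -> invariant_under c T ->
  between T Q -> between (tr c d T) (tr c d Q).
Proof.
move=> fg gf dfc Ti; have sg (x : 'I_(dep_arity E) -> N) : sim d c x (g \o x).
  split=> [i j|i] /=; last by rewrite -dfc gf.
  by split=> [->//|/(can_inj gf)].
apply: (between_iso fg gf) => x; last by move=> Qx; exists (g \o x) => //; exact: sim_sym.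
by move=> [y Ty yx]; apply: Ti Ty; exact: sim_trans yx (sg x).
Qed.

(** * Extension of nat by a continuum of points *)

Lemma continuum_two : exists a b : nat + (nat -> bool), a <> b.
Proof. by exists (inl 0), (inl 1) => -[]. Qed.

Definition continuumD : domain := Domain continuum_two.

Section Continuum.
Variables (k : nat) (A : set nat).
Hypothesis Au : unbounded A.
Variables (n1 : nat).
Hypothesis An1 : forall m, A m -> n1 <= m.
Variables (T1 Q1 : set ('I_k -> natD)).
Hypotheses (T1i : invariant_under (pcol A) T1) (Q1i : invariant_under (ccol n1) Q1).

(** The added points share the colour of [A], so colour preserving permutations may exchange the two
    kinds. *)
Definition pcol2 (m : continuumD) : option nat :=
  if m is inl j then pcol A j else None.

(** With [n' = n] the added points are merged with the tail of nat; with [n' = n.+1] they form a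
    second infinite colour class. *)
Definition ccol2 (n n' : nat) (m : continuumD) : nat :=
  if m is inl j then ccol n j else n'.

Lemma pcol_ccol j j' : pcol A j = pcol A j' -> ccol n1 j = ccol n1 j'.
Proof.
have [h|h] := pselect (A j); [rewrite (pcol_in h)|rewrite (pcol_out h)];
  have [h'|h'] := pselect (A j'); [rewrite (pcol_in h')|rewrite (pcol_out h')|
    rewrite (pcol_in h')|rewrite (pcol_out h')] => // [_|[->//]].
by rewrite !ccol_ge //; exact: An1.
Qed.

Lemma pcol2_ccol2 j m : pcol A j = pcol2 m -> ccol n1 j = ccol2 n1 n1 m.
Proof.
case: m => [j'|b] /=; first exact: pcol_ccol.
have [/An1/ccol_ge->//|h] := pselect (A j).
by rewrite pcol_out.
Qed.

(** The coordinates coloured [None] are sent into the infinite set [A], equal ones to equal points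
    and distinct ones to distinct points; the other coordinates already lie in nat. *)
Lemma pcol2_push (x : 'I_k -> continuumD) : exists y, sim (pcol A) pcol2 y x.
Proof.
have [a [ai aA _ _]] := unbounded_enum Au; have [r rP] := tuple_code x.
pose y i := if pcol2 (x i) is Some q then q else a (r i).
have out m q : pcol2 m = Some q -> m = inl q /\ ~ A q.
  case: m => //= j; have [h|h] := pselect (A j); first by rewrite pcol_in.
  by rewrite pcol_out // => -[<-].
exists y; split=> [i j|i]; rewrite /y.
  case Ei: (pcol2 (x i)) => [q|]; case Ej: (pcol2 (x j)) => [q'|].
  - have [-> _] := out _ _ Ei; have [-> _] := out _ _ Ej.
    by split=> [->|[]].
  - split=> [qE|E]; last by move: Ej; rewrite -E Ei.
    by have [_ []] := out _ _ Ei; rewrite qE.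
  - split=> [qE|E]; last by move: Ej; rewrite -E Ei.
    by have [_ []] := out _ _ Ej; rewrite -qE.
  - by rewrite -rP; split=> [/ai|->].
case Ei: (pcol2 (x i)) => [q|]; last by rewrite pcol_in.
by have [_ nA] := out _ _ Ei; rewrite pcol_out.
Qed.

Local Notation T2 := (tr (pcol A) pcol2 T1).
Local Notation Q2 := (tr (pcol A) pcol2 Q1).

Lemma continuum_invariant : invariant_under (acol (inl : nat -> continuumD) n1) Q2.
Proof.
apply: (@invariant_color _ _ _ _ _ (ccol2 n1 n1)) => [m m'|].
  case Em: (acol inl n1 m) => [a|] /esym Em'.
    by rewrite (acol_Some Em) (acol_Some Em').
  have [j nj <-] := acol_None Em; have [j' nj' <-] := acol_None Em'.
  by rewrite /= !ccol_ge.
move=> x x' xx' [y Qy yx]; have [y' yx'] := pcol2_push x'.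
exists y' => //; apply: Q1i Qy.
have s1 := sim_color pcol2_ccol2 yx; have s2 := sim_color pcol2_ccol2 yx'.
exact: sim_trans (sim_trans s1 xx') (sim_sym s2).
Qed.

(** [T2] is already invariant under the permutations of the added points. So these can be fixed:
    [y'] takes the added points of [x] and keeps the remaining coordinates of [y]. *)
Lemma continuum_tr_sub n :
  tr (ccol2 n n.+1) (ccol2 n n.+1) T2 `<=`
  tr (acol (inl : nat -> continuumD) n) (acol inl n) T2.
Proof.
move=> x [y T2y [yxE yxC]].
have ccol_le m : ccol n m <> n.+1.
  by rewrite /ccol => E; have := geq_minr m n; rewrite E ltnn.
pose y' i : continuumD := if x i is inr b then inr b else y i.
have inrE i b : x i = inr b -> exists b', y i = inr b'.
  move=> E; have := yxC i; rewrite E; case: (y i) => [j /ccol_le//|b' _].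
  by exists b'.
have inlE i j : x i = inl j -> exists2 j', y i = inl j' & ccol n j' = ccol n j.
  move=> E; have := yxC i; rewrite E; case: (y i) => [j' |b' /esym/ccol_le//].
  by exists j'.
have y'E i j : y' i = y' j <-> y i = y j.
  rewrite /y'; case Ei: (x i) => [a|b]; case Ej: (x j) => [a'|b'] //.
  - have [q qE _] := inlE _ _ Ei; have [q' qE'] := inrE _ _ Ej.
    by rewrite qE qE'.
  - have [q qE _] := inlE _ _ Ej; have [q' qE'] := inrE _ _ Ei.
    by rewrite qE qE'.
  - by rewrite yxE Ei Ej.
exists y'.
  apply: (@tr_invariant _ _ _ _ (pcol A) pcol2 T1 y) T2y; split=> [i j|i]; first by rewrite y'E.
  by rewrite /y'; case Ei: (x i) => [a|b] //; have [b' ->] := inrE _ _ Ei.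
split=> [i j|i]; first by rewrite y'E.
rewrite /y'; case Ei: (x i) => [a|b] //.
have [j' -> cE] := inlE _ _ Ei; have [an|na] := ltnP a n.
  by rewrite (ccol_eq (esym cE) an).
rewrite [in RHS]acolN // acolN //; move: cE; rewrite (ccol_ge na) => E.
by rewrite -E geq_minl.
Qed.

End Continuum.

Section ContinuumBetween.
Variables (E : dependency) (Es : strongly_fo E).
Local Notation k := (dep_arity E).

(** A countable elementary submodel containing nat is isomorphic to nat as a coloured set: each
    point outside [A] is alone in its colour, and the remaining class is infinite on both sides. *)
Lemma continuum_between (A : set nat) (T1 Q1 : set ('I_k -> natD)) :
  unbounded A -> invariant_under (pcol A) T1 -> between T1 Q1 ->
  between (tr (pcol A) (pcol2 A) T1) (tr (pcol A) (pcol2 A) Q1).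
Proof.
move=> Au T1i T1Q1.
have inli : injective (inl : nat -> continuumD) by move=> i j [].
have [e [ei eh ->]] := between_ls1 Es (tr (pcol A) (pcol2 A) T1) (tr (pcol A) (pcol2 A) Q1) inli.
have [a aP] := choice eh.
have ai : injective a by move=> i j ij; apply: inli; rewrite !aP ij.
have [f [g [fg gf fc]]] : exists f g : nat -> nat, [/\ cancel f g, cancel g f &
    forall m, (pcol2 A \o e) (f m) = pcol A m].
  apply: nat_color_bij => -[q|].
    have [Aq|nAq] := pselect (A q).
      constructor 3; split=> m /=; last case: (e m) => //= j.
        by have [h|h] := pselect (A m); [rewrite pcol_in|rewrite pcol_out // => -[mq]; apply: h; rewrite mq].
      by have [h|h] := pselect (A j); [rewrite pcol_in|rewrite pcol_out // => -[mq]; apply: h; rewrite mq].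
    have pE j : pcol A j = Some q <-> j = q.
      split=> [|->]; last exact: pcol_out.
      by have [h|h] := pselect (A j); [rewrite pcol_in|rewrite pcol_out // => -[]].
    constructor 2; exists q, (a q); split=> m; first exact: pE.
    split=> [|->] /=; last by rewrite -aP /=; exact/pE.
    case Em: (e m) => [j|//] /= /pE jq; apply: ei.
    by rewrite Em -aP jq.
  constructor 1; split=> N; first by have [m Nm Am] := Au N; exists m => //=; rewrite pcol_in.
  have [b [bi bA _ _]] := unbounded_enum Au.
  apply: (@injection_unbounded _ (a \o b)); first exact: inj_comp.
  by move=> j /=; rewrite -aP /= pcol_in.
have := between_color_iso (M := natD) (N := natD) (d := pcol2 A \o e) fg gf fc T1i T1Q1.
by apply: between_sub => x; rewrite /= tr_pull.
Qed.

End ContinuumBetween.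

Section SplitColor.
Variables (n : nat) (a : nat -> nat).
Hypotheses (ai : injective a) (na : forall i, n <= a i).

(* The first [N] points [a i.*2] get the colour of the part [inr] of [continuumD];
   along an ultrapower, they become infinitely many. *)
Definition split_col (N m : nat) : nat :=
  if m < n then m else if [exists i : 'I_N, m == a i.*2] then n.+1 else n.

Lemma split_col_lt N m : m < n -> split_col N m = m.
Proof. by rewrite /split_col => ->. Qed.

Lemma split_col_in N i : i < N -> split_col N (a i.*2) = n.+1.
Proof.
move=> iN; rewrite /split_col ltnNge na /=; case: existsP => // -[].
by exists (Ordinal iN).
Qed.

Lemma split_col_out N m : n <= m -> (forall i, i < N -> m <> a i.*2) -> split_col N m = n.
Proof.
move=> nm H; rewrite /split_col ltnNge nm /=; case: existsP => // -[i /eqP E].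
by case: (H i).
Qed.

Lemma split_colP N m : [\/ m < n /\ split_col N m = m,
  (exists2 i, i < N & m = a i.*2) /\ split_col N m = n.+1 |
  [/\ n <= m, forall i, i < N -> m <> a i.*2 & split_col N m = n]].
Proof.
have [mn|nm] := ltnP m n; first by constructor 1; rewrite split_col_lt.
have [[i iN mE]|H] := pselect (exists2 i, i < N & m = a i.*2).
  by constructor 2; split; [exists i|rewrite mE split_col_in].
have H' i : i < N -> m <> a i.*2 by move=> iN mE; apply: H; exists i.
by constructor 3; split=> //; rewrite split_col_out.
Qed.

Lemma split_col_le N m : split_col N m < n.+2.
Proof.
case: (split_colP N m) => [[mn ->]|[_ ->]|[_ _ ->]] //.
by apply: leq_trans mn _; rewrite -addn2 leq_addr.
Qed.

Lemma split_col_ccol n1 N m : n1 <= n -> ccol n1 m = ccol n1 (split_col N m).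
Proof.
move=> n1n; case: (split_colP N m) => [[mn ->]//|[[i _ ->] ->]|[nm _ ->]].
  by rewrite !ccol_ge // ?(leq_trans n1n) // (leq_trans n1n (na _)).
by rewrite !ccol_ge // (leq_trans n1n).
Qed.

(** Beyond [n] and finitely many exceptional points everything has colour [n], so invariance under
    [split_col N] implies invariance under some [ccol b]. *)
Lemma ccol_split_col N : exists b, forall m m', ccol b m = ccol b m' ->
  split_col N m = split_col N m'.
Proof.
pose b := maxn n (\max_(i < N) a i.*2).+1; exists b.
have big m : b <= m -> split_col N m = n.
  rewrite geq_max => /andP[nm bm]; apply: split_col_out => // i iN mE.
  move: bm; rewrite mE ltnNge => /negP; apply.
  exact: (leq_bigmax (F := fun i : 'I_N => a i.*2) (Ordinal iN)).
move=> m m' E; have [mb|bm] := ltnP m b; first by rewrite (ccol_eq E mb).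
have [mb'|bm'] := ltnP m' b; first by rewrite (ccol_eq (esym E) mb').
by rewrite !big.
Qed.

End SplitColor.

Section FiniteSupport.
Variables (E : dependency) (Es : strongly_fo E).
Local Notation k := (dep_arity E).
Local Notation betN := (@between E natD).

(* If no [n] worked, [pure_set_exists] would give a counterexample whose lower
   bound does not distinguish the points of an infinite set [A]. Extend [nat] by a
   continuum of points that look like those of [A]: [permutation_closure] makes
   the lower bound invariant under the permutations of a tail of [nat] fixing the
   added points, so that only two infinite colours remain. The colourings
   [split_col N] imitate this situation on [nat], where it is impossible. *)
Lemma finite_support_closure (S Q : set ('I_k -> natD)) (n0 : nat) :
  invariant_under (ccol n0) Q -> betN S Q ->
  exists n, betN (tr (ccol n) (ccol n) S) Q.
Proof.
move=> Qi SQ; apply: contrapT => none.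
have [|T1 [Q1 [n1 [A [Au An1 T1i Q1i [T1Q1 none1]]]]]] := pure_set_exists Es Qi SQ.
  by move=> n H; apply: none; exists n.
have inli : injective (inl : nat -> continuumD) by move=> i j [].
have inri : injective (inr : (nat -> bool) -> continuumD) by move=> i j [].
have [n n1n VQ2'] := permutation_closure Es inri inli (continuum_invariant Au An1 Q1i)
  (continuum_between Es Au T1i T1Q1).
pose T2 := tr (pcol A) (pcol2 A) T1; pose Q2 := tr (pcol A) (pcol2 A) Q1.
pose c3 := ccol2 n n.+1; pose V := tr c3 c3 T2.
have VQ2 : between V Q2.
  apply: (between_sub _ _ VQ2'); first exact: continuum_tr_sub.
  by [].
have {VQ2'} codei : injective (fun j i : nat => i == j).
  by move=> i j ij; apply/eqP; have := congr1 (@^~ i) ij; rewrite /= eqxx => <-.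
(* This puts all of nat and infinitely many added points into the submodel, so that both colours [n]
   and [n.+1] stay infinite there. *)
pose h j : continuumD := if odd j then inr (fun i => i == j./2) else inl j./2.
have hi : injective h.
  move=> i j; rewrite /h; case Ei: (odd i); case Ej: (odd j) => // -[].
    by move=> /codei E'; rewrite -(odd_double_half i) -(odd_double_half j) Ei Ej E'.
  by move=> E'; rewrite -(odd_double_half i) -(odd_double_half j) Ei Ej E'.
have [e3 [e3i e3h e3P]] := between_ls1 Es V Q2 hi.
have {}e3P := e3P.1 VQ2.
have [al [ali alA aln _]] : exists e : nat -> nat, [/\ injective e,
    forall i, (A (e i) /\ n <= e i), forall n, n <= e n &
    forall m, (A m /\ n <= m) -> exists n, e n = m].
  apply: (@unbounded_enum [set m | A m /\ n <= m]) => N.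
  by have [m + Am] := Au (maxn N n); rewrite geq_max => /andP[? ?]; exists m.
have nal i : n <= al i by have [] := alA i.
pose dN := split_col n al.
pose VN N : set ('I_k -> natD) := tr c3 (dN N) T2.
(* [VN N] is invariant under some [ccol b], and it contains [T1]: the points [al i.*2] with [i < N]
   lie in [A], so they may be replaced by added points. A success would thus contradict [none1]. *)
have noneN N : ~ betN (VN N) Q1.
  have [b bP] := ccol_split_col n al N; move=> H; apply: (none1 b).
  apply: between_sub H => //; apply: tr_sub.
    by apply: invariant_color bP _; exact: tr_invariant.
  move=> x T1x.
  pose code m : continuumD := if pselect (exists2 i, i < N & m = al i.*2) is left _
    then inr (fun i => i == m) else inl m.
  have codei' : injective code.
    move=> m m'; rewrite /code; case: pselect => _; case: pselect => _ // [] //.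
    exact: codei.
  exists (code \o x).
    exists x => //; split=> [i j|i] /=; first by split=> [->//|/codei'].
    rewrite /code; case: pselect => // -[j jN ->] /=.
    by have [Aj _] := alA j.*2; rewrite pcol_in.
  split=> [i j|i] /=; first by split=> [/codei'|->].
  rewrite /c3 /dN; move: (x i) => m; rewrite /code.
  case: (split_colP nal N m) => [[mn ->]|[mE ->]|[nm H' ->]]; case: pselect => //=.
  - by move=> [j _ mE]; move: mn; rewrite mE ltnNge nal.
  - by move=> _; rewrite ccol_lt.
  - by move=> [j jN /(H' _ jN)].
  - by move=> _; rewrite ccol_ge.
have [U hU] := free_ultra_exists.
pose VU : set ('I_k -> unat hU) := urel hU VN.
pose QU : set ('I_k -> unat hU) := urel hU (fun=> Q1).
have noneU : ~ between VU QU.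
  by move=> /(between_los Es hU)/(ae_ex hU)[N /noneN].
have [e4 [e4i e4h e4P]] := between_ls1 Es VU QU (@std_inj _ hU).
apply: noneU; apply/e4P => {e4P}.
(* Only [n.+2] colours occur, so each point of the ultrapower has a limit colour [ds] along the
   ultrafilter. *)
have /choice[ds dsP] : forall m : unat hU, exists q, q < n.+2 /\ ae U (fun N => dN N (urep m N) = q).
  move=> m; have [q ? ?] := ae_color hU (f := fun N => dN N (urep m N)) (fun N => split_col_le nal N (urep m N)).
  by exists q.
have ds_eq (m : unat hU) q : ae U (fun N => dN N (urep m N) = q) -> ds m = q.
  move=> H; have [_ H'] := dsP m.
  by have [N [E1 E2]] := ae_ex hU (ae_and hU H H'); rewrite -E1 -E2.
have ds_std j q : ae U (fun N => dN N j = q) -> ds (std hU j) = q.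
  move=> H; apply: ds_eq; apply: (ae_mono hU) (ae_and hU H (std_rep hU j)).
  by move=> N [<- ->].
have [a3 a3P] := choice e3h.
have a3i : injective a3 by move=> i j ij; apply: hi; rewrite !a3P ij.
have [a4 a4P] := choice e4h.
have a4i : injective a4 by move=> i j ij; apply: (@std_inj _ hU); rewrite !a4P ij.
have h2 j : h j.*2 = inl j by rewrite /h odd_double doubleK.
have h2S j : h j.*2.+1 = inr (fun i => i == j).
  by rewrite /h /= odd_double /= uphalf_double.
(* Both countable submodels have one point of each colour below [n] and infinitely many of the
   colours [n] and [n.+1], hence are isomorphic as coloured sets. *)
have [f [g [fg gf fc]]] : exists f g : nat -> nat, [/\ cancel f g, cancel g f &
    forall m, (ds \o e4) (f m) = (c3 \o e3) m].
  apply: nat_color_bij => q; have [qn|nq] := ltnP q n.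
    constructor 2; exists (a3 q.*2), (a4 q); split=> m.
      split=> [/=|->]; last by rewrite /= -a3P h2 /= ccol_lt.
      case Em: (e3 m) => [j|b] /= H; last by move: qn; rewrite -H ltnNge leqnSn.
      apply: e3i; rewrite Em -a3P h2; congr inl.
      by apply/esym; apply: (ccol_eq _ qn); rewrite ccol_lt.
    split=> [/= H|->]; last first.
      by rewrite /= -a4P; apply: ds_std; apply: (ae_true hU) => N; exact: split_col_lt.
    apply: e4i; rewrite -a4P; apply/std_eq; have [_] := dsP (e4 m); rewrite H.
    apply: (ae_mono hU) => N; rewrite /dN.
    case: (split_colP nal N (urep (e4 m) N)) => [[_ ->]//|[_ ->]|[_ _ ->]] H'.
      by move: qn; rewrite -H' ltnNge leqnSn.
    by move: qn; rewrite -H' ltnn.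
  have [qn|nqn] := eqVneq q n.
    rewrite qn; constructor 1; split.
      apply: (@injection_unbounded _ (fun j => a3 (n + j).*2)).
        by move=> i j /a3i/double_inj/addnI.
      by move=> j /=; rewrite -a3P h2 /= ccol_ge // leq_addr.
    (* The points [al] at odd arguments are never recoloured, which keeps the colour [n]
       infinite. *)
    apply: (@injection_unbounded _ (fun j => a4 (al j.*2.+1))).
      by move=> i j /a4i/ali[]/double_inj.
    move=> j /=; rewrite -a4P; apply: ds_std; apply: (ae_true hU) => N.
    apply: split_col_out => // i _ /ali /(congr1 odd).
    by rewrite /= !odd_double.
  have [qn|nqn'] := eqVneq q n.+1.
    rewrite qn; constructor 1; split.
      apply: (@injection_unbounded _ (fun j => a3 j.*2.+1)); first by move=> i j /a3i[]/double_inj.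
      by move=> j /=; rewrite -a3P h2S.
    apply: (@injection_unbounded _ (fun j => a4 (al j.*2))).
      by move=> i j /a4i/ali/double_inj.
    move=> j /=; rewrite -a4P; apply: ds_std; apply: (ae_mono hU) (ae_ge hU j.+1) => N.
    exact: split_col_in.
  have {}nq : n.+1 < q by rewrite ltn_neqAle eq_sym nqn' ltn_neqAle eq_sym nqn.
  constructor 3; split=> m /=.
    case: (e3 m) => [j|b] /= H; last by move: nq; rewrite -H ltnn.
    have := geq_minr j n; rewrite -/(ccol n j) H => H'.
    by move: (ltn_trans nq (leq_ltn_trans H' (ltnSn n))); rewrite ltnn.
  by move=> H; have [] := dsP (e4 m); rewrite H ltnS leqNgt nq.
have sg (x : 'I_k -> nat) : sim (ds \o e4) (c3 \o e3) x (g \o x).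
  split=> [i j|i] /=; last by rewrite -[c3 _]fc /= gf.
  by split=> [->//|/(can_inj gf)].
have sg' (x : 'I_k -> nat) : sim ds c3 (e4 \o x) (e3 \o (g \o x)).
  apply: sim_trans (sim_sym (sim_inj _ _ e4i)) _.
  by apply: sim_trans (sg x) _; exact: sim_inj.
have aeC (x : 'I_k -> unat hU) : ae U (fun N => sim (dN N) ds (fun i => urep (x i) N) x).
  have H : ae U (fun N => forall i, dN N (urep (x i) N) = ds (x i)).
    by apply: (ae_fin hU) => i; have [] := dsP (x i).
  by apply: (ae_mono hU) (ae_and hU (ae_pattern x) H) => N [].
apply: (between_iso (M := natD) (N := natD) fg gf _ _ e3P) => x /=.
  (* At some coordinate [N] the equalities and colours of the tuple agree with their limits, and the
     tuple belongs to [VN N]. *)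
  move=> VUx; have [N [[y T2y yx] xx]] := ae_ex hU (ae_and hU VUx (aeC (e4 \o x))).
  exists y => //; exact: sim_trans (sim_trans yx xx) (sg' x).
move=> [y Q1y yx]; apply: (ae_mono hU) (aeC (e4 \o x)) => N xx; apply: Q1i Q1y.
have s1 := sim_color (pcol2_ccol2 An1) yx.
have s2 := sim_sym (sim_trans xx (sg' x)).
apply: sim_trans s1 _; apply: (sim_color _ s2) => m m'.
rewrite (split_col_ccol nal N m' n1n) -/(dN N m') => <-.
case: m => [j|b] /=; last by rewrite ccol_ge // (leq_trans n1n).
by rewrite /ccol -minnA (minn_idPr n1n).
Qed.

End FiniteSupport.

(** * Basic sentences *)

Section Patterns.
Variable I : finType.

Definition pattern (M : Type) (z : I -> M) : {ffun I * I -> bool} :=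
  [ffun p => `[< z p.1 = z p.2 >]].

Lemma pattern_eq (M N : Type) (z : I -> M) (w : I -> N) :
  pattern z = pattern w <-> forall i j, z i = z j <-> w i = w j.
Proof.
split=> [E i j|E].
  have := congr1 (fun f : {ffun I * I -> bool} => f (i, j)) E; rewrite !ffunE /= => H.
  by split=> [zij|wij]; apply/asboolP; [rewrite -H|rewrite H]; exact/asboolP.
by apply/ffunP => -[i j]; rewrite !ffunE /=; apply/asboolP/asboolP => /E.
Qed.

Definition patterns_fo (v : I -> nat) (P : {set {ffun I * I -> bool}}) : fo sig0 :=
  \big[@FOr _/fo_bot _]_(q in P) \big[@FAnd _/fo_top _]_(p : I * I)
    FLit (LEq (q p) (Var (v p.1)) (Var (v p.2))).

Lemma patterns_fo_fv v P : fo_fv (patterns_fo v P) `<=` range v.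
Proof.
rewrite /patterns_fo; elim/big_rec: _ => [|q p _ IH] w.
  by rewrite fo_neg_fv fo_top_sentence.
move=> /= [|/IH//]; elim/big_rec: _ => [|i r _ IHr] /=; first by move=> [[->|->]].
by move=> [[->|->]|/IHr//]; [exists i.1|exists i.2].
Qed.

Lemma patterns_fo_sat v P (M : domain) (s : assignment M) (z : I -> M) :
  (forall i, s (v i) = Some (z i)) ->
  fo_sat (M := bare M) s (patterns_fo v P) <-> pattern z \in P.
Proof.
move=> sz; rewrite /patterns_fo fo_bigor_satP.
have E (q : {ffun I * I -> bool}) : fo_sat (M := bare M) s (\big[@FAnd _/fo_top _]_(p : I * I)
    FLit (LEq (q p) (Var (v p.1)) (Var (v p.2)))) <-> pattern z = q.
  rewrite fo_bigand_satP; split=> [H|<- [i j] _].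
    apply/ffunP => p; have [m [n []]] := H p isT.
    rewrite /= !sz => -[<-] [<-]; rewrite ffunE; case: (q p) => ?; first exact/asboolP.
    exact/asboolPn.
  exists (z i), (z j); split=> //=; rewrite ffunE /=.
  by case: asboolP.
split=> [[q qP /E ->]//|zP]; exists (pattern z) => //.
exact/E.
Qed.

End Patterns.

Definition sumf (k n : nat) (M : Type) (a : 'I_k -> M) (b : 'I_n -> M) (p : 'I_k + 'I_n) : M :=
  match p with inl i => a i | inr j => b j end.

Definition distinct_fo (n : nat) : fo sig0 :=
  foldr (@FEx _) (patterns_fo (fun i : 'I_n => val i) [set pattern (fun i : 'I_n => i)]%SET)
    (iota 0 n).

Lemma distinct_fo_sentence n : fo_sentence (distinct_fo n).
Proof.
rewrite /fo_sentence fo_exs_fv; apply/seteqP; split=> // v [/patterns_fo_fv[i _ <-]] /=.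
by rewrite mem_iota add0n ltn_ord.
Qed.

Lemma distinct_fo_true n (M : domain) :
  fo_true (bare M) (distinct_fo n) <-> exists b : 'I_n -> M, injective b.
Proof.
have [m0 _] := domain_two M; rewrite /fo_true fo_sat_exs.
have E ms (z : 'I_n -> M) : size ms = n -> (forall i : 'I_n, nth m0 ms i = z i) ->
    fo_sat (M := bare M) (updl (@empty_assignment _) (iota 0 n) ms)
      (patterns_fo (fun i : 'I_n => val i) [set pattern (fun i : 'I_n => i)]%SET) <-> injective z.
  move=> sz mz; rewrite (patterns_fo_sat _ (z := z)) => [|i].
    rewrite inE; split=> [/eqP/pattern_eq H i j /H//|zi].
    by apply/eqP/pattern_eq => i j; split=> [/zi|->].
  have {1}-> : val i = nth 0 (iota 0 n) i by rewrite nth_iota ?ltn_ord.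
  by rewrite (updl_nth m0) ?iota_uniq ?size_iota ?ltn_ord // mz.
split=> [[ms]|[b bi]].
  by rewrite size_iota => sz /(E ms (fun i => nth m0 ms i) sz (fun=> erefl)); eexists; eassumption.
exists (codom b); first by rewrite size_codom_ord size_iota.
by apply/(E _ b) => //; [rewrite size_codom_ord|move=> i; rewrite nth_codom_ord].
Qed.

Section Basic.
Variable k : nat.

Definition patset (n : nat) := {set {ffun ('I_k + 'I_n) * ('I_k + 'I_n) -> bool}}.

Lemma covers_uniq n : uniq (codom (fun i : 'I_k => val i) ++ iota k n).
Proof.
have -> : codom (fun i : 'I_k => val i) = iota 0 k by rewrite codomE; exact: val_enum_ord.
by rewrite -iotaD iota_uniq.
Qed.

Definition covers_var n (p : 'I_k + 'I_n) : nat :=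
  match p with inl i => i | inr j => k + j end.

Lemma covers_fv n (P : patset n) : fo_fv (patterns_fo (@covers_var n) P) `<=`
  [set v | v \in codom (fun i : 'I_k => val i) ++ iota k n].
Proof.
move=> v /patterns_fo_fv[[i|j] _ <-] /=; rewrite mem_cat; apply/orP.
  by left; rewrite (codom_f (fun i : 'I_k => val i)).
by right; rewrite mem_iota leq_addr ltn_add2l ltn_ord.
Qed.

Definition covers_mx n (P : patset n) : qmatrix (fun i : 'I_k => val i) :=
  QMatrix (covers_uniq n) (covers_fv (P := P)).

Definition covers n (P : patset n) (M : domain) (R : set ('I_k -> M)) : Prop :=
  exists b : 'I_n -> M, forall a, R a -> pattern (sumf a b) \in P.

Lemma covers_mxP n (P : patset n) (M : domain) (R : set ('I_k -> M)) :
  mx_sem (covers_mx P) R <-> covers P R.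
Proof.
have [m0 _] := domain_two M.
have E ys (b : 'I_n -> M) a : size ys = n -> (forall i : 'I_n, nth m0 ys i = b i) ->
    fo_sat (M := bare M) (mx_env (covers_mx P) ys a) (mx_fo (covers_mx P)) <->
    pattern (sumf a b) \in P.
  move=> sz yb; apply: patterns_fo_sat => -[i|j] /=.
    by apply: updl_codom => //; exact: val_inj.
  rewrite /mx_env updl_notin; last first.
    by apply/negP => /codomP[i E]; have := ltn_ord i; rewrite -[X in X < _]E ltnNge leq_addr.
  have {1}-> : k + j = nth 0 (iota k n) j by rewrite nth_iota ?ltn_ord.
  by rewrite (updl_nth m0) ?iota_uniq ?size_iota ?ltn_ord // yb.
split=> [[ys]|[b bP]].
  rewrite size_iota => sz H; exists (fun i => nth m0 ys i) => a Ra.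
  exact/(E ys _ a sz (fun=> erefl))/H.
exists (codom b); first by rewrite size_codom_ord size_iota.
by move=> a Ra; apply/(E _ b) => [||]; [rewrite size_codom_ord|move=> i; rewrite nth_codom_ord|exact: bP].
Qed.

(** Matrices that are sets of equality patterns suffice for the normal form. They make the basic
    sentences countable, so that [basic_at] can enumerate them. *)
Definition basic := (nat + {n : nat & patset n})%type.

Definition basic_sem (q : basic) (M : domain) (R : set ('I_k -> M)) : Prop :=
  match q with
  | inl n => exists b : 'I_n -> M, injective b
  | inr (existT n P) => covers P R
  end.

Definition basic_fo (q : basic) : fo (sigR k) :=
  match q with
  | inl n => fo_lift _ (distinct_fo n)
  | inr (existT n P) => qmatrix_fo (covers_mx P)
  end.

Lemma basic_fo_sentence q : fo_sentence (basic_fo q).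
Proof.
case: q => [n|[n P]] /=; last exact: qmatrix_fo_sentence.
by rewrite /fo_sentence fo_lift_fv; exact: distinct_fo_sentence.
Qed.

Lemma basic_fo_true q (M : domain) (R : set ('I_k -> M)) :
  fo_true (relmodel R) (basic_fo q) <-> basic_sem q R.
Proof.
case: q => [n|[n P]] /=; last by rewrite qmatrix_fo_true covers_mxP.
by rewrite /fo_true fo_lift_sat; exact: distinct_fo_true.
Qed.

Definition basic_at (i : nat) : basic :=
  if unpickle i : option basic is Some q then q else inl 0.

Lemma basic_atP q : exists i, basic_at i = q.
Proof. by exists (pickle q); rewrite /basic_at pickleK. Qed.

Section FinitelyDetermined.
Variables (N : nat) (p : fo (sigR k)).
Hypothesis pN : forall (M M' : domain) (R : set ('I_k -> M)) (R' : set ('I_k -> M')),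
  (forall i, i < N -> basic_sem (basic_at i) R <-> basic_sem (basic_at i) R') ->
  fo_true (relmodel R) p -> fo_true (relmodel R') p.

Definition type_of (M : domain) (R : set ('I_k -> M)) : {ffun 'I_N -> bool} :=
  [ffun i => `[< basic_sem (basic_at (val i)) R >]].

Definition type_psi (t : {ffun 'I_N -> bool}) : fo sig0 :=
  \big[@FAnd _/fo_top _]_(i : 'I_N)
    if basic_at i is inl n then
      if t i then distinct_fo n else fo_neg (distinct_fo n)
    else fo_top _.

Lemma type_psi_sentence t : fo_sentence (type_psi t).
Proof.
apply: fo_bigand_sentence => i; case: (basic_at i) => [n|_]; last exact: fo_top_sentence.
case: (t i); last rewrite /fo_sentence fo_neg_fv; exact: distinct_fo_sentence.
Qed.

(** The last branch is a placeholder: [at_pred] selects only indices of covering sentences. *)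
Definition at_mx (i : 'I_N) : qmatrix (fun i : 'I_k => val i) :=
  if basic_at i is inr (existT n P) then covers_mx P else covers_mx (n := 0) finset.set0.

Definition at_pred (t : {ffun 'I_N -> bool}) (b : bool) : pred 'I_N :=
  [pred i | (t i == b) && (if basic_at i is inr _ then true else false)].

Definition type_disjunct (t : {ffun 'I_N -> bool}) : disjunct (fun i : 'I_k => val i) :=
  @Disjunct _ _ (type_psi t) (type_psi_sentence t)
    #|at_pred t true| (fun j => at_mx (enum_val j))
    #|at_pred t false| (fun j => at_mx (enum_val j)).

Lemma type_disjunctP t (M : domain) (R : set ('I_k -> M)) :
  [/\ fo_true (bare M) (dj_psi (type_disjunct t)),
    forall j, mx_sem (dj_theta (d := type_disjunct t) j) R &
    forall j, ~ mx_sem (dj_xi (d := type_disjunct t) j) R] <-> type_of R = t.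
Proof.
split=> /= [[/fo_bigand_satP Hp Ht Hx]|<-].
  apply/ffunP => i; rewrite ffunE; have := Hp i isT.
  case E: (basic_at i) => [n|[n P]] /=.
    case: (t i) => [/distinct_fo_true H|/(fo_neg_true _ (distinct_fo_sentence n)) H].
      exact/asboolP.
    by apply/asboolPn => /distinct_fo_true.
  move=> _; have mE : at_mx i = covers_mx P by rewrite /at_mx E.
  case Ei: (t i).
    have iP : i \in at_pred t true by rewrite inE Ei E.
    have := Ht (enum_rank_in iP i); rewrite enum_rankK_in // mE => /covers_mxP H.
    exact/asboolP.
  have iP : i \in at_pred t false by rewrite inE Ei E.
  have := Hx (enum_rank_in iP i); rewrite enum_rankK_in // mE => H.
  by apply/asboolPn => /covers_mxP.
split=> [|j|j].
- apply/fo_bigand_satP => i _; rewrite ffunE.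
  case: (basic_at i) => [n|q]; last exact: fo_top_sat.
  case: asboolP => [/distinct_fo_true//|H].
  by apply/(fo_neg_true _ (distinct_fo_sentence n)) => /distinct_fo_true.
- have : at_pred (type_of R) true (enum_val j) by exact: (enum_valP j).
  rewrite /at_pred /= ffunE /at_mx; case: (basic_at _) => [n|[n P]]; first by rewrite andbF.
  by rewrite andbT eqb_id => /asboolP/covers_mxP.
- have : at_pred (type_of R) false (enum_val j) by exact: (enum_valP j).
  rewrite /at_pred /= ffunE /at_mx; case: (basic_at _) => [n|[n P]]; first by rewrite andbF.
  by rewrite andbT eqbF_neg => /asboolPn + /covers_mxP.
Qed.

(** The sentence is the disjunction of the finitely many types, over the first [N] basic sentences,
    that are realized in one of its models; each type is a disjunct of the normal form. *)
Lemma finitely_determined_normal_form : has_normal_form p.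
Proof.
pose G t := `[< exists (M : domain) (R : set ('I_k -> M)),
  type_of R = t /\ fo_true (relmodel R) p >].
exists (fun i : 'I_k => val i), #|G|, (fun j => type_disjunct (enum_val j)) => M.
pose R : set ('I_k -> M) := rint M tt.
have -> : M = relmodel R.
  rewrite /R; case: M @R => M f r R; congr Model;
    by apply: functional_extensionality_dep => -[].
rewrite normal_form_true; split=> [Rp|[j /type_disjunctP E]].
  have RG : type_of R \in G by apply/asboolP; exists M, R.
  by exists (enum_rank_in RG (type_of R)); apply/type_disjunctP; rewrite enum_rankK_in.
have /asboolP[M' [R' [E' R'p]]] : G (enum_val j) by have := enum_valP j.
apply: pN R'p => i iN.
have := congr1 (fun f : {ffun 'I_N -> bool} => f (Ordinal iN)) (etrans E (esym E')).
rewrite !ffunE /= => H.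
by split=> [h|h]; apply/asboolP; [rewrite H|rewrite -H]; exact/asboolP.
Qed.

End FinitelyDetermined.
End Basic.

(** * Basic equivalence and the main theorem *)

Section BasicEquivalence.
Variable k : nat.

Definition basic_equiv (M M' : domain) (R : set ('I_k -> M)) (R' : set ('I_k -> M')) :=
  forall q : basic k, basic_sem q R <-> basic_sem q R'.

Lemma basic_equiv_sym (M M' : domain) (R : set ('I_k -> M)) (R' : set ('I_k -> M')) :
  basic_equiv R R' -> basic_equiv R' R.
Proof. by move=> H q; rewrite H. Qed.

(** Without a normal form, for no [N] do the first [N] basic sentences determine [p]. The
    ultraproducts of the resulting pairs agree on all basic sentences and still disagree on [p]. *)
Lemma undetermined_pair (p : fo (sigR k)) : fo_sentence p -> ~ has_normal_form p ->
  exists (M M' : domain) (R : set ('I_k -> M)) (R' : set ('I_k -> M')),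
    [/\ fo_true (relmodel R) p, ~ fo_true (relmodel R') p & basic_equiv R R'].
Proof.
move=> p0 nnf; pose T := {M : domain & set ('I_k -> M)}.
have /choice[X XP] : forall N, exists X : T * T,
    [/\ fo_true (relmodel (projT2 X.1)) p, ~ fo_true (relmodel (projT2 X.2)) p &
      forall i, i < N -> basic_sem (basic_at k i) (projT2 X.1) <->
        basic_sem (basic_at k i) (projT2 X.2)].
  move=> N; apply: contrapT => H; apply: nnf.
  apply: (finitely_determined_normal_form (N := N)) => M M' R R' E Rp.
  apply: contrapT => nR'; apply: H.
  by exists (existT _ M R, existT _ M' R').
have [U hU] := free_ultra_exists.
exists (udom hU (fun n => projT1 (X n).1)), (udom hU (fun n => projT1 (X n).2)).
exists (urel hU (fun n => projT2 (X n).1)), (urel hU (fun n => projT2 (X n).2)).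
split=> [||q].
- by apply/los_true => //; apply: (ae_true hU) => n; have [] := XP n.
- by move=> /(los_true hU _ p0)/(ae_ex hU)[n]; have [] := XP n.
rewrite -!basic_fo_true !los_true; try exact: basic_fo_sentence.
have [i <-] := basic_atP q; apply: (ae_iff hU); apply: (ae_mono hU) (ae_ge hU i.+1) => n ni.
by rewrite !basic_fo_true; have [_ _] := XP n; exact.
Qed.

(** Let [P] be the set of patterns that the rows of [R] form with [a]. It covers [R], hence [R'],
    with some parameters [b]; a row of [R'] then shows that [b] is as injective as [a]. *)
Lemma cover_transfer (M M' : domain) (R : set ('I_k -> M)) (R' : set ('I_k -> M'))
    n (a : 'I_n -> M) : basic_equiv R R' -> R' !=set0 -> injective a ->
  exists2 b : 'I_n -> M', injective b & forall y, R' y -> exists2 x, R x &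
    forall p q, sumf x a p = sumf x a q <-> sumf y b p = sumf y b q.
Proof.
move=> RR' [y0 R'y0] ai.
pose P : patset k n := [set q | `[< exists2 x, R x & pattern (sumf x a) = q >]]%SET.
have [b bP] : covers P R'.
  apply/(RR' (inr (existT _ n P))); exists a => x Rx.
  by rewrite inE; apply/asboolP; exists x.
have bP' y : R' y -> exists2 x, R x &
    forall p q, sumf x a p = sumf x a q <-> sumf y b p = sumf y b q.
  move=> /bP; rewrite inE => /asboolP[x Rx /pattern_eq H].
  by exists x.
exists b => // i j bij; have [x _ H] := bP' _ R'y0.
exact/ai/(H (inr i) (inr j)).
Qed.

(** Being covered by the empty set of patterns is a basic sentence saying that the relation is
    empty. *)
Lemma basic_equiv_empty (M M' : domain) (R : set ('I_k -> M)) (R' : set ('I_k -> M')) :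
  basic_equiv R R' -> R' = set0 -> R = set0.
Proof.
move=> RR' R'0; have [m _] := domain_two M'.
have [b bP] : covers (n := 0) finset.set0 R.
  by apply/(RR' (inr (existT _ 0 finset.set0))); exists (fun=> m); rewrite R'0.
by apply/seteqP; split=> // x /bP; rewrite inE.
Qed.

Lemma maximal_injection_bij (M : Type) n (a : 'I_n -> M) : injective a ->
  ~ (exists b : 'I_n.+1 -> M, injective b) ->
  exists2 g, cancel a g & cancel g a.
Proof.
move=> ai nb; have /choice[g gP] : forall m, exists i, a i = m.
  move=> m; apply: contrapT => nm; apply: nb.
  exists (fun i => if unlift ord0 i is Some i' then a i' else m) => i j.
  case: unliftP => [i'|] ->; case: unliftP => [j'|] -> //.
  - by move/ai => ->.
  - by move=> E; case: nm; exists i'.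
  - by move=> E; case: nm; exists j'.
by exists g => // i; apply: ai; exact: gP.
Qed.

Lemma finite_transfer (M M' : domain) (R : set ('I_k -> M)) (R' : set ('I_k -> M'))
    n (a : 'I_n -> M) g (a' : 'I_n -> M') g' :
  basic_equiv R R' -> R' !=set0 -> cancel a g -> cancel g a -> cancel a' g' -> cancel g' a' ->
  exists2 f : 'I_n -> 'I_n, injective f &
    [set y : {ffun 'I_k -> 'I_n} | `[< R' (a' \o y) >]]%SET \subset
    ((fun x : {ffun 'I_k -> 'I_n} => [ffun i => f (x i)]) @:
      [set x : {ffun 'I_k -> 'I_n} | `[< R (a \o x) >]])%SET.
Proof.
move=> RR' R'0 ag ga ag' ga'.
have [b bi bP] := cover_transfer RR' R'0 (can_inj ag).
exists (g' \o b); first exact: (inj_comp (can_inj ga') bi).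
apply/fintype.subsetP => y; rewrite inE => /asboolP/bP[x Rx H].
apply/imsetP; exists [ffun i => g (x i)].
  rewrite inE; apply/asboolP.
  suff -> : a \o [ffun i => g (x i)] = x by [].
  by apply: funext => i /=; rewrite ffunE ga.
apply/ffunP => i; rewrite !ffunE /=; apply: (can_inj ag'); rewrite ga'.
exact: (H (inl i) (inr (g (x i)))).1 (esym (ga (x i))).
Qed.

(** With parameters enumerating the whole domain, [cover_transfer] places each relation inside a
    bijective copy of the other; by counting, the inclusion is an equality. *)
Lemma finite_basic_equiv (M M' : domain) (R : set ('I_k -> M)) (R' : set ('I_k -> M')) n :
  basic_equiv R R' -> (exists b : 'I_n -> M, injective b) ->
  ~ (exists b : 'I_n.+1 -> M, injective b) ->
  exists2 f : M -> M', bijective f & R' = [set f \o x | x in R].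
Proof.
move=> RR' [a ai] na.
have [a' ai'] := (RR' (inl n)).1 (ex_intro _ a ai).
have na' : ~ (exists b : 'I_n.+1 -> M', injective b) by move=> /(RR' (inl n.+1)).
have [g ag ga] := maximal_injection_bij ai na.
have [g' ag' ga'] := maximal_injection_bij ai' na'.
have [R'0|nR'0] := pselect (R' = set0).
  exists (a' \o g); first by exists (a \o g') => m /=; rewrite ?ag ?ag' ?ga ?ga'.
  by rewrite (basic_equiv_empty RR' R'0) image_set0.
have R'0 : R' !=set0 by apply/set0P; apply/eqP.
have R0 : R !=set0.
  by apply/set0P/eqP => R0; apply: nR'0; exact: basic_equiv_empty (basic_equiv_sym RR') R0.
have [f fi sub] := finite_transfer RR' R'0 ag ga ag' ga'.
have [f' fi' sub'] := finite_transfer (basic_equiv_sym RR') R0 ag' ga' ag ga.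
have [h fh hf] := injF_bij fi.
exists (a' \o f \o g).
  by exists (a \o h \o g') => m /=; rewrite ?ag ?ag' ?fh ?hf ?ga ?ga'.
have /eqP E : ([set y : {ffun 'I_k -> 'I_n} | `[< R' (a' \o y) >]] ==
    (fun x : {ffun 'I_k -> 'I_n} => [ffun i => f (x i)]) @:
      [set x : {ffun 'I_k -> 'I_n} | `[< R (a \o x) >]])%SET.
  rewrite eqEcard sub /=; apply: leq_trans (leq_imset_card _ _) _.
  by apply: leq_trans (subset_leq_card sub') _; exact: leq_imset_card.
apply/seteqP; split=> [y R'y|_ [x Rx <-]].
  have : [ffun i => g' (y i)] \in [set y : {ffun 'I_k -> 'I_n} | `[< R' (a' \o y) >]]%SET.
    rewrite inE; apply/asboolP; suff -> : a' \o [ffun i => g' (y i)] = y by [].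
    by apply: funext => i /=; rewrite ffunE ga'.
  rewrite E => /imsetP[x]; rewrite inE => /asboolP Rx yx; exists (a \o x) => //.
  apply: funext => i /=; rewrite ag.
  have := congr1 (fun z : {ffun 'I_k -> 'I_n} => z i) yx; rewrite !ffunE => <-.
  exact: ga'.
have : [ffun i => f (g (x i))] \in [set y : {ffun 'I_k -> 'I_n} | `[< R' (a' \o y) >]]%SET.
  rewrite E; apply/imsetP; exists [ffun i => g (x i)]; last by apply/ffunP => i; rewrite !ffunE.
  rewrite inE; apply/asboolP; suff -> : a \o [ffun i => g (x i)] = x by [].
  by apply: funext => i /=; rewrite ffunE ga.
rewrite inE => /asboolP; set y := (X in R' X); set z := (X in _ -> R' X).
suff -> : y = z by [].
by apply: funext => i; rewrite /y /z /= ffunE.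
Qed.

Lemma infinite_injection (M : Type) : (forall n, exists b : 'I_n -> M, injective b) ->
  exists h : nat -> M, injective h.
Proof.
move=> Minf; have /choice[fresh fP] : forall l : seq M, exists m,
    forall i, i < size l -> nth m l i <> m.
  move=> l; have [b bi] := Minf (size l).+1; apply: contrapT => nf.
  have /choice[c cP] : forall i, exists j : 'I_(size l), nth (b i) l j = b i.
    move=> i; apply: contrapT => nj; apply: nf; exists (b i) => j jl E.
    by apply: nj; exists (Ordinal jl).
  have ci : injective c.
    move=> i j ij; apply: bi; rewrite -cP -[RHS]cP ij; exact: set_nth_default.
  by have := leq_card c ci; rewrite !card_ord ltnn.
pose L n := iter n (fun l => fresh l :: l) [::].
have szL n : size (L n) = n by elim: n => //= n ->.
have nthL m i n : i < n -> nth m (L n) (n - i.+1) = fresh (L i).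
  elim: n => // n IH; rewrite ltnS leq_eqVlt => /orP[/eqP ->|lt]; first by rewrite subnn.
  by rewrite subSS -subnSK //= IH.
have lt i j : i < j -> fresh (L i) <> fresh (L j).
  move=> ij E; apply: (fP (L j) (j - i.+1)); last by rewrite nthL.
  by rewrite szL ltn_subrL (leq_ltn_trans _ ij).
exists (fun n => fresh (L n)) => i j E; case: (ltngtP i j) => // /lt.
  by rewrite E.
by rewrite E.
Qed.

Lemma basic_equiv_nat (p : fo (sigR k)) (M : domain) (R : set ('I_k -> M)) :
  fo_sentence p -> (forall n, exists b : 'I_n -> M, injective b) ->
  exists R0 : set ('I_k -> natD),
    (fo_true (relmodel R) p <-> fo_true (relmodel R0) p) /\ basic_equiv R R0.
Proof.
move=> p0 /infinite_injection[h hi].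
pose q n := if n is n'.+1 then basic_fo (basic_at k n') else p.
have [|e [_ _ _ eP]] := lowenheim_skolem (q := q) (fun _ _ => R) (fun _ _ => h 0) hi.
  by case=> [|n] //=; exact: basic_fo_sentence.
exists [set w | R (e \o w)]; split; first exact: (eP 0 [::]).
move=> b; have [i <-] := basic_atP b; rewrite -!basic_fo_true.
exact: (eP i.+1 [::]).
Qed.

Definition embeds (R Q : set ('I_k -> natD)) : Prop :=
  exists f g : nat -> nat, [/\ cancel f g, cancel g f & forall x, R x -> Q (f \o x)].

(** Whether [f \o x] lies in the invariant [Q] depends only on the pattern of [x] with the points
    that [f] sends to 0, ..., n - 1; [cover_transfer] finds corresponding points for [R']. *)
Lemma embeds_transfer (R R' Q : set ('I_k -> natD)) n : basic_equiv R R' -> R' !=set0 ->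
  invariant_under (ccol n) Q -> embeds R Q -> embeds R' Q.
Proof.
move=> RR' R'0 Qi [f [g [fg gf RQ]]].
have ai : injective (fun i : 'I_n => g i) by move=> i j /(can_inj gf)/val_inj.
have [b bi bP] := cover_transfer (M := natD) (M' := natD) RR' R'0 ai.
have [|f' [g' [fg' gf' _ fb]]] := @sim_perm n unit nat (fun=> tt) b (fun i => val i).
  by split=> // i j; split=> [/bi ->|/val_inj ->].
exists f', g'; split=> // y /bP[x Rx H]; apply: Qi (RQ _ Rx); split=> [i j|i] /=.
  split=> [/(can_inj fg)/(H (inl i) (inl j))|/(can_inj fg')/(H (inl i) (inl j))] /= -> //.
apply: ccolP => lt.
  have xE : x i = g (f (x i)) by rewrite fg.
  have /= -> := (H (inl i) (inr (Ordinal lt))).1 xE.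
  by rewrite fb.
have yE : y i = b (Ordinal lt) by apply: (can_inj fg'); rewrite fb.
have /= -> := (H (inl i) (inr (Ordinal lt))).2 yE.
by rewrite gf.
Qed.

End BasicEquivalence.

(** The closure [Q'] of the copy of [R] is again invariant, so the step can be repeated below [P],
    with this dependency or with its complement. *)
Lemma embeds_step (E : dependency) (R Q : set ('I_(dep_arity E) -> natD)) n :
  strongly_fo E -> dep_mem E R -> R !=set0 -> invariant_under (ccol n) Q -> embeds R Q ->
  exists (P Q' : set ('I_(dep_arity E) -> natD)) n',
    [/\ dep_mem E P, P !=set0, Q' `<=` P /\ P `<=` Q, invariant_under (ccol n') Q' &
      embeds R Q'].
Proof.
move=> Es ER [x0 Rx0] Qi [f [g [fg gf RQ]]].
pose fR : set ('I_(dep_arity E) -> natD) := [set f \o x | x in R].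
have fRQ : between fR Q.
  exists fR; split=> //; first by apply: (dep_iso (M := natD) (N := natD)) ER; exists g.
    by move=> _ [x Rx <-]; exact: RQ.
  by exists (f \o x0), x0.
have [n' [P [EP TP PQ P0]]] := finite_support_closure Es Qi fRQ.
exists P, (tr (ccol n') (ccol n') fR), n'; split=> //; first exact: tr_invariant.
by exists f, g; split=> // x Rx; apply: sub_tr; exists x.
Qed.

Lemma basic_equiv_mem (D : dependency) (R R' : set ('I_(dep_arity D) -> natD)) :
  strongly_fo D -> strongly_fo (dep_compl D) -> basic_equiv R R' ->
  dep_mem D R -> dep_mem D R'.
Proof.
move=> Ds Dcs RR' DR; apply: contrapT => nDR'.
have R'R := basic_equiv_sym RR'.
have R'0 : R' !=set0.
  by apply/set0P/eqP => R'0; apply: nDR'; rewrite R'0 -(basic_equiv_empty RR' R'0).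
have R0 : R !=set0.
  by apply/set0P/eqP => R0; apply: nDR'; rewrite (basic_equiv_empty R'R R0) -R0.
(* Copies of both relations are maintained, so that the next term can be taken in [D] or outside it;
   [embeds_transfer] restores the copy that a step does not provide. *)
pose good Q := exists n, [/\ invariant_under (ccol n) Q, embeds R Q & embeds R' Q].
have step (Q : {Q | good Q}) : exists f : bool -> set ('I_(dep_arity D) -> natD) * {Q | good Q},
    forall b, [/\ dep_mem D (f b).1 <-> b, (f b).1 !=set0, sval (f b).2 `<=` (f b).1 &
      (f b).1 `<=` sval Q].
  have [n [Qi RQ R'Q]] := svalP Q.
  have [P [Q1 [n1 [DP P0 [QP PQ] Q1i RQ1]]]] := embeds_step Ds DR R0 Qi RQ.
  have [P' [Q2 [n2 [DP' P'0 [QP' PQ'] Q2i R'Q2]]]] := embeds_step Dcs nDR' R'0 Qi R'Q.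
  have G1 : good Q1 by exists n1; split=> //; exact: embeds_transfer RR' R'0 Q1i RQ1.
  have G2 : good Q2 by exists n2; split=> //; exact: embeds_transfer R'R R0 Q2i R'Q2.
  by exists (fun b => if b then (P, exist _ Q1 G1) else (P', exist _ Q2 G2)) => -[].
have [next nextP] := choice step.
have GT : good setT by exists 0; split=> //; exists id, id.
pose st := fix st j := if j is j'.+1 then (next (st j') (~~ odd j')).2 else exist good setT GT.
apply: (no_alternating_chain Ds Dcs (P := fun j => (next (st j) (~~ odd j)).1)) => j.
- apply: (subset_trans (B := sval (st j.+1))); first by have [] := nextP (st j.+1) (~~ odd j.+1).
  by have [] := nextP (st j) (~~ odd j).
- by have [] := nextP (st j) (~~ odd j).
- by have [] := nextP (st j) (~~ odd j).
Qed.

(** Basically equivalent relations have domains that are both infinite, and then move to nat, or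
    both finite, and then they are isomorphic. *)
Lemma strongly_fo_normal_form (D : dependency) (p : fo (sigR (dep_arity D))) :
  fo_sentence p -> defines D p -> strongly_fo D -> strongly_fo (dep_compl D) ->
  has_normal_form p.
Proof.
move=> p0 Dp Ds Dcs; apply: contrapT => /(undetermined_pair p0).
move=> [M [M' [R [R' [Rp nR'p RR']]]]].
have [Minf|nMinf] := pselect (forall n, exists b : 'I_n -> M, injective b).
  have M'inf n : exists b : 'I_n -> M', injective b.
    exact/(RR' (inl n))/Minf.
  have [R0 [RR0 eR]] := basic_equiv_nat R p0 Minf.
  have [R0' [RR0' eR']] := basic_equiv_nat R' p0 M'inf.
  apply: nR'p; apply/RR0'/Dp; apply: (basic_equiv_mem Ds Dcs (R := R0)).
    by move=> q; rewrite -eR RR' eR'.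
  exact/Dp/RR0.
have ex : exists n, ~~ `[< exists b : 'I_n -> M, injective b >].
  by apply: contrapT => H; apply: nMinf => n; apply: contrapT => /asboolPn nb; apply: H; exists n.
(* The least number of points that cannot be chosen distinct is positive, the empty choice being
   injective; its predecessor is the size of the domain. *)
case: (ex_minnP ex) => -[|n] /asboolPn nb nmin.
  by apply: nb; have [m _] := domain_two M; exists (fun=> m) => -[].
have [|f fb E] := finite_basic_equiv RR' (n := n) _ nb.
  apply: contrapT => /asboolPn /nmin; by rewrite ltnn.
by apply: nR'p; apply/Dp; rewrite E; apply: dep_iso fb _; exact/Dp.
Qed.

Lemma in_logic_mono (S : signature) (A B : set (atom S)) g (p : tform S) :
  A `<=` B -> in_logic A g p -> in_logic B g p.
Proof.
move=> AB; elim: p => //= [a x /AB//|p IHp q IHq|p IHp q IHq|p IHp q IHq].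
- by move=> [/IHp ? /IHq ?].
- by move=> [/IHp ? /IHq ?].
- by move=> [? /IHp ? /IHq ?].
Qed.

Lemma strongly_fo_sub (F G : set dependency) :
  F `<=` G -> strongly_fo_family G -> strongly_fo_family F.
Proof.
move=> FG Gs S p Fp p0; apply: Gs => //; apply: in_logic_mono Fp.
exact: image_subset.
Qed.

Theorem theorem8 (D : dependency) (DR : fo (sigR (dep_arity D)))
    (DR_sentence : fo_sentence DR) (DR_defines : defines D DR)
    (D_relativizable : relativizable D) :
  [<-> has_normal_form DR;
       definable_in (@FO_D0_gor_const_all sig0) D /\
         definable_in (@FO_D0_gor_const_all sig0) (dep_compl D);
       doubly_strongly_fo D;
       strongly_fo D /\ strongly_fo (dep_compl D)].
Proof.
tfae.
- exact: normal_form_definable.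
- move=> [D1 D2]; apply: nf_strongly_fo => E [->|->]; exact: nf_dep_definable.
- by move=> H; split; apply: strongly_fo_sub H => E ->; [left|right].
- by move=> [Ds Dcs]; exact: strongly_fo_normal_form.
Qed.
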